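(* Let $n\geq 1$ be an integer, let $\mathbb{T}^n=\mathbb{R}^n/\mathbb{Z}^n$, let $F\colon T\mathbb{T}^n\to\mathbb{R}$ be a flat, reversible Finsler norm on $\mathbb{T}^n$, and let $c$ be a (normalized) symplectic capacity on symplectic manifolds of dimension $2n$. Then \[ c(D_F^*\mathbb{T}^n,\omega_{\mathrm{can}})\leq 2\,\mathrm{sys}(F). \] If, in addition, at least one of the following two conditions holds: \begin{enumerate} \item there is a Finsler norm $G$ on $\mathbb{T}^n$ induced by a flat Riemannian metric such that $F\geq G$ (pointwise on $T\mathbb{T}^n$) and $\mathrm{sys}(F)=\mathrm{sys}(G)$, or \item $c\geq c_{\mathrm{HZ}}$, where $c_{\mathrm{HZ}}$ denotes the Hofer--Zehnder capacity, \end{enumerate} then \[ c(D_F^*\mathbb{T}^n,\omega_{\mathrm{can}})= 2\,\mathrm{sys}(F). \]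
   Context: **Normalized symplectic capacity.** A (normalized) symplectic capacity in dimension $2n$ is a function $c$ assigning to each symplectic manifold $(M,\omega)$ of dimension $2n$ a value $c(M,\omega)\in[0,\infty]$ such that: - (Embedding) if there is a symplectic embedding $\varphi\colon(M_1,\omega_1)\to(M_2,\omega_2)$ (both manifolds of dimension $2n$), then $c(M_1,\omega_1)\leq c(M_2,\omega_2)$; - (Scaling) if $r>0$, then $c(M,r\omega)=r\,c(M,\omega)$; - (Normalization) for every $r>0$, $c(B_r,\omega_0)=\pi r^2=c(Z_r,\omega_0)$, where $\omega_0=\sum_{j=1}^n \mathrm{d}x_j\wedge \mathrm{d}y_j$ is the standard symplectic form on $\mathbb{C}^n$ (with coordinates $z_j=x_j+iy_j$), $B_r\subset\mathbb{C}^n$ is the open Euclidean ball of radius $r$ centered at $0$, and $Z_r=D_r\times\mathbb{C}^{n-1}$, with $D_r\subset\mathbb{C}$ the open disc of radius $r$ centered at $0$. **Hofer--Zehnder capacity.** For a symplectic manifold $(M,\omega)$, $c_{\mathrm{HZ}}(M,\omega)\in[0,\infty]$ is the supremum of $\max H$ over all smooth functions $H\colon M\to[0,\infty)$ such that: (i) there are a compact set $C\subset M\setminus\partial M$ and a constant $m(H)$ with $H=m(H)$ on $M\setminus C$ and $0\leq H\leq m(H)$ on $M$ (so $\max H=m(H)$); (ii) $H=0$ on some nonempty open subset of $M$; (iii) every periodic orbit of the Hamiltonian vector field $X_H$ (defined by $\omega(X_H,\cdot)=\pm\mathrm{d}H$; the sign is irrelevant) of period $T$ with $0<T\leq 1$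 is constant. The condition $c\geq c_{\mathrm{HZ}}$ means $c(M,\omega)\geq c_{\mathrm{HZ}}(M,\omega)$ for all symplectic manifolds $(M,\omega)$ of dimension $2n$. **Finsler norms.** Let $Q$ be a closed manifold. A Finsler norm $F\colon TQ\to\mathbb{R}$ is a function, continuous on $TQ$ and smooth away from the zero section, whose restriction to each tangent space is positive on nonzero vectors, positively homogeneous of degree $1$, and convex. It is reversible if $F(q,v)=F(q,-v)$ for all $(q,v)\in TQ$. A Finsler norm $F$ on $\mathbb{T}^n$ is flat if, in the global trivialization $T\mathbb{T}^n=\mathbb{T}^n\times\mathbb{R}^n$ induced by the quotient map $\mathbb{R}^n\to\mathbb{T}^n$, there is $f\colon\mathbb{R}^n\to\mathbb{R}$ with $F(q,v)=f(v)$ for all $(q,v)\in\mathbb{T}^n\times\mathbb{R}^n$. A Finsler norm $G$ is induced by a Riemannian metric $g$ if $G(q,v)=\sqrt{g_q(v,v)}$ for all $(q,v)$; for a flat Riemannian metric on $\mathbb{T}^n$, $g_q=g$ is an inner product on $\mathbb{R}^n$ independent of $q$ in the global trivialization $T\mathbb{T}^n=\mathbb{T}^n\times\mathbb{R}^n$ induced by the quotient map $\mathbb{R}^n\to\mathbb{T}^n$. **Disc cotangent bundle.** The dual norm $F^*\colon T^*Q\to\mathbb{R}$ is \[ F^*(q,p):=\sup\{p\cdot v\mid v\in T_qQ,\ F(q,v)<1\}, \] and $D_F^*Q:=\{(q,p)\in T^*Q\mid F^*(q,p)<1\}$. It carries the canonical symplectic form $\omega_{\mathrm{can}}=\sum_{i=1}^n\mathrm{d}p_i\wedge\mathrm{d}q_i$.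 **Systole.** Finsler geodesics are the extremals of the Finsler length $\ell_F(q):=\int_a^bF(q(t),\dot q(t))\,\mathrm{d}t$ at fixed endpoints. $\mathrm{sys}(F)$ denotes the Finsler length of the shortest non-contractible closed geodesic on $Q$. *)

(* Defs.v *)
From HB Require Import structures.
From mathcomp Require Import all_boot all_order all_algebra.
From mathcomp Require Import generic_quotient.
From mathcomp Require Import all_classical all_reals all_analysis.
From mathcomp Require Import ring lra zify.

Set Implicit Arguments.
Unset Strict Implicit.
Unset Printing Implicit Defensive.

Import Order.TTheory GRing.Theory Num.Theory.
Import numFieldNormedType.Exports.

Local Open Scope classical_set_scope.
Local Open Scope ring_scope.

Section smooth.
Context {R : realType}.

(* For open [U] : of class C^k iff differentiable with all the directional
   derivatives of class C^(k-1). *)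
Fixpoint Ck {V W : normedModType R} (k : nat) (U : set V) (f : V -> W) : Prop :=
  if k is k'.+1 then
    (forall x, U x -> differentiable f x) /\ forall v, Ck k' U ('D_v f)
  else forall x, U x -> {for x, continuous f}.

Definition Cinfty {V W : normedModType R} (U : set V) (f : V -> W) : Prop :=
  forall k, Ck k U f.

Lemma CkS (V W : normedModType R) k (U U' : set V) (f : V -> W) :
  U' `<=` U -> Ck k U f -> Ck k U' f.
Proof.
elim: k f => [|k IH] f sU /=; first by move=> h x /sU; exact: h.
by case=> h1 h2; split => [x /sU|v]; [exact: h1 | exact: IH].
Qed.

Lemma Ck_cst (V W : normedModType R) k (U : set V) (c : W) : Ck k U (cst c).
Proof.
elim: k c => [|k IH] c /=; first by move=> x _; exact: cst_continuous.
split=> [x _|v]; first exact: differentiable_cst.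
rewrite (_ : 'D_v (cst c) = cst 0) //; apply/funext => x.
exact: derive_cst.
Qed.

Lemma Cinfty_cst (V W : normedModType R) (U : set V) (c : W) : Cinfty U (cst c).
Proof. by move=> k; exact: Ck_cst. Qed.

Lemma near_differentiable (V W : normedModType R) (f g : V -> W) (x : V) :
  (\near x, f x = g x) -> differentiable f x -> is_diff x g ('d f x).
Proof.
move=> fg df; have [c e] := (diff_locallyP _ _).1 df.
have fgx : f x = g x by exact: nbhs_singleton fg.
have e' : g \o shift x = cst (g x) + 'd f x +o_ 0 id.
  apply/eqaddoP => eps eps0; move/eqaddoP : e => /(_ eps eps0).
  have fg' : \forall h \near (0 : V), f (h + x) = g (h + x).
    by move: fg; rewrite (near_shift 0 x) /= => fg; apply: filterS fg => h /=;
      rewrite subr0.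
  by apply: filterS2 fg' => h /= E; rewrite !fctE /= E fgx.
have E : 'd g x = 'd f x :> (V -> W) by exact: diff_unique.
have dg : differentiable g x.
  by apply/diff_locallyP; rewrite E; split.
exact: DiffDef dg E.
Qed.

Lemma open_near (V W : normedModType R) (U : set V) (f g : V -> W) (x : V) :
  open U -> (forall x, U x -> f x = g x) -> U x -> \near x, f x = g x.
Proof. by move=> oU fg Ux; apply: filterS (open_nbhs_nbhs (conj oU Ux)). Qed.

Lemma eq_Ck (V W : normedModType R) k (U : set V) (f g : V -> W) :
  open U -> (forall x, U x -> f x = g x) -> Ck k U f -> Ck k U g.
Proof.
move=> oU; elim: k f g => [|k IH] f g fg /=.
  move=> h x Ux; suff : g @ x --> g x by [].
  rewrite -(fg _ Ux); by apply: cvg_trans (h x Ux); apply: near_eq_cvg; exact: open_near oU fg Ux.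
case=> h1 h2; split=> [x Ux|v].
  by have [] := near_differentiable (open_near oU fg Ux) (h1 _ Ux).
apply: IH (h2 v) => x Ux; apply: near_eq_derive; exact: open_near oU fg Ux.
Qed.

Lemma Ck_scale (V W : normedModType R) k (U : set V) (f : V -> W) (c : R) :
  open U -> Ck k U f -> Ck k U (c *: f).
Proof.
move=> oU; elim: k f => [|k IH] f /=.
  by move=> h x Ux; apply: cvgZl_tmp; exact: h.
case=> h1 h2; split=> [x Ux|v]; first exact: differentiableZ (h1 x Ux).
apply: eq_Ck (IH _ (h2 v)) => // x Ux.
by rewrite deriveZ //; exact/diff_derivable/h1.
Qed.

Lemma Cinfty_scale (V W : normedModType R) (U : set V) (f : V -> W) (c : R) :
  open U -> Cinfty U f -> Cinfty U (c *: f).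
Proof. by move=> oU h k; exact: Ck_scale. Qed.

Lemma diff_translation (V : normedModType R) (c x : V) :
  is_diff x (fun y : V => y + c) (idfun : V -> V).
Proof.
have := @is_diffD R V V idfun (cst c) idfun 0 x _ _.
by rewrite addr0; exact.
Qed.

Lemma Cinfty_translation (V : normedModType R) (U : set V) (c : V) :
  Cinfty U (fun y => y + c).
Proof.
have D x := diff_translation c x.
case=> [|k] /=.
  move=> x _; apply: differentiable_continuous.
  exact: (@ex_diff _ _ _ _ _ _ _ (D x)).
split=> [x _|v]; first exact: (@ex_diff _ _ _ _ _ _ _ (D x)).
rewrite (_ : 'D_v _ = cst v); first exact: Ck_cst.
apply/funext => x; rewrite deriveE; last exact: (@ex_diff _ _ _ _ _ _ _ (D x)).
by rewrite (@diff_val _ _ _ _ _ _ _ (D x)).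
Qed.

End smooth.

Section manifolds.
Context (R : realType).

(* The chart [i] is meant to be defined on [cs_dom i], with values in the model
   space: R^m, or a closed half-space if [cs_bdry i] holds. *)
Record charted_space (m : nat) := ChartedSpace {
  cs_carrier :> topologicalType ;
  cs_index : Type ;
  cs_dom : cs_index -> set cs_carrier ;
  cs_bdry : cs_index -> bool ;
  cs_chart : cs_index -> cs_carrier -> 'rV[R]_m }.

Definition model_space {m : nat} (bdry : bool) : set 'rV[R]_m :=
  if bdry then [set x | forall i : 'I_m, i = 0%N :> nat -> 0 <= x 0 i]
  else setT.

(* [g] is a smooth function on a neighbourhood, open in R^m, of the coordinates
   of [p] in the chart [i], which represents there the restriction of [f] to
   [O].  At a point in the boundary, [g] is thus a smooth extension; when [O] is
   open, the derivatives of [g] at the coordinates of [p] only depend on [f]. *)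
Definition local_rep m (M : charted_space m) (W : normedModType R)
    (O : set M) (f : M -> W) (i : cs_index M) (p : M) (g : 'rV[R]_m -> W) :=
  exists U : set 'rV[R]_m,
    [/\ open U, U (cs_chart i p), Cinfty U g &
        forall q, O q -> cs_dom i q -> U (cs_chart i q) -> f q = g (cs_chart i q)].

Definition smooth_on m (M : charted_space m) (W : normedModType R)
    (O : set M) (f : M -> W) :=
  forall p, O p -> forall i, cs_dom i p -> exists g, local_rep O f i p g.

(* Smooth manifolds of dimension m, possibly with boundary. *)
Record manifold (m : nat) := Manifold {
  mf_space :> charted_space m ;
  mf_hausdorff : hausdorff_space mf_space ;
  mf_second_countable : @second_countable mf_space ;
  mf_cover : forall p : mf_space, exists i, cs_dom i p ;
  mf_dom_open : forall i : cs_index mf_space, open (cs_dom i) ;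
  mf_chart_inj : forall (i : cs_index mf_space) p q,
    cs_dom i p -> cs_dom i q -> cs_chart i p = cs_chart i q -> p = q ;
  mf_chart_continuous : forall (i : cs_index mf_space) p,
    cs_dom i p -> {for p, continuous (cs_chart i)} ;
  mf_chart_open : forall (i : cs_index mf_space) (A : set mf_space),
    open A -> A `<=` cs_dom i ->
    exists2 V, open V & cs_chart i @` A = V `&` model_space (cs_bdry i) ;
  mf_compatible : forall j : cs_index mf_space,
    smooth_on (cs_dom j) (cs_chart j) }.

Definition manifold_interior m (M : manifold m) : set M :=
  [set p | exists2 i, cs_dom i p & interior (cs_chart i @` cs_dom i) (cs_chart i p)].

Definition smooth_map m1 m2 (M1 : manifold m1) (M2 : manifold m2)
    (f : M1 -> M2) :=
  continuous f /\
  forall j : cs_index M2, smooth_on (f @^-1` cs_dom j) (cs_chart j \o f).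

Definition form_eval m (W : 'M[R]_m) (u v : 'rV[R]_m) : R :=
  (u *m W *m v^T) 0 0.

Lemma form_evalZ m (W : 'M[R]_m) (r : R) u v :
  form_eval (r *: W) u v = r * form_eval W u v.
Proof. by rewrite /form_eval -scalemxAr -scalemxAl mxE. Qed.

(* The form is given by the matrix [sm_form i p] of its value at [p] in the
   coordinates of the chart [i].  Since ['J g x] acts on row vectors on the
   right, the pullback of [W] by [g] has the matrix ['J g x *m W *m ('J g x)^T]. *)
Record symplectic_manifold (m : nat) := SymplecticManifold {
  sm_manifold :> manifold m ;
  sm_form : cs_index sm_manifold -> sm_manifold -> 'M[R]_m ;
  sm_smooth : forall i, smooth_on (cs_dom i) (sm_form i) ;
  sm_compatible : forall i j p g, cs_dom i p -> cs_dom j p ->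
    local_rep (cs_dom j) (cs_chart j) i p g ->
    sm_form i p =
      'J g (cs_chart i p) *m sm_form j p *m ('J g (cs_chart i p))^T ;
  sm_skew : forall i p, cs_dom i p -> (sm_form i p)^T = - sm_form i p ;
  sm_nondegenerate : forall i p, cs_dom i p -> sm_form i p \in unitmx ;
  sm_closed : forall i p w, cs_dom i p ->
    local_rep (cs_dom i) (sm_form i) i p w ->
    forall u v z,
      form_eval ('D_u w (cs_chart i p)) v z
      + form_eval ('D_v w (cs_chart i p)) z u
      + form_eval ('D_z w (cs_chart i p)) u v = 0 }.

(* The differential of [f] is injective because [f] pulls the second form back
   to the first one, so it is not required separately. *)
Definition symplectic_embedding m (M1 M2 : symplectic_manifold m)
    (f : M1 -> M2) :=
  [/\ smooth_map f,
      injective f,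
      forall A : set M1, open A ->
        exists2 B : set M2, open B & f @` A = B `&` range f &
      forall i j p g, cs_dom i p -> cs_dom j (f p) ->
        local_rep (f @^-1` cs_dom j) (cs_chart j \o f) i p g ->
        sm_form i p =
          'J g (cs_chart i p) *m sm_form j (f p) *m ('J g (cs_chart i p))^T].

End manifolds.
#[global] Arguments model_space {R m} bdry.
#[global] Arguments manifold_interior {R m} M.

Section scaling.
Context {R : realType} (m : nat) (M : symplectic_manifold R m).
Variables (r : R) (r0 : 0 < r).

Definition scale_form (i : cs_index M) p := r *: sm_form i p.

Fact scale_form_smooth i : smooth_on (cs_dom i) (scale_form i).
Proof.
move=> p ip j jp; have [g [U [oU Up gU gE]]] := sm_smooth ip jp.
exists (r *: g); exists U; split => //; first exact: Cinfty_scale.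
by move=> q iq jq Uq; rewrite /scale_form gE.
Qed.

Fact scale_form_compatible i j p g : cs_dom i p -> cs_dom j p ->
  local_rep (cs_dom j) (cs_chart j) i p g ->
  scale_form i p = 'J g (cs_chart i p) *m scale_form j p *m ('J g (cs_chart i p))^T.
Proof.
move=> ip jp h; rewrite /scale_form (sm_compatible ip jp h).
by rewrite -scalemxAr -scalemxAl.
Qed.

Fact scale_form_skew i p : cs_dom i p -> (scale_form i p)^T = - scale_form i p.
Proof. by move=> ip; rewrite /scale_form linearZ /= sm_skew // scalerN. Qed.

Fact scale_form_nondegenerate i p : cs_dom i p -> scale_form i p \in unitmx.
Proof. by move=> ip; rewrite /scale_form unitmxZ ?unitfE ?gt_eqF // sm_nondegenerate. Qed.

Fact scale_form_closed i p w : cs_dom i p -> local_rep (cs_dom i) (scale_form i) i p w ->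
  forall u v z,
    form_eval ('D_u w (cs_chart i p)) v z
    + form_eval ('D_v w (cs_chart i p)) z u
    + form_eval ('D_z w (cs_chart i p)) u v = 0.
Proof.
move=> ip [U [oU Up wU wE]] u v z.
have rN0 : r != 0 by rewrite gt_eqF.
have rep : local_rep (cs_dom i) (sm_form i) i p (r^-1 *: w).
  exists U; split => //; first exact: Cinfty_scale.
  by move=> q iq _ Uq; rewrite fctE -wE // /scale_form scalerA mulVf // scale1r.
have dw : differentiable w (cs_chart i p) by have [+ _] := wU 1%N; apply.
have := sm_closed ip rep u v z.
have E v1 : 'D_v1 (r^-1 *: w) (cs_chart i p) = r^-1 *: 'D_v1 w (cs_chart i p).
  by apply: deriveZ; exact: diff_derivable.
rewrite (E u) (E v) (E z).
move: ('D_u w _) ('D_v w _) ('D_z w _) => A B C.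
rewrite (form_evalZ A) (form_evalZ B) (form_evalZ C) => h.
apply: (mulfI (invr_neq0 rN0)).
by rewrite mulr0 -[RHS]h (mulrDr r^-1) (mulrDr r^-1).
Qed.

Definition scale_symplectic : symplectic_manifold R m :=
  SymplecticManifold scale_form_smooth scale_form_compatible scale_form_skew
    scale_form_nondegenerate scale_form_closed.

End scaling.

Section open_submanifold.
Context {R : realType} (m : nat).

Section sub_manifold.
Variables (M : manifold R m) (O : set M) (oO : open O).

Definition sub_charts : charted_space R m :=
  @ChartedSpace R m O (cs_index M) (fun i => set_val @^-1` cs_dom i)
    (@cs_bdry _ _ M) (fun i => cs_chart i \o set_val).
Local Notation S := sub_charts.

Fact sub_val_cont : continuous (set_val : O -> M).
Proof. exact: initial_continuous. Qed.

Fact sub_valO (p : S) : O (set_val p).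
Proof. exact: set_valP. Qed.

Fact sub_val_img (A : set S) : open A -> open (set_val @` A).
Proof.
case=> B oB <-; rewrite (_ : _ @` _ = B `&` O); first exact: openI.
apply/seteqP; split => [x [y By <-]|x [Bx Ox]].
  by split => //; exact: (sub_valO y).
by exists (exist _ x (mem_set Ox)).
Qed.

Lemma sub_local_rep (W : normedModType R) (A : set M) (f : M -> W) i (p : S) g :
  local_rep A f i (set_val p) g ->
  @local_rep _ _ S W (set_val @^-1` A) (f \o set_val) i p g.
Proof.
move=> [U [oU Up gU gE]]; exists U; split => //= q; exact: gE.
Qed.

Lemma local_rep_sub (W : normedModType R) (A : set M) (f : M -> W) i (p : S) g :
  cs_dom i (set_val p) ->
  @local_rep _ _ S W (set_val @^-1` A) (f \o set_val) i p g ->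
  local_rep A f i (set_val p) g.
Proof.
move=> ip [U [oU Up gU gE]].
have [V oV VE] : exists2 V, open V & cs_chart i @` (cs_dom i `&` O)
    = V `&` model_space (cs_bdry i).
  by apply: mf_chart_open => //; apply: openI => //; exact: mf_dom_open.
have [V' oV' VE'] : exists2 V, open V & cs_chart i @` cs_dom i
    = V `&` model_space (cs_bdry i).
  by apply: mf_chart_open => //; exact: mf_dom_open.
exists (U `&` V); split; first exact: openI.
- split=> //; have : (cs_chart i @` (cs_dom i `&` O)) (cs_chart i (set_val p)).
    by exists (set_val p) => //; split => //; exact: (sub_valO p).
  by rewrite VE => -[].
- move=> k; apply: CkS (gU k); exact: subIsetl.
- move=> q Aq iq [Uq Vq].
  have : (cs_chart i @` (cs_dom i `&` O)) (cs_chart i q).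
    rewrite VE; split => //.
    have : (cs_chart i @` cs_dom i) (cs_chart i q) by exists q.
    by rewrite VE' => -[].
  move=> [q' [iq' Oq'] E]; have Eq := mf_chart_inj iq' iq E.
  rewrite {q' iq' E}Eq in Oq'.
  exact: (gE (exist _ q (mem_set Oq'))).
Qed.

Fact sub_hausdorff : hausdorff_space S.
Proof.
move=> p q pq; apply: val_inj; apply: (@mf_hausdorff _ _ M) => A B nA nB.
have [x [Ax Bx]] := pq _ _ (sub_val_cont nA) (sub_val_cont nB).
by exists (set_val x).
Qed.

Fact sub_second_count : @second_countable S.
Proof.
have [B cB [oB bB]] := mf_second_countable M.
exists ((fun A => set_val @^-1` A) @` B); first exact: card_le_trans (card_image_le _ _) cB.
split=> [_ [A BA <-]|p A]; first by exists A => //; exact: oB.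
rewrite nbhsE => -[C [[D oD <-] Dp] CA].
have [E [BE Ep] ED] := bB (set_val p) D (open_nbhs_nbhs (conj oD Dp)).
exists (set_val @^-1` E); first by split=> //; exists E.
by move=> q Eq; apply: CA; exact: ED.
Qed.

Fact sub_cover (p : S) : exists i, cs_dom i p.
Proof. exact: (@mf_cover _ _ M). Qed.

Fact sub_dom_open (i : cs_index S) : open (cs_dom i).
Proof. by exists (@cs_dom _ _ M i) => //; exact: mf_dom_open. Qed.

Fact sub_chart_inj (i : cs_index S) p q :
  cs_dom i p -> cs_dom i q -> cs_chart i p = cs_chart i q -> p = q.
Proof. move=> ip iq E; apply: val_inj; exact: mf_chart_inj ip iq E. Qed.

Fact sub_chart_continuous (i : cs_index S) p :
  cs_dom i p -> {for p, continuous (cs_chart i)}.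
Proof.
move=> ip; apply: continuous_comp; first exact: sub_val_cont.
exact: mf_chart_continuous.
Qed.

Fact sub_chart_open (i : cs_index S) (A : set S) :
  open A -> A `<=` cs_dom i ->
  exists2 V, open V & cs_chart i @` A = V `&` model_space (cs_bdry i).
Proof.
move=> oA Ai; have [||V oV VE] := @mf_chart_open _ _ M i (set_val @` A).
- exact: sub_val_img.
- by move=> _ [x Ax <-]; exact: Ai.
by exists V => //; rewrite -VE -image_comp.
Qed.

Fact sub_compatible (j : cs_index S) : smooth_on (cs_dom j) (cs_chart j).
Proof.
move=> p jp i ip; have [g gE] := @mf_compatible _ _ M j _ jp i ip.
by exists g; exact: sub_local_rep.
Qed.

Definition open_submanifold : manifold R m :=
  Manifold sub_hausdorff sub_second_count sub_cover sub_dom_open sub_chart_inj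
    sub_chart_continuous sub_chart_open sub_compatible.

End sub_manifold.

Section sub_symplectic.
Variables (M : symplectic_manifold R m) (O : set M) (oO : open O).
Local Notation S := (open_submanifold oO).
Definition sub_form (i : cs_index S) (p : S) : 'M[R]_m := @sm_form _ _ M i (set_val p).

Fact sub_form_smooth i : smooth_on (cs_dom i) (sub_form i).
Proof.
move=> p jp j ip; have [g gE] := @sm_smooth _ _ M i _ jp j ip.
by exists g; exact: sub_local_rep.
Qed.

Fact sub_form_compatible i j p g : cs_dom i p -> cs_dom j p ->
  local_rep (cs_dom j) (cs_chart j) i p g ->
  sub_form i p = 'J g (cs_chart i p) *m sub_form j p *m ('J g (cs_chart i p))^T.
Proof.
move=> ip jp /(local_rep_sub oO ip) h; exact: (@sm_compatible _ _ M i j).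
Qed.

Fact sub_form_skew i p : cs_dom i p -> (sub_form i p)^T = - sub_form i p.
Proof. exact: (@sm_skew _ _ M i). Qed.

Fact sub_form_nondegenerate i p : cs_dom i p -> sub_form i p \in unitmx.
Proof. exact: (@sm_nondegenerate _ _ M i). Qed.

Fact sub_form_closed i p w : cs_dom i p -> local_rep (cs_dom i) (sub_form i) i p w ->
  forall u v z,
    form_eval ('D_u w (cs_chart i p)) v z
    + form_eval ('D_v w (cs_chart i p)) z u
    + form_eval ('D_z w (cs_chart i p)) u v = 0.
Proof.
move=> ip /(local_rep_sub oO ip) h; exact: (@sm_closed _ _ M i).
Qed.

Definition open_symplectic : symplectic_manifold R m :=
  SymplecticManifold sub_form_smooth sub_form_compatible sub_form_skew
    sub_form_nondegenerate sub_form_closed.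
End sub_symplectic.
End open_submanifold.

Section translation_atlas.
Context (R : realType) (m : nat).

Definition translation_atlas (S : charted_space R m) :=
  forall (i j : cs_index S) p, cs_dom i p -> cs_dom j p -> exists k U,
    [/\ open U, U (cs_chart i p) & forall q, cs_dom i q -> cs_dom j q ->
      U (cs_chart i q) -> cs_chart j q = cs_chart i q + k].

Lemma translation_compatible (S : charted_space R m) (j : cs_index S) :
  translation_atlas S -> smooth_on (cs_dom j) (cs_chart j).
Proof.
move=> T p jp i ip; have [k [U [oU Up UE]]] := T i j p ip jp.
exists (fun x => x + k), U; split => //; first exact: Cinfty_translation.
by move=> q jq iq; exact: UE.
Qed.

Variables (M : manifold R m) (W : 'M[R]_m).
Hypotheses (transM : translation_atlas M)
  (bdryM : forall i : cs_index M, cs_bdry i = false)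
  (skewW : W^T = - W) (unitW : W \in unitmx).

Fact constant_near_chart (A : set M) i p : open A -> A p -> cs_dom i p ->
  \forall x \near cs_chart i p, exists q, [/\ A q, cs_dom i q & cs_chart i q = x].
Proof.
move=> oA Ap ip.
have [||V oV] := @mf_chart_open _ _ M i (A `&` cs_dom i).
- by apply: openI => //; exact: mf_dom_open.
- exact: subIsetr.
rewrite bdryM /model_space setIT => VE.
have Vp : V (cs_chart i p) by rewrite -VE; exists p.
apply: filterS (open_nbhs_nbhs (conj oV Vp)) => x; rewrite -VE.
by move=> [q [Aq iq] <-]; exists q.
Qed.

Definition constant_form (i : cs_index M) (p : M) : 'M[R]_m := W.

Fact constant_form_smooth i : smooth_on (cs_dom i) (constant_form i).
Proof.
move=> p ip j jp; exists (cst W), setT; split=> //; first exact: openT.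
exact: Cinfty_cst.
Qed.

Fact constant_form_compatible i j p g : cs_dom i p -> cs_dom j p ->
  local_rep (cs_dom j) (cs_chart j) i p g ->
  constant_form i p = 'J g (cs_chart i p) *m constant_form j p *m ('J g (cs_chart i p))^T.
Proof.
move=> ip jp [U [oU Up gU gE]].
have [k [U' [oU' Up' kE]]] := transM ip jp.
have E : \forall x \near cs_chart i p, x + k = g x.
  apply: filterS3 (constant_near_chart (mf_dom_open j) jp ip)
    (open_nbhs_nbhs (conj oU Up)) (open_nbhs_nbhs (conj oU' Up')).
  by move=> _ [q [jq iq <-]] Uq U'q; rewrite -kE // gE.
have [D0 D1] := diff_translation k (cs_chart i p).
have [_ D2] := near_differentiable E D0.
suff -> : 'J g (cs_chart i p) = 1%:M by rewrite trmx1 mul1mx mulmx1.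
apply/row_matrixP => a.
by rewrite !rowE /jacobian mul_rV_lin1 mulmx1 /= D2 D1.
Qed.

Fact constant_form_closed i p w : cs_dom i p -> local_rep (cs_dom i) (constant_form i) i p w ->
  forall u v z,
    form_eval ('D_u w (cs_chart i p)) v z
    + form_eval ('D_v w (cs_chart i p)) z u
    + form_eval ('D_z w (cs_chart i p)) u v = 0.
Proof.
move=> ip [U [oU Up gU gE]] u v z.
have E : \forall x \near cs_chart i p, w x = cst W x.
  apply: filterS2 (constant_near_chart (mf_dom_open i) ip ip)
    (open_nbhs_nbhs (conj oU Up)).
  by move=> _ [q [_ iq <-]] Uq; rewrite -gE.
rewrite !(near_eq_derive _ E) !derive_cst /form_eval.
by rewrite !mulmx0 !mul0mx !mxE !addr0.
Qed.

Definition constant_symplectic : symplectic_manifold R m :=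
  @SymplecticManifold R m M constant_form constant_form_smooth
    constant_form_compatible
    (fun _ _ _ => skewW) (fun _ _ _ => unitW) constant_form_closed.

End translation_atlas.

Section euclidean.
Context (R : realType).

Lemma rV_second_countable m : @second_countable 'rV[R]_m.
Proof.
pose b (x : 'rV[rat]_m * nat) : set 'rV[R]_m :=
  ball (map_mx ratr x.1 : 'rV[R]_m) (x.2.+1%:R^-1).
exists (range b); first exact: card_le_trans (card_image_le _ _) (countableP _).
split=> [_ [x _ <-]|x A].
  exact: ball_open.
move=> /nbhs_ballP[e /= e0 eA].
have [k ke] : exists k, k.+1%:R^-1 < e / 2.
  have [k _ kP] := near_infty_natSinv_lt (PosNum (divr_gt0 e0 (ltr0Sn R 1))).
  by exists k; exact: (kP k (leqnn k)).
have k0 : (0 : R) < k.+1%:R^-1 by rewrite invr_gt0.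
have F i : exists q : rat, `|ratr q - x 0 i| < k.+1%:R^-1.
  have /rat_in_itvoo[q /itvP qre] : x 0 i < x 0 i + k.+1%:R^-1 by rewrite ltrDl.
  exists q; rewrite ltr_distl qre andbT.
  by rewrite (@lt_trans _ _ (x 0 i)) ?qre// ltrBlDl ltrDr.
have [q qP] := choice F.
pose y : 'rV[rat]_m := \row_i q i.
have yx : ball (map_mx ratr y : 'rV[R]_m) k.+1%:R^-1 x.
  split=> // i j; rewrite !mxE ord1; exact: qP.
exists (b (y, k)); first by split=> //; exists (y, k).
move=> z yz; apply: eA; rewrite [e]splitr.
apply: (@ball_triangle _ _ (map_mx ratr y : 'rV[R]_m)).
  apply: le_ball (ltW ke) _ _; exact: ball_sym.
exact: le_ball (ltW ke) _ yz.
Qed.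

Definition euclidean_charts (m : nat) : charted_space R m :=
  @ChartedSpace R m 'rV[R]_m unit (fun=> setT) (fun=> false) (fun=> id).

Lemma euclidean_translation m : translation_atlas (euclidean_charts m).
Proof.
move=> i j p _ _; exists 0, setT; split => // [|q _ _ _]; first exact: openT.
by rewrite addr0.
Qed.

Lemma euclidean_hausdorff m : hausdorff_space (euclidean_charts m).
Proof. exact: norm_hausdorff. Qed.

Lemma euclidean_chart_open m (i : cs_index (euclidean_charts m))
    (A : set (euclidean_charts m)) : open A -> A `<=` cs_dom i ->
  exists2 V, open V & cs_chart i @` A = V `&` model_space (cs_bdry i).
Proof. by move=> oA _; exists A => //=; rewrite image_id setIT. Qed.

Definition euclidean_space (m : nat) : manifold R m :=
  @Manifold R m (euclidean_charts m) (@euclidean_hausdorff m)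
    (rV_second_countable m) (fun=> ex_intro _ tt I) (fun=> openT)
    (fun _ _ _ _ _ => id) (fun _ _ _ => @cvg_id _ _) (@euclidean_chart_open m)
    (fun j => translation_compatible (@euclidean_translation m)).

Definition standard_mx n : 'M[R]_(n + n) := block_mx 0 1%:M (- 1%:M) 0.

Lemma standard_mx_skew n : (standard_mx n)^T = - standard_mx n.
Proof.
by rewrite /standard_mx tr_block_mx opp_block_mx !trmx0 linearN /= trmx1 oppr0
  opprK.
Qed.

Lemma standard_mx_unit n : standard_mx n \in unitmx.
Proof.
suff /mulmx1_unit[] : standard_mx n *m (- standard_mx n) = 1%:M by [].
rewrite mulmxN /standard_mx mulmx_block !mul0mx !mulmx0 !mul1mx !mulmx1.
by rewrite !addr0 add0r opp_block_mx oppr0 !opprK -scalar_mx_block.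
Qed.
End euclidean.

Section torus.
Context (R : realType) (n : nat).

Definition lattice_equiv (x y : 'rV[R]_n) : bool :=
  [forall i, x 0 i - y 0 i \is a Num.int].

Lemma lattice_equiv_refl : reflexive lattice_equiv.
Proof. by move=> x; apply/forallP => i; rewrite subrr. Qed.

Lemma lattice_equiv_sym : symmetric lattice_equiv.
Proof.
by move=> x y; apply/forallP/forallP => h i; rewrite -opprB rpredN h.
Qed.

Lemma lattice_equiv_trans : transitive lattice_equiv.
Proof.
move=> y x z /forallP xy /forallP yz; apply/forallP => i.
by rewrite -(subrK (y 0 i) (x 0 i)) -addrA rpredD.
Qed.

Canonical lattice_equiv_rel :=
  EquivRel lattice_equiv lattice_equiv_refl lattice_equiv_sym
    lattice_equiv_trans.

Definition torus : Type := quotient_topology {eq_quot lattice_equiv_rel}%qT.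
HB.instance Definition _ := Topological.on torus.

Definition torus_proj (x : 'rV[R]_n) : torus :=
  \pi_(quotient_topology {eq_quot lattice_equiv_rel})%qT x.

Lemma torus_projP x y : torus_proj x = torus_proj y <-> lattice_equiv x y.
Proof.
have H : reflect (torus_proj x = torus_proj y) (lattice_equiv x y) :=
  @eqmodP _ lattice_equiv_rel x y.
by split=> /H.
Qed.

Lemma torus_proj_surj (q : torus) : exists x, torus_proj x = q.
Proof.
pose Q := quotient_topology {eq_quot lattice_equiv_rel}%qT.
by exists (repr (q : Q)); exact: (reprK (q : Q)).
Qed.

Lemma torus_proj_continuous : continuous torus_proj.
Proof. exact: (@pi_continuous _ {eq_quot lattice_equiv_rel}%qT). Qed.

Lemma torus_proj_open (U : set 'rV[R]_n) : open U -> open (torus_proj @` U).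
Proof.
move=> oU; suff: open (torus_proj @^-1` (torus_proj @` U)) by [].
rewrite openE => x [y Uy /torus_projP yx].
have h : \forall z \near x, U (z + (y - x)).
  have c : (fun z => z + (y - x)) @ x --> x + (y - x).
    have [D _] := diff_translation (y - x) x; exact: differentiable_continuous D.
  apply: c; rewrite addrC subrK; exact: open_nbhs_nbhs.
apply: filterS h => z Uz; exists (z + (y - x)) => //; apply/torus_projP.
apply/forallP => i; rewrite !mxE addrAC subrr add0r.
by move/forallP : yx.
Qed.

Lemma torus_hausdorff : hausdorff_space torus.
Proof.
move=> p q; have [x <-] := torus_proj_surj p; have [y <-] := torus_proj_surj q.
move=> pq; apply/torus_projP; apply: contrapT => /negP.
rewrite negb_forall => /existsP[i tN].
set t := x 0 i - y 0 i in tN.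
pose f : R := (Num.floor t)%:~R.
have ft : f < t.
  rewrite lt_neqAle floor_le andbT; apply: contra tN => /eqP <-.
  exact: intr_int.
have tf : t < f + 1 by rewrite /f -intrD1 floorD1_gt.
pose e := Num.min (t - f) (f + 1 - t) / 2.
have m0 : 0 < Num.min (t - f) (f + 1 - t) by rewrite lt_min !subr_gt0 ft.
have e0 : 0 < e by rewrite divr_gt0.
have N z : nbhs (torus_proj z) (torus_proj @` ball z e).
  apply: open_nbhs_nbhs; split; first by apply/torus_proj_open/ball_open.
  by exists z => //; exact: ballxx.
have [_ [[x' xx' <-] [y' yy' E]]] := pq _ _ (N x) (N y).
move/torus_projP/forallP : E => /(_ i) /intrP[k kE].
have [_ /(_ 0 i) h1] := xx'; have [_ /(_ 0 i) h2] := yy'.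
rewrite /ball /= in h1 h2.
have em : e + e = Num.min (t - f) (f + 1 - t) by rewrite -splitr.
have b1 : e + e <= t - f by rewrite em ge_min lexx.
have b2 : e + e <= f + 1 - t by rewrite em ge_min lexx orbT.
move: h1 h2; rewrite !ltr_norml => /andP[h1 h1'] /andP[h2 h2'].
have c1 : f < (- k)%:~R.
  rewrite mulrNz -kE opprB; rewrite /t in b1 b2 ft tf; lra.
have c2 : (- k)%:~R < f + 1.
  rewrite mulrNz -kE opprB; rewrite /t in b1 b2 ft tf; lra.
have {c1} : Num.floor t < - k by rewrite -(ltr_int R).
have {c2} : - k < Num.floor t + 1 by rewrite -(ltr_int R) intrD1.
by rewrite ltzD1 leNgt => /negP.
Qed.

(* The coordinates of [q] in the open cube of side 1 centred at [a]. *)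
Definition torus_lift (a : 'rV[R]_n) (q : torus) : 'rV[R]_n :=
  xget 0 [set x | ball a 2^-1 x /\ torus_proj x = q].

Lemma torus_lift_unique (a x y : 'rV[R]_n) :
  ball a 2^-1 x -> ball a 2^-1 y -> torus_proj x = torus_proj y -> x = y.
Proof.
move=> [_ ax] [_ ay] /torus_projP /forallP xy; apply/rowP => i.
have := ax 0 i; have := ay 0 i; have /intrP[k kE] := xy i.
rewrite /ball /= !ltr_norml => /andP[h1 h1'] /andP[h2 h2'].
suff k0 : k = 0 by apply/eqP; rewrite -subr_eq0 kE k0.
have : (-1)%:~R < k%:~R :> R by rewrite -kE mulrN1z; lra.
have : k%:~R < 1%:~R :> R by rewrite -kE; lra.
rewrite !ltr_int; lia.
Qed.

Lemma torus_liftE (a x : 'rV[R]_n) :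
  ball a 2^-1 x -> torus_lift a (torus_proj x) = x.
Proof.
move=> ax; rewrite /torus_lift; case: xgetP => [y -> [ay E]|/(_ x)].
  exact: torus_lift_unique ay ax E.
by case; split.
Qed.

(* T^n x R^n with the charts induced by R^n x R^n -> T^n x R^n.  In the
   global trivializations it is both the tangent and the cotangent bundle of
   T^n; in the latter case the coordinates are (q_1,...,q_n,p_1,...,p_n). *)
Definition torus_bundle_charts : charted_space R (n + n) :=
  @ChartedSpace R (n + n) (torus * 'rV[R]_n)%type 'rV[R]_n
    (fun a => [set z | exists2 x, ball a 2^-1 x & torus_proj x = z.1])
    (fun=> false) (fun a z => row_mx (torus_lift a z.1) z.2).

Local Notation B := torus_bundle_charts.
Implicit Type a : cs_index B.

Fact torus_bundle_dom_open a : open (cs_dom a).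
Proof.
rewrite (_ : cs_dom a = fst @^-1` (torus_proj @` ball a 2^-1)) //.
apply: open_comp; first by move=> *; exact: cvg_fst.
apply: torus_proj_open; exact: ball_open.
Qed.

Fact torus_bundle_chart_inj a (p q : B) : cs_dom a p -> cs_dom a q ->
  cs_chart a p = cs_chart a q -> p = q.
Proof.
case: p q => [_ p] [_ q] [x ax /= <-] [y ay /= <-].
by rewrite !torus_liftE // => /eq_row_mx[-> ->].
Qed.

Lemma row_mx_continuous (z : 'rV[R]_n * 'rV[R]_n) :
  {for z, continuous (fun z : 'rV[R]_n * 'rV[R]_n => row_mx z.1 z.2)}.
Proof.
move=> A /nbhs_ballP[e /= e0 eA]; apply/nbhs_ballP; exists e => //= w [zw1 zw2].
apply: eA; split=> // i j; rewrite !mxE; case: splitP => k _.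
  by have [_ +] := zw1; apply.
by have [_ +] := zw2; apply.
Qed.

Fact torus_bundle_chart_continuous a p : cs_dom a p -> {for p, continuous (cs_chart a)}.
Proof.
case: p => [_ p] [x ax /= <-].
have lc : {for torus_proj x, continuous (torus_lift a)}.
  move=> A; rewrite torus_liftE // => nA.
  have N : nbhs x (A° `&` ball a 2^-1).
    apply: filterI; first exact: nbhs_interior.
    exact: open_nbhs_nbhs (conj (ball_open _ _) ax).
  have o : open (A° `&` ball a 2^-1).
    by apply: openI; [exact: open_interior | exact: ball_open].
  have : nbhs (torus_proj x) (torus_proj @` (A° `&` ball a 2^-1)).
    apply: open_nbhs_nbhs; split; first exact: torus_proj_open.
    by exists x => //; exact: nbhs_singleton N.
  apply: filterS => _ [y [Ay ay] <-] /=; rewrite torus_liftE //.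
  exact: interior_subset.
apply: (@continuous_comp _ _ _
  (fun z : torus * 'rV[R]_n => (torus_lift a z.1, z.2))
  (fun z : 'rV[R]_n * 'rV[R]_n => row_mx z.1 z.2)).
  have c1 : {for (torus_proj x, p), continuous
      (fun z : torus * 'rV[R]_n => torus_lift a z.1)}.
    apply: (@continuous_comp _ _ _ fst (torus_lift a)).
      exact: cvg_fst.
    exact: lc.
  have c2 : {for (torus_proj x, p), continuous
      (fun z : torus * 'rV[R]_n => z.2)} by exact: cvg_snd.
  exact: cvg_pair c1 c2.
exact: row_mx_continuous.
Qed.

Definition torus_bundle_proj (x : 'rV[R]_(n + n)) : B :=
  (torus_proj (lsubmx x), rsubmx x).

Lemma torus_bundle_proj_continuous : continuous torus_bundle_proj.
Proof.
move=> x; have c1 : {for x, continuous (torus_proj \o lsubmx)}.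
  apply: continuous_comp; first exact: continuous_lsubmx.
  exact: torus_proj_continuous.
exact: cvg_pair c1 (@continuous_rsubmx R 1 n n x).
Qed.

Fact torus_bundle_chart_open a (A : set B) : open A -> A `<=` cs_dom a ->
  exists2 V, open V & cs_chart a @` A = V `&` model_space (cs_bdry a).
Proof.
move=> oA Aa; exists (torus_bundle_proj @^-1` A `&` lsubmx @^-1` ball a 2^-1).
  apply: openI; apply: open_comp => //.
  - by move=> *; exact: torus_bundle_proj_continuous.
  - by move=> *; exact: continuous_lsubmx.
  - exact: ball_open.
rewrite /= setIT; apply/seteqP; split.
  move=> _ [[q p] Aq <-] /=; have [x ax /= xq] := Aa _ Aq.
  rewrite /torus_bundle_proj -xq torus_liftE // row_mxKl row_mxKr.
  by split=> //=; rewrite xq.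
move=> x [Ax ax] /=; exists (torus_bundle_proj x) => //=.
by rewrite torus_liftE // hsubmxK.
Qed.

Lemma torus_bundle_translation : translation_atlas B.
Proof.
move=> a b [_ p] [x ax /= <-] [y ay /= E].
exists (row_mx (y - x) 0), [set z | ball b 2^-1 (lsubmx z + (y - x))].
split.
- apply: (@open_comp _ _ (fun z => lsubmx z + (y - x)) (ball b 2^-1)).
    move=> z _; apply: (@continuous_comp _ _ _ lsubmx (fun t => t + (y - x))).
      exact: continuous_lsubmx.
    have [D _] := diff_translation (y - x) (lsubmx z).
    exact: differentiable_continuous D.
  exact: ball_open.
- by rewrite /= torus_liftE // row_mxKl addrC subrK.
move=> [_ q] [x' ax' /= <-] [y' ay' /= E'].
rewrite torus_liftE // row_mxKl => bx'; rewrite -E' torus_liftE //.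
rewrite add_row_mx addr0; congr row_mx; apply: torus_lift_unique ay' bx' _.
rewrite E'; apply/torus_projP; apply/forallP => i; rewrite !mxE.
move/torus_projP/forallP : E => /(_ i) h.
by rewrite opprD addrA subrr sub0r rpredN.
Qed.

Fact torus_bundle_hausdorff : hausdorff_space B.
Proof.
move=> [p p'] [q q'] pq; congr (_, _).
  apply: torus_hausdorff => A C nA nC.
  have [[x x'] [Ax Cx]] := pq (fst @^-1` A) (fst @^-1` C) (cvg_fst nA) (cvg_fst nC).
  by exists x.
apply: (@norm_hausdorff _ 'rV[R]_n) => A C nA nC.
have [[x x'] [Ax Cx]] := pq (snd @^-1` A) (snd @^-1` C) (cvg_snd nA) (cvg_snd nC).
by exists x'.
Qed.

Fact torus_bundle_second_count : @second_countable B.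
Proof.
have [D cD [oD bD]] := rV_second_countable R (n + n).
exists ((fun A => torus_bundle_proj @` A) @` D).
  exact: card_le_trans (card_image_le _ _) cD.
have img (A : set 'rV[R]_(n + n)) : open A -> open (torus_bundle_proj @` A).
  move=> oA; rewrite openE => _ [x Ax <-].
  have nA : nbhs (row_mx (lsubmx x) (rsubmx x)) A.
    by rewrite hsubmxK; exact: open_nbhs_nbhs.
  have [[U V] /= [nU nV] UV] := @row_mx_continuous (lsubmx x, rsubmx x) _ nA.
  exists (torus_proj @` U°, V) => /=.
    split=> //; apply: open_nbhs_nbhs; split.
      by apply/torus_proj_open/open_interior.
    by exists (lsubmx x) => //; exact: nbhs_singleton (nbhs_interior nU).
  move=> [_ v] /= [[u Uu <-] Vv]; exists (row_mx u v).
    by apply: (UV (u, v)); split=> //; exact: interior_subset.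
  by rewrite /torus_bundle_proj row_mxKl row_mxKr.
split=> [_ [A DA <-]|[q p] A nA]; first by apply: img; exact: oD.
have [x xq] := torus_proj_surj q.
have E : torus_bundle_proj (row_mx x p) = (q, p).
  by rewrite /torus_bundle_proj row_mxKl row_mxKr xq.
have nA' : nbhs (row_mx x p) (torus_bundle_proj @^-1` A).
  by apply: torus_bundle_proj_continuous; rewrite E.
have [U [DU Ux] UA] := bD _ _ nA'.
exists (torus_bundle_proj @` U).
  by split; [exists U | exists (row_mx x p)].
by move=> _ [y Uy <-]; exact: UA.
Qed.

Fact torus_bundle_cover (p : B) : exists a, cs_dom a p.
Proof.
have [x xp] := torus_proj_surj p.1; exists x, x => //.
by apply: ballxx; rewrite invr_gt0.
Qed.

Definition torus_bundle : manifold R (n + n) :=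
  @Manifold R (n + n) B torus_bundle_hausdorff torus_bundle_second_count
    torus_bundle_cover torus_bundle_dom_open torus_bundle_chart_inj
    torus_bundle_chart_continuous torus_bundle_chart_open
    (fun j => translation_compatible (@torus_bundle_translation)).

End torus.

Lemma sum_continuous (R : realType) (T : topologicalType) (I : Type) (r : seq I)
    (f : I -> T -> R) :
  (forall i, continuous (f i)) -> continuous (fun x => \sum_(i <- r) f i x).
Proof.
move=> cf; elim: r => [|i r IH].
  rewrite (_ : (fun _ => _) = cst 0); first exact: cst_continuous.
  by apply/funext => x; rewrite big_nil.
rewrite (_ : (fun _ => _) = f i \+ (fun x => \sum_(j <- r) f j x)).
  by move=> x; apply: cvgD; [exact: cf | exact: IH].
by apply/funext => x; rewrite big_cons.
Qed.

Section finsler.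
Context (R : realType) (n : nat).
Notation TT := (torus R n * 'rV[R]_n)%type.

Record finsler (F : TT -> R) : Prop := Finsler {
  finsler_continuous : continuous F ;
  finsler_smooth :
    @smooth_on R (n + n) (torus_bundle R n) R [set z | z.2 != 0] F ;
  finsler_pos : forall q v, v != 0 -> 0 < F (q, v) ;
  finsler_homogeneous : forall q v (t : R), 0 < t -> F (q, t *: v) = t * F (q, v) ;
  finsler_convex : forall q v w (t : R), 0 <= t <= 1 ->
    F (q, t *: v + (1 - t) *: w) <= t * F (q, v) + (1 - t) * F (q, w) }.

Definition reversible (F : TT -> R) := forall q v, F (q, v) = F (q, - v).

Definition flat (F : TT -> R) :=
  exists f : 'rV[R]_n -> R, forall q v, F (q, v) = f v.

Definition induced_by_flat_metric (G : TT -> R) :=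
  exists g : 'M[R]_n,
    [/\ g^T = g,
        forall v, v != 0 -> 0 < form_eval g v v &
        forall q v, G (q, v) = Num.sqrt (form_eval g v v)].

Definition pairing (p v : 'rV[R]_n) : R := \sum_i p 0 i * v 0 i.

Definition dual_norm (F : TT -> R) (z : TT) : R :=
  sup [set pairing z.2 v | v in [set v | F (z.1, v) < 1]].

Definition disc_bundle (F : TT -> R) : set (torus_bundle R n) :=
  [set z | dual_norm F z < 1].

Lemma finsler0 F q : finsler F -> F (q, 0) = 0.
Proof.
move=> hF; have := finsler_homogeneous hF q 0 (ltr0Sn R 1).
by rewrite scaler0 => h; lra.
Qed.

Lemma pairing_continuous :
  continuous (fun z : 'rV[R]_n * 'rV[R]_n => pairing z.1 z.2).
Proof.
apply: sum_continuous => i z.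
have c1 : {for z, continuous (fun z : 'rV[R]_n * 'rV[R]_n => z.1 0 i)}.
  apply: (@continuous_comp _ _ _ fst (fun x : 'rV[R]_n => x 0 i)).
    exact: cvg_fst.
  exact: coord_continuous.
have c2 : {for z, continuous (fun z : 'rV[R]_n * 'rV[R]_n => z.2 0 i)}.
  apply: (@continuous_comp _ _ _ snd (fun x : 'rV[R]_n => x 0 i)).
    exact: cvg_snd.
  exact: coord_continuous.
exact: cvgM c1 c2.
Qed.

Lemma partial_continuous (T U V : topologicalType) (f : T * U -> V) (x : T) :
  continuous f -> continuous (fun y => f (x, y)).
Proof.
move=> cf y; apply: (@continuous_comp _ _ _ (fun y => (x, y)) f); last exact: cf.
by apply: cvg_pair; [exact: cvg_cst | exact: cvg_id].
Qed.

Lemma sphere_compact : compact [set v : 'rV[R]_n | `|v| = 1].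
Proof.
apply: bounded_closed_compact.
  exists 1; split; first exact: num_real.
  by move=> M M1 v /= ->; exact: ltW.
rewrite (_ : [set v | _] = (@Num.norm _ _) @^-1` [set 1]) //.
apply: preimage_closed; first by move=> *; exact: norm_continuous.
exact: closed_eq.
Qed.

Lemma pairingZr (p v : 'rV[R]_n) t : pairing p (t *: v) = t * pairing p v.
Proof.
by rewrite /pairing mulr_sumr; apply: eq_bigr => i _; rewrite !mxE mulrCA.
Qed.

Lemma norm1_neq0 (v : 'rV[R]_n) : `|v| = 1 -> v != 0.
Proof. by move=> v1; rewrite -normr_eq0 v1 oner_eq0. Qed.

Lemma dual_norm_bound F z : finsler F -> exists s, [/\ 0 <= s,
    ubound [set pairing z.2 v | v in [set v | F (z.1, v) < 1]] s &
    (forall v, `|v| = 1 -> pairing z.2 v < F (z.1, v)) -> s < 1].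
Proof.
case: z => q p hF /=.
pose K := [set v : 'rV[R]_n | `|v| = 1].
pose f (v : 'rV[R]_n) := pairing p v / F (q, v).
have red s : 0 <= s -> (forall v, K v -> f v <= s) ->
    ubound [set pairing p v | v in [set v | F (q, v) < 1]] s.
  move=> s0 h _ [w Fw <-]; have [->|w0] := eqVneq w 0.
    by rewrite /pairing big1 // => i _; rewrite mxE mulr0.
  have nw : 0 < `|w| by rewrite normr_gt0.
  pose u := `|w|^-1 *: w.
  have Ku : K u.
    by rewrite /K /u /= normrZ ger0_norm ?invr_ge0 // mulVf // gt_eqF.
  have wu : w = `|w| *: u by rewrite /u scalerA mulfV ?scale1r // gt_eqF.
  have Fu : 0 < F (q, u) by apply: finsler_pos => //; exact: norm1_neq0.
  have := h _ Ku; rewrite /f ler_pdivrMr // => hu.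
  have Fwu : F (q, w) = `|w| * F (q, u).
    by rewrite -finsler_homogeneous // -wu.
  rewrite /= in Fw; rewrite wu pairingZr.
  apply: (@le_trans _ _ (`|w| * (s * F (q, u)))); first by rewrite ler_pM2l.
  rewrite mulrCA -Fwu -[leRHS]mulr1; apply: ler_wpM2l => //; exact: ltW.
have [K0|/set0P/negP/negPn/eqP K0] := pselect (K !=set0); last first.
  exists 0; split => //; apply: red => // v; by rewrite K0.
have cf : {within K, continuous f}.
  apply: continuous_in_subspaceT => v; rewrite inE => Kv.
  have Fv : F (q, v) != 0.
    by rewrite gt_eqF //; apply: finsler_pos => //; exact: norm1_neq0.
  have c1 : {for v, continuous (pairing p)}.
    exact: (@partial_continuous _ _ _ _ p pairing_continuous v).
  have c2 : {for v, continuous (fun v => F (q, v))}.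
    exact: (@partial_continuous _ _ _ _ q (finsler_continuous hF) v).
  exact: cvgM c1 (cvgV Fv c2).
have [v0 Kv0 fmax] := compact_EVT_max K0 sphere_compact cf.
rewrite inE in Kv0; exists (Num.max 0 (f v0)); split.
- by rewrite le_max lexx.
- apply: red => [|v Kv]; first by rewrite le_max lexx.
  by rewrite le_max fmax ?orbT // inE.
- move=> /(_ _ Kv0) h; rewrite gt_max ltr01 /f ltr_pdivrMr ?mul1r //.
  by apply: finsler_pos => //; exact: norm1_neq0.
Qed.

Lemma disc_bundleP F z : finsler F ->
  disc_bundle F z <-> forall v, `|v| = 1 -> pairing z.2 v < F (z.1, v).
Proof.
move=> hF; have [s [s0 sub s1]] := dual_norm_bound z hF.
pose S := [set pairing z.2 v | v in [set v | F (z.1, v) < 1]].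
have S0 : S 0.
  exists 0; first by rewrite /= finsler0.
  by rewrite /pairing big1 // => i _; rewrite mxE mulr0.
have supS : has_sup S by split; [exists 0 | exists s].
split=> [|h]; last first.
  apply: le_lt_trans (s1 h); apply: ge_sup => //; by exists 0.
rewrite /disc_bundle /dual_norm /= -/S => S1 v v1.
rewrite ltNge; apply/negP => Fv.
have F0 : 0 < F (z.1, v) by apply: finsler_pos => //; exact: norm1_neq0.
have supS0 : 0 <= sup S by apply: ub_le_sup => //; case: supS.
pose t := (sup S + 1) / 2.
have t0 : 0 < t by rewrite /t; lra.
have t1 : t < 1 by rewrite /t; lra.
have : pairing z.2 ((t / F (z.1, v)) *: v) <= sup S.
  apply: ub_le_sup; first by case: supS.
  exists ((t / F (z.1, v)) *: v) => //=.
  have tF : 0 < t / F (z.1, v) by exact: divr_gt0.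
  rewrite (finsler_homogeneous hF z.1 v tF).
  by rewrite -mulrA mulVf ?mulr1 // gt_eqF.
rewrite pairingZr leNgt => /negP; apply.
apply: (@lt_le_trans _ _ t); first by rewrite /t; lra.
rewrite -mulrA; apply: ler_peMr; first exact: ltW.
by rewrite mulrC ler_pdivlMr // mul1r.
Qed.

Lemma disc_bundle_open F : finsler F -> open (disc_bundle F).
Proof.
move=> hF; rewrite openE => z /(disc_bundleP _ hF) zP.
pose P (z : TT) (v : 'rV[R]_n) := 0 < F (z.1, v) - pairing z.2 v.
pose Phi (x : 'rV[R]_n * TT) := F (x.2.1, x.1) - pairing x.2.2 x.1.
have cPhi : continuous Phi.
  move=> x.
  have f1 : {for x, continuous (fun x : 'rV[R]_n * TT => x.1)} by exact: cvg_fst.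
  have f2 : {for x, continuous (fun x : 'rV[R]_n * TT => x.2)} by exact: cvg_snd.
  have f21 : {for x, continuous (fun x : 'rV[R]_n * TT => x.2.1)}.
    apply: (@continuous_comp _ _ _ snd fst); [exact: f2 | exact: cvg_fst].
  have f22 : {for x, continuous (fun x : 'rV[R]_n * TT => x.2.2)}.
    apply: (@continuous_comp _ _ _ snd snd); [exact: f2 | exact: cvg_snd].
  have c1 : {for x, continuous (fun x : 'rV[R]_n * TT => F (x.2.1, x.1))}.
    apply: (@continuous_comp _ _ _ (fun x : 'rV[R]_n * TT => (x.2.1, x.1)) F).
      exact: cvg_pair f21 f1.
    exact: (finsler_continuous hF).
  have c2 : {for x, continuous (fun x : 'rV[R]_n * TT => pairing x.2.2 x.1)}.
    apply: (@continuous_comp _ _ _ (fun x : 'rV[R]_n * TT => (x.2.2, x.1))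
      (fun z => pairing z.1 z.2)).
      exact: cvg_pair f22 f1.
    exact: pairing_continuous.
  exact: cvgB c1 c2.
have nc := (compact_near_coveringP _).1 sphere_compact.
have := nc TT (nbhs z) P _; rewrite /filter_from.
have H : forall v : 'rV[R]_n, `|v| = 1 ->
    \forall v' \near v & z' \near z, P z' v'.
  move=> v v1; have := cPhi (v, z) [set r | 0 < r].
  apply; apply: open_nbhs_nbhs; split; first exact: open_gt.
  by rewrite /Phi /= subr_gt0; exact: zP.
move=> /(_ _ H); apply: filterS => z' hz'; apply/disc_bundleP => // v v1.
by have := hz' v v1; rewrite /P subr_gt0.
Qed.

(* Sum of the dp_i /\ dq_i in the coordinates (q, p). *)
Definition canonical_mx : 'M[R]_(n + n) := block_mx 0 (- 1%:M) 1%:M 0.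

Lemma canonical_mxE : canonical_mx = - standard_mx R n.
Proof. by rewrite /standard_mx opp_block_mx oppr0 opprK. Qed.

Lemma canonical_mx_skew : canonical_mx^T = - canonical_mx.
Proof. by rewrite canonical_mxE linearN /= standard_mx_skew. Qed.

Lemma canonical_mx_unit : canonical_mx \in unitmx.
Proof.
rewrite canonical_mxE -scaleN1r unitmxZ ?standard_mx_unit //.
by rewrite unitrN unitr1.
Qed.

Definition cotangent_torus : symplectic_manifold R (n + n) :=
  @constant_symplectic R (n + n) (torus_bundle R n) canonical_mx
    (@torus_bundle_translation R n) (fun=> erefl)
    canonical_mx_skew canonical_mx_unit.

Definition disc_cotangent_bundle F (hF : finsler F) :
    symplectic_manifold R (n + n) :=
  @open_symplectic R (n + n) cotangent_torus (disc_bundle F)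
    (disc_bundle_open hF).

End finsler.

Section systole.
Context (R : realType) (n : nat).
Implicit Types (F : torus R n * 'rV[R]_n -> R) (x : R -> 'rV[R]_n).

(* A smooth curve in T^n is given by a smooth lift [x] to R^n, whose derivative
   is its velocity in the global trivialization of the tangent bundle. *)
Definition finsler_length F (a b : R) x : R :=
  \int[lebesgue_measure]_(t in `[a, b]) F (torus_proj (x t), derive1 x t).

Definition geodesic F x :=
  [/\ Cinfty setT x,
      forall t, derive1 x t != 0 &
      forall (a b : R) (y : R * R -> 'rV[R]_n), a < b ->
        Cinfty setT y ->
        (forall t, y (0, t) = x t) ->
        (forall s, y (s, a) = x a /\ y (s, b) = x b) ->
        is_derive (0 : R) (1 : R)
          (fun s => finsler_length F a b (fun t => y (s, t))) 0].

Definition closed_geodesic F x :=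
  geodesic F x /\ forall t, torus_proj (x (t + 1)) = torus_proj (x t).

(* Homotopic to a constant among 1-periodic curves; letting the parameter of the
   homotopy range over R rather than [0, 1] makes no difference. *)
Definition contractible_loop (c : R -> torus R n) :=
  exists h : R * R -> torus R n,
    [/\ continuous h,
        forall s t, h (s, t + 1) = h (s, t),
        forall t, h (0, t) = c t &
        exists q, forall t, h (1, t) = q].

(* A minimum on a closed manifold, hence equal to the infimum. *)
Definition systole F : R :=
  inf [set l | exists x,
    [/\ closed_geodesic F x, ~ contractible_loop (@torus_proj R n \o x) &
        l = finsler_length F 0 1 x]].

End systole.

Section capacities.
Context (R : realType).

Section hofer_zehnder.
Context (m : nat) (M : symplectic_manifold R m).

(* [c] is an integral curve of the Hamiltonian vector field X_H, with the
   convention omega(X_H, .) = dH. *)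
Definition hamiltonian_orbit (H : M -> R) (c : R -> M) :=
  continuous c /\
  forall (t : R) (i : cs_index M), cs_dom i (c t) ->
    exists2 u : 'rV[R]_m, is_derive t 1 (cs_chart i \o c) u &
      forall g : 'rV[R]_m -> R, local_rep setT H i (c t) g ->
        forall v, form_eval (sm_form i (c t)) u v = 'd g (cs_chart i (c t)) v.

Definition hz_admissible (H : M -> R) (mH : R) :=
  [/\ smooth_on setT H,
      exists C : set M, [/\ compact C, C `<=` manifold_interior M,
        forall p, ~ C p -> H p = mH & forall p, 0 <= H p <= mH],
      exists A : set M, [/\ open A, A !=set0 & forall p, A p -> H p = 0] &
      forall (c : R -> M) (T : R), hamiltonian_orbit H c ->
        0 < T <= 1 -> (forall t, c (t + T) = c t) -> forall t, c t = c 0].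

(* Since [M \ C] can be empty, max H = m(H) is required explicitly. *)
Definition c_HZ : \bar R :=
  ereal_sup [set mu%:E | mu in [set mu | exists H : M -> R,
    hz_admissible H mu /\ exists p, H p = mu]].

End hofer_zehnder.

Section normalized.
Context (n : nat).

(* R^(2n) = C^n, with coordinates (x_1,...,x_n,y_1,...,y_n). *)
Definition standard_space : symplectic_manifold R (n + n) :=
  @constant_symplectic R (n + n) (euclidean_space R (n + n)) (standard_mx R n)
    (@euclidean_translation R (n + n)) (fun=> erefl)
    (standard_mx_skew R n) (standard_mx_unit R n).

Definition sqr_modulus (z : 'rV[R]_(n + n)) (j : 'I_n) : R :=
  z 0 (lshift n j) ^+ 2 + z 0 (rshift n j) ^+ 2.

Definition ball_set (r : R) : set standard_space :=
  [set z | \sum_j sqr_modulus z j < r ^+ 2].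

Definition cylinder_set (r : R) : set standard_space :=
  [set z | forall j : 'I_n, j = 0%N :> nat -> sqr_modulus z j < r ^+ 2].

Lemma sqr_modulus_continuous j : continuous (fun z => sqr_modulus z j).
Proof.
have sq (k : 'I_(n + n)) : continuous (fun z : 'rV[R]_(n + n) => z 0 k ^+ 2).
  move=> z; apply: (@continuous_comp _ _ _
    (fun z : 'rV[R]_(n + n) => z 0 k) (fun r => r ^+ 2)).
    exact: coord_continuous.
  exact: exprn_continuous.
move=> z; exact: cvgD (sq (lshift n j) z) (sq (rshift n j) z).
Qed.

Lemma ball_set_open r : open (ball_set r).
Proof.
apply: (@open_comp _ _ (fun z => \sum_j sqr_modulus z j) [set t | t < r ^+ 2]).
  by move=> z _; apply: sum_continuous => j; exact: sqr_modulus_continuous.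
exact: open_lt.
Qed.

Lemma cylinder_set_open r : open (cylinder_set r).
Proof.
have [[j j0]|N] := pselect (exists j : 'I_n, j = 0%N :> nat).
  rewrite (_ : cylinder_set r =
      (fun z => sqr_modulus z j) @^-1` [set t | t < r ^+ 2]).
    apply: open_comp; last exact: open_lt.
    by move=> z _; exact: sqr_modulus_continuous.
  apply/seteqP; split => [z|z zj i i0]; first exact.
  by rewrite (_ : i = j) //; apply/val_inj; rewrite /= i0.
rewrite (_ : cylinder_set r = setT); first exact: openT.
apply/seteqP; split => // z _ j j0; exfalso; apply: N; by exists j.
Qed.

Definition symplectic_ball r := open_symplectic (@ball_set_open r).
Definition symplectic_cylinder r := open_symplectic (@cylinder_set_open r).

Record symplectic_capacity (c : symplectic_manifold R (n + n) -> \bar R) :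
    Prop := SymplecticCapacity {
  capacity_ge0 : forall M, (0 <= c M)%E ;
  capacity_embedding :
    forall (M1 M2 : symplectic_manifold R (n + n)) (f : M1 -> M2),
    symplectic_embedding f -> (c M1 <= c M2)%E ;
  capacity_scaling : forall M (r : R) (r0 : 0 < r),
    c (scale_symplectic M r0) = (r%:E * c M)%E ;
  capacity_ball : forall r : R, 0 < r ->
    c (symplectic_ball r) = (pi * r ^+ 2)%:E ;
  capacity_cylinder : forall r : R, 0 < r ->
    c (symplectic_cylinder r) = (pi * r ^+ 2)%:E }.

End normalized.
End capacities.

(* Main.v *)
Require Import Defs.
From mathcomp Require Import all_boot all_order all_algebra.
From mathcomp Require Import all_classical all_reals all_analysis.
From mathcomp Require Import ring lra zify.

Set Implicit Arguments.
Unset Strict Implicit.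
Unset Printing Implicit Defensive.

Import Order.TTheory GRing.Theory Num.Theory.
Import numFieldNormedType.Exports.
Local Open Scope classical_set_scope.
Local Open Scope ring_scope.

(** The value 2 sys(F) is controlled by explicit embeddings and one explicit
    Hamiltonian. Write f for the norm on R^n given by F, and l for the minimum
    of f over the nonzero integer vectors.

    Systole. A non-contractible closed geodesic lifts to a curve translated by a
    nonzero integer vector k over a period, and pairing its velocity with a
    supporting functional of f at k bounds its length below by f(k). The line in
    the direction of a shortest k is a geodesic by convexity of f, and it is not
    contractible because its angles have nonzero winding number. Hence
    sys(F) = l (systole_flat).

    Upper bound (capacity_disc_bundle_le). A shortest integer vector r_0 is
    primitive, so it is the first row of a unimodular matrix with rows r_j. In
    the corresponding canonical coordinates (X, P) of the cotangent bundle of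
    the torus, a point of the disc bundle satisfies |P_j| < f(r_j), as
    P_j = p . r_j. Symplectic polar coordinates, of angle 2 pi X_j and area
    P_j + f(r_j) + e in the j-th plane, embed the disc bundle into a cylinder of
    capacity 2 l + e.

    Lower bound, with a flat metric (capacity_ge_case_metric). In coordinates
    where the metric is Euclidean, F >= G means that the unit disc bundle of the
    metric is contained in that of F. The cotangent lift of a radial map
    y -> h(|y|^2) y embeds the ball of radius r, with pi r^2 < 2 l, into the
    product of a ball of radius less than l/2 and the unit ball: the covector at
    h(|y|^2) y has norm less than 1 as soon as the slope of the radial map is at
    least sqrt (rho^2 - |y|^2), and the radial map with exactly this slope has
    image of radius a quarter of the area of a disc. A ball of radius less than
    l/2 embeds into the torus.

    Lower bound, with the Hofer-Zehnder capacity (c_HZ_disc_bundle_ge). Up to a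
    small loss, the sets f(x) < l/2 and f*(p) < 1 are polytopes given by finitely
    many linear forms w_i and v_j with |v_j . w_i| <= 2/l (norming_families).
    Consider the Hamiltonian h(E), where E is the sum of the (w_i . x)^K and the
    (v_j . p)^K for a large even exponent K, and h is a smooth approximation of
    C E^(2/K) with C slightly smaller than 2 l. A periodic orbit with T <= 1 that
    is not constant would contradict a sharp isoperimetric inequality for the
    two polytopes (no_short_orbit): the action of the orbit, computed from the
    energy, is at most a quarter of the product of the lengths of its two
    projections, since one of them stays within a quarter of its length of a
    midpoint. Hence h(E) is admissible, with a maximum close to 2 l. *)

(** * Functions of class C^k *)

Section Ck_calculus.
Context {R : realType}.
Implicit Types (V W : normedModType R).

Lemma CkW V W k (U : set V) (f : V -> W) : Ck k.+1 U f -> Ck k U f.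
Proof.
elim: k f => [|k IH] f; first by case=> h _ x /h; exact: differentiable_continuous.
by move=> [h1 h2]; split=> // v; apply: IH; exact: h2.
Qed.

Lemma CkD V W k (U : set V) (f g : V -> W) : open U ->
  Ck k U f -> Ck k U g -> Ck k U (f \+ g).
Proof.
move=> oU; elim: k f g => [|k IH] f g /=.
  by move=> cf cg x Ux; exact: cvgD (cf x Ux) (cg x Ux).
case=> f1 f2 [g1 g2]; split=> [x Ux|v]; first exact: differentiableD (f1 x Ux) (g1 x Ux).
apply: eq_Ck (IH _ _ (f2 v) (g2 v)) => // x Ux.
by rewrite /= -deriveD //; apply: diff_derivable; [exact: f1|exact: g1].
Qed.

Lemma CkM V k (U : set V) (f g : V -> R) : open U ->
  Ck k U f -> Ck k U g -> Ck k U (f \* g).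
Proof.
move=> oU; elim: k f g => [|k IH] f g.
  by move=> cf cg x Ux; exact: cvgM (cf x Ux) (cg x Ux).
move=> hf hg; case: (hf) (hg) => f1 f2 [g1 g2].
split=> [x Ux|v]; first exact: differentiableM (f1 x Ux) (g1 x Ux).
have := CkD oU (IH _ _ (CkW hf) (g2 v)) (IH _ _ (CkW hg) (f2 v)).
apply: eq_Ck => // x Ux /=.
by rewrite -[RHS]/('D_v (f * g) x) deriveM //; apply: diff_derivable; [exact: f1|exact: g1].
Qed.

Lemma Ck_sum V W k (U : set V) (I : Type) (r : seq I) (f : I -> V -> W) :
  open U -> (forall i, Ck k U (f i)) -> Ck k U (fun x => \sum_(i <- r) f i x).
Proof.
move=> oU h; elim: r => [|i r IH].
  by apply: eq_Ck (Ck_cst _ _ 0) => // x _; rewrite big_nil.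
by apply: eq_Ck (CkD oU (h i) IH) => // x _; rewrite big_cons.
Qed.

Lemma Ck_linear V W k (U : set V) (f : {linear V -> W}) :
  continuous f -> Ck k U f.
Proof.
move=> cf; case: k => [|k] /=; first by move=> x _; exact: cf.
split=> [x _|v]; first exact: linear_differentiable.
rewrite (_ : 'D_v f = cst (f v)); first exact: Ck_cst.
by apply/funext => x; rewrite deriveE ?diff_lin //; exact: linear_differentiable.
Qed.

(** The derivative of p o f along v is (p' o f) times the derivative of f, so
    the composite is of class C^(k+1) because products and composites are of
    class C^k. *)
Lemma Ck_comp1 V k (U : set V) (U' : set R) (p : R -> R) (f : V -> R) :
  open U -> (forall x, U x -> U' (f x)) -> Ck k U' p -> Ck k U f ->
  Ck k U (p \o f).
Proof.
move=> oU fU; elim: k p f fU => [|k IH] p f fU.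
  move=> cp cf x Ux; apply: continuous_comp; [exact: cf|exact/cp/fU].
move=> [p1 p2] hf; case: (hf) => f1 f2; split=> [x Ux|v].
  apply: differentiable_comp; [exact: f1|exact/p1/fU].
apply: eq_Ck (CkM oU (IH _ _ fU (p2 1) (CkW hf)) (f2 v)) => // x Ux /=.
have df := f1 x Ux; have dp := p1 _ (fU _ Ux).
rewrite (deriveE v (differentiable_comp df dp)) diff_comp //=.
by rewrite diff1E // derive1E -deriveE // mulrC.
Qed.

Lemma derive_coordE V m (f : V -> 'rV[R]_m) x v i : differentiable f x ->
  'D_v (fun x => f x 0 i) x = 'D_v f x 0 i.
Proof.
move=> df; rewrite derive_mx ?mxE //; exact: diff_derivable.
Qed.

Lemma row_sum_coord V m (f : V -> 'rV[R]_m) :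
  f = fun x => \sum_i (f x 0 i) *: delta_mx 0 i.
Proof. by apply/funext => x; exact: row_sum_delta. Qed.

Lemma differentiable_rV V m (f : V -> 'rV[R]_m) x :
  (forall i, differentiable (fun x => f x 0 i) x) -> differentiable f x.
Proof.
move=> h; rewrite (row_sum_coord f).
rewrite (_ : (fun _ => _) = \sum_i (fun x => (f x 0 i) *: (delta_mx 0 i : 'rV[R]_m))).
  by apply: differentiable_sum => i; apply: differentiableZl.
by apply/funext => y; rewrite fct_sumE.
Qed.

Lemma Ck_rV V k (U : set V) m (f : V -> 'rV[R]_m) : open U ->
  (forall i, Ck k U (fun x => f x 0 i)) -> Ck k U f.
Proof.
move=> oU; elim: k f => [|k IH] f h.
  move=> x Ux; apply/cvg_ballP => e e0.
  have : \forall y \near x, forall i, ball (f x 0 i) e (f y 0 i).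
    by apply: filter_forall => i; have /cvg_ballP := h i x Ux; exact.
  by apply: filterS => y hy; split=> // i' i; rewrite (ord1 i').
have d x : U x -> differentiable f x.
  by move=> Ux; apply: differentiable_rV => i; have [+ _] := h i; apply.
split=> // v; apply: IH => i; have [_ /(_ v)] := h i.
by apply: eq_Ck => // x Ux; rewrite derive_coordE //; exact: d.
Qed.

Lemma Ck_coord V k (U : set V) m (f : V -> 'rV[R]_m) i : open U ->
  Ck k U f -> Ck k U (fun x => f x 0 i).
Proof.
move=> oU; elim: k f => [|k IH] f.
  move=> cf x Ux; apply: (@continuous_comp _ _ _ f (fun y : 'rV[R]_m => y 0 i)).
    exact: cf.
  exact: coord_continuous.
case=> f1 f2; split=> [x Ux|v].
  apply: (@differentiable_comp _ _ _ _ f (fun y : 'rV[R]_m => y 0 i)); first exact: f1.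
  exact: differentiable_coord.
apply: eq_Ck (IH _ (f2 v)) => // x Ux.
by rewrite derive_coordE //; exact: f1.
Qed.

Lemma CkU V W k (U U' : set V) (f : V -> W) : Ck k U f -> Ck k U' f ->
  Ck k (U `|` U') f.
Proof.
elim: k f => [|k IH] f /=; first by move=> h h' x [/h|/h'].
by case=> h1 h2 [h1' h2']; split=> [x [/h1|/h1']//|v]; exact: IH.
Qed.

Lemma Ck_id k (U : set R) : Ck k U (id : R -> R).
Proof.
apply: (@Ck_linear _ _ k U (idfun : {linear R -> R})) => x; exact: cvg_id.
Qed.

Lemma Ck_coordR k m (U : set 'rV[R]_m) i : open U -> Ck k U (fun x => x 0 i).
Proof. by move=> oU; apply: Ck_coord => //; exact: (@Ck_linear _ _ k U idfun (fun x => @cvg_id _ _)). Qed.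

Lemma CkX V k (U : set V) (f : V -> R) n : open U -> Ck k U f ->
  Ck k U (fun x => f x ^+ n).
Proof.
move=> oU h; elim: n => [|n IH].
  exact: Ck_cst.
by apply: eq_Ck (CkM oU h IH) => // x _ /=; rewrite exprS.
Qed.

Lemma Ck_derive1 k (U : set R) (f df : R -> R) : open U ->
  (forall x, U x -> is_derive x (1 : R) f (df x)) -> Ck k U df -> Ck k.+1 U f.
Proof.
move=> oU h hd; split=> [x Ux|v].
  by apply/derivable1_diffP; have [] := h x Ux.
apply: eq_Ck (@Ck_scale _ _ _ _ _ _ v oU hd) => // x Ux.
have [d E] := h x Ux; rewrite fctE -E; move/derivable1_diffP : d => d.
rewrite !deriveE // -[in RHS](mulr1 v) -[_ * 1]/(v *: 1).
by rewrite linearZ.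
Qed.

Lemma Ck_expR k (U : set R) : open U -> Ck k U (@expR R).
Proof.
move=> oU; elim: k => [|k IH]; first by move=> x _; exact: continuous_expR.
exact: Ck_derive1.
Qed.

Lemma Ck_sin_cos k (U : set R) : open U -> Ck k U (@sin R) /\ Ck k U (@cos R).
Proof.
move=> oU; elim: k => [|k [IH1 IH2]].
  by split=> x _; [exact: continuous_sin|exact: continuous_cos].
split; first exact: Ck_derive1 IH2.
apply: (@Ck_derive1 _ _ _ (fun x => - sin x)) => //.
apply: eq_Ck (@Ck_scale _ _ _ _ _ _ (-1) oU IH1) => // x Ux.
by rewrite fctE scaleN1r.
Qed.

Lemma Ck_inv k (U : set R) : open U -> (forall x, U x -> x != 0) ->
  Ck k U (fun x : R => x^-1).
Proof.
move=> oU U0; elim: k => [|k IH]; first by move=> x /U0 x0; exact: inv_continuous.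
apply: (@Ck_derive1 _ _ _ (fun x => - (x^-1 * x^-1))) => //.
  move=> x /U0 x0; apply: is_derive_eq; first exact: is_deriveV.
  by rewrite /= expr2 invfM scaler1.
by apply: eq_Ck (@Ck_scale _ _ _ _ _ _ (-1) oU (CkM oU IH IH)) => // x Ux; rewrite fctE scaleN1r.
Qed.

Lemma open_gt0 : open [set x : R | 0 < x].
Proof. exact: open_gt. Qed.

Lemma Ck_sqrt k : Ck k [set x : R | 0 < x] Num.sqrt.
Proof.
elim: k => [|k IH]; first by move=> x _; exact: sqrt_continuous.
apply: (@Ck_derive1 _ _ _ (fun x => (2 * Num.sqrt x)^-1)) => [|].
  exact: open_gt0.
have h : Ck k [set x : R | 0 < x] (2 *: Num.sqrt).
  exact: Ck_scale open_gt0 IH.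
apply: (@Ck_comp1 _ _ _ [set x : R | 0 < x] (fun x => x^-1) (2 *: Num.sqrt)) => //.
- by move=> x /= x0; rewrite fctE mulr_gt0 // sqrtr_gt0.
- by apply: Ck_inv; [exact: open_gt0|move=> x /= x0; rewrite gt_eqF].
Qed.

Lemma Ck_ln k : Ck k [set x : R | 0 < x] (@ln R).
Proof.
case: k => [|k]; first by move=> x /= x0; exact: continuous_ln.
apply: (@Ck_derive1 _ _ _ (fun x => x^-1)).
  exact: open_gt0.
- by apply: Ck_inv; [exact: open_gt0|move=> x /= x0; rewrite gt_eqF].
Qed.

End Ck_calculus.

(** * One-variable calculus *)

Section one_variable.
Context {R : realType}.
Implicit Types (f u U : R -> R).

Lemma is_derive_continuous f (x d : R) : is_derive x (1 : R) f d -> {for x, continuous f}.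
Proof. by case=> /derivable1_diffP h _; exact: differentiable_continuous. Qed.

(** The integral from a is differentiable only to the right of a, whence the
    open half-line. *)
Lemma antiderivative u (a : R) : continuous u ->
  exists U, forall t, a < t -> is_derive t (1 : R) U (u t).
Proof.
move=> cu; exists (fun x => \int[lebesgue_measure]_(t in `[a, x]) u t) => t at_.
have [||h1 h2] := @continuous_FTC1_closed R u a t (t + 1) _ _ at_ (cu t).
- by rewrite ltrDl.
- apply: continuous_compact_integrable; first exact: segment_compact.
  exact: continuous_subspaceT.
by split; [exact: h1|rewrite -derive1E].
Qed.

Lemma increment_le U u V (v : R -> R) (a b : R) : a <= b ->
  (forall t, a <= t <= b -> is_derive t (1 : R) U (u t)) ->
  (forall t, a <= t <= b -> is_derive t (1 : R) V (v t)) ->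
  (forall t, a <= t <= b -> u t <= v t) -> U b - U a <= V b - V a.
Proof.
move=> ab dU dV uv.
have d t : a <= t <= b -> is_derive t (1 : R) (V - U) (v t - u t).
  by move=> tab; have := dU t tab; have := dV t tab => ? ?; exact: is_deriveB.
have [||c] := @MVT_segment R (V - U) (v - u) a b ab.
- move=> t; rewrite in_itv /= => /andP[h1 h2]; apply: d; by rewrite !ltW.
- apply: derivable_within_continuous => t; rewrite in_itv /= => tab.
  by have [] := d t tab.
rewrite in_itv /= => /uv h; rewrite !fctE => E.
have : 0 <= (v c - u c) * (b - a) by rewrite mulr_ge0 // subr_ge0.
by rewrite -E; lra.
Qed.

Lemma increment_eq U u V (a b : R) : a <= b ->
  (forall t, a <= t <= b -> is_derive t (1 : R) U (u t)) ->
  (forall t, a <= t <= b -> is_derive t (1 : R) V (u t)) ->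
  U b - U a = V b - V a.
Proof.
by move=> ab dU dV; apply/eqP; rewrite eq_le !(increment_le ab) //.
Qed.

Lemma increment_ge0 U u (a b : R) : a <= b ->
  (forall t, a <= t <= b -> is_derive t (1 : R) U (u t)) ->
  (forall t, a <= t <= b -> 0 <= u t) -> U a <= U b.
Proof.
move=> ab dU u0.
have := @increment_le (fun=> 0) (fun=> 0) U u a b ab (fun t _ => is_derive_cst (0 : R) t (1 : R)) dU u0.
by rewrite subrr subr_ge0.
Qed.

Lemma is_derive_mul (V : normedModType R) (f g : V -> R) (x v : V) (df dg : R) :
  is_derive x v f df -> is_derive x v g dg ->
  is_derive x v (fun y => f y * g y) (f x * dg + g x * df).
Proof. by move=> h1 h2; exact: is_deriveM. Qed.

Lemma is_derive_add (V W : normedModType R) (f g : V -> W) (x v : V) (df dg : W) :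
  is_derive x v f df -> is_derive x v g dg ->
  is_derive x v (fun y => f y + g y) (df + dg).
Proof. by move=> h1 h2; exact: is_deriveD. Qed.

Lemma is_derive_opp (V W : normedModType R) (f : V -> W) (x v : V) (df : W) :
  is_derive x v f df -> is_derive x v (fun y => - f y) (- df).
Proof. by move=> h1; exact: is_deriveN. Qed.

Lemma is_derive_scale (V : normedModType R) (f : V -> R) (x v : V) (df : R) (c : R) :
  is_derive x v f df -> is_derive x v (fun y => c * f y) (c * df).
Proof. by move=> h1; exact: is_deriveZ. Qed.

Lemma is_derive_pow (V : normedModType R) (f : V -> R) (x v : V) (df : R) n :
  is_derive x v f df ->
  is_derive x v (fun y => f y ^+ n) (n%:R * f x ^+ n.-1 * df).
Proof.
move=> h; elim: n => [|n IH].
  rewrite mul0r mul0r; exact: is_derive_cst.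
apply: is_derive_eq.
  rewrite (_ : (fun y => _) = (fun y => f y * f y ^+ n)); last first.
    by apply/funext => y; rewrite exprS.
  exact: is_derive_mul h IH.
case: n {IH} => [|n] /=; first by rewrite expr0; ring.
by rewrite -(natr1 n.+1) exprS; move: (n.+1%:R) => c; ring.
Qed.

Lemma is_derive_bigsum (V W : normedModType R) (I : Type) (r : seq I)
    (f : I -> V -> W) (df : I -> W) (x v : V) :
  (forall i, is_derive x v (f i) (df i)) ->
  is_derive x v (fun y => \sum_(i <- r) f i y) (\sum_(i <- r) df i).
Proof.
move=> h; elim: r => [|i r IH].
  rewrite big_nil (_ : (fun y => _) = cst 0); first exact: is_derive_cst.
  by apply/funext => y; rewrite big_nil.
rewrite big_cons (_ : (fun y => _) = fun y => f i y + \sum_(j <- r) f j y).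
  exact: is_derive_add.
by apply/funext => y; rewrite big_cons.
Qed.

Lemma is_derive_chain (V : normedModType R) (p : R -> R) (f : V -> R) (x v : V) (dp df : R) :
  differentiable f x -> is_derive (f x) (1 : R) p dp -> is_derive x v f df ->
  is_derive x v (fun y => p (f y)) (dp * df).
Proof.
move=> df' [/derivable1_diffP p1 <-] [_ <-].
have d := differentiable_comp df' p1.
apply: DeriveDef; first exact: diff_derivable.
rewrite (deriveE v d) diff_comp //= diff1E // derive1E -deriveE // mulrC //.
Qed.

Lemma is_derive_chain1 (p : R -> R) (f : R -> R) (x : R) (dp df : R) :
  is_derive (f x) (1 : R) p dp -> is_derive x (1 : R) f df ->
  is_derive x (1 : R) (fun y => p (f y)) (dp * df).
Proof.
by move=> h1 h2; apply: is_derive_chain => //; apply/derivable1_diffP; case: h2.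
Qed.

Lemma is_derive_invr (x : R) : x != 0 ->
  is_derive x (1 : R) (fun x => x^-1) (- (x^-1) ^+ 2).
Proof.
move=> x0; apply: is_derive_eq; first exact: is_deriveV.
by rewrite /= exprVn scaler1.
Qed.

Lemma is_derive_littleo f (x : R) :
  (forall e, 0 < e -> exists2 d, 0 < d &
     forall h, `|h| <= d -> `|f (x + h) - f x| <= e * `|h|) ->
  is_derive x (1 : R) f 0.
Proof.
move=> H.
have L : (fun h => h^-1 *: (f (h *: (1:R) + x) - f x)) @ 0^' --> (0 : R).
  apply/cvgrPdist_le => e e0; have [d d0 Hd] := H e e0; near=> h.
  rewrite sub0r normrN normrM normfV.
  have h0 : h != 0 by near: h; exact: nbhs_dnbhs_neq.
  rewrite ler_pdivrMl ?normr_gt0 //.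
  rewrite -[h *: 1]/(h * 1) mulr1 [h + x]addrC mulrC; apply: Hd.
  by near: h; exact: dnbhs0_le.
exact: DeriveDef (cvgP _ L) (cvg_lim _ L).
Unshelve. all: by end_near. Qed.

(** This gives the derivative of a function at a point where it is flat, in
    particular where two pieces are glued. *)
Lemma is_derive_quadratic f (x C : R) :
  (forall h, `|f (x + h) - f x| <= C * h ^+ 2) -> is_derive x (1 : R) f 0.
Proof.
move=> H; have C0 : 0 <= C.
  by have := le_trans (normr_ge0 _) (H 1); rewrite expr1n mulr1.
apply: is_derive_littleo => e e0; exists (e / (C + 1)).
  by rewrite divr_gt0 //; lra.
move=> h hd; apply: le_trans (H h) _.
rewrite -(real_normK (num_real h)) expr2 mulrA ler_wpM2r //.
move: hd; rewrite ler_pdivlMr; last lra.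
by have := normr_ge0 h; nra.
Qed.

Lemma lipschitz_derive (g dg : R -> R) (M s : R) :
  (forall t, `|t| <= `|s| -> is_derive t (1 : R) g (dg t) /\ `|dg t| <= M) ->
  `|g s - g 0| <= M * `|s|.
Proof.
have H (g1 dg1 : R -> R) (r : R) : 0 <= r ->
    (forall t : R, 0 <= t <= r -> is_derive t (1 : R) g1 (dg1 t) /\ `|dg1 t| <= M) ->
    `|g1 r - g1 0| <= M * r.
  move=> r0 h.
  have hd c (t : R) : is_derive t (1 : R) (fun x => c * x) c.
    by rewrite -[X in is_derive _ _ _ X]mulr1; exact: is_derive_scale.
  rewrite ler_norml; apply/andP; split.
    have := @increment_le (fun x => - M * x) (cst (- M)) g1 dg1 0 r r0.
    rewrite mulr0 subr0 mulNr; apply => t tr; have [h1 h2] := h t tr => //.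
    by move: h2; rewrite ler_norml => /andP[].
  have := @increment_le g1 dg1 (fun x => M * x) (cst M) 0 r r0.
  rewrite mulr0 subr0; apply => t tr; have [h1 h2] := h t tr => //.
  by move: h2; rewrite ler_norml => /andP[].
move=> h; have [s0|s0] := leP 0 s.
  rewrite (ger0_norm s0); apply: (H g dg) => // t /andP[t0 ts].
  by apply: h; rewrite !ger0_norm.
rewrite (ltr0_norm s0).
have := @H (fun t => g (- t)) (fun t => - dg (- t)) (- s).
rewrite opprK oppr0; apply; first by rewrite oppr_ge0 ltW.
move=> t /andP[t0 ts]; have [|h1 h2] := h (- t).
  by rewrite normrN (ltr0_norm s0) ger0_norm.
split; last by rewrite normrN.
rewrite -mulrN1; apply: (@is_derive_chain1 g (fun t : R => - t)) => //.
Qed.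

Lemma Rintegral_FTC U u (a b : R) : a < b -> continuous u ->
  (forall t, is_derive t (1 : R) U (u t)) ->
  \int[lebesgue_measure]_(t in `[a, b]) u t = U b - U a.
Proof.
move=> ab cu dU; rewrite /Rintegral (@continuous_FTC2 R u U) //.
- exact: continuous_subspaceT.
- split.
  + by move=> t _; have [] := dU t.
  + by apply: cvg_at_right_filter; exact: is_derive_continuous (dU a).
  + by apply: cvg_at_left_filter; exact: is_derive_continuous (dU b).
- by move=> t _; rewrite derive1E; have [_ ->] := dU t.
Qed.

Lemma segment_integrable u (a b : R) : continuous u ->
  (@lebesgue_measure R).-integrable `[a, b]%classic (EFin \o u).
Proof.
move=> cu; apply: continuous_compact_integrable; first exact: segment_compact.
exact: continuous_subspaceT.
Qed.

(** The functions y^-m exp(-1/y), extended by 0 to y <= 0: all the derivatives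
    of the case m = 0 are linear combinations of them, so that the family is
    proved smooth as a whole. *)
Definition flat_exp (m : nat) (y : R) : R :=
  if 0 < y then y^-1 ^+ m * expR (- y^-1) else 0.

Lemma flat_exp_le0 m y : y <= 0 -> flat_exp m y = 0.
Proof. by rewrite /flat_exp => y0; case: ltP => //; lra. Qed.

Lemma flat_exp_ge0 m y : 0 <= flat_exp m y.
Proof.
rewrite /flat_exp; case: ifP => // y0; rewrite mulr_ge0 ?expR_ge0 //.
by rewrite exprn_ge0 // invr_ge0 ltW.
Qed.

Lemma flat_exp0_gt0 y : 0 < y -> 0 < flat_exp 0 y.
Proof. by rewrite /flat_exp => ->; rewrite expr0 mul1r expR_gt0. Qed.

Lemma flat_exp_quadratic m y : flat_exp m y <= m.+2`!%:R * y ^+ 2.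
Proof.
rewrite /flat_exp; case: ifPn => [y0|_]; last first.
  by rewrite mulr_ge0 // exprn_even_ge0.
have z0 : 0 < y^-1 by rewrite invr_gt0.
have := expR_ge1Dxn m.+1 (ltW z0).
have f0 : (0 : R) < m.+2`!%:R by rewrite ltr0n fact_gt0.
have e0 := expR_gt0 y^-1.
move=> h; rewrite expRN ler_pdivrMr //.
have {h} h : y^-1 ^+ m.+2 <= m.+2`!%:R * expR y^-1.
  rewrite -ler_pdivrMl // mulrC; lra.
have y2 : y ^+ 2 != 0 by rewrite expf_eq0 /= gt_eqF.
have -> : y^-1 ^+ m = y^-1 ^+ m.+2 * y ^+ 2.
  by rewrite -addn2 exprD (exprVn _ 2) -mulrA mulVf ?mulr1.
have y20 : 0 < y ^+ 2 by rewrite exprn_gt0.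
by rewrite [leRHS]mulrAC (ler_pM2r y20).
Qed.

Lemma is_derive_flat_exp m y :
  is_derive y (1 : R) (flat_exp m) (flat_exp m.+2 y - m%:R * flat_exp m.+1 y).
Proof.
have [y0|y0|->] := ltgtP y 0.
- rewrite !flat_exp_le0 ?ltW // mulr0 subr0.
  apply: (@near_eq_is_derive _ _ _ (cst 0)).
  near=> z; rewrite flat_exp_le0 //; apply: ltW; near: z; exact: lt_nbhsl.
- have := y0; rewrite /flat_exp => ->.
  have yn : y != 0 by rewrite gt_eqF.
  suff : is_derive y (1 : R) (fun y : R => y^-1 ^+ m * expR (- y^-1))
    (y^-1 ^+ m.+2 * expR (- y^-1) - m%:R * (y^-1 ^+ m.+1 * expR (- y^-1))).
    apply: near_eq_is_derive.
    by near=> z; rewrite ifT //; near: z; exact: lt_nbhsr.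
  apply: is_derive_eq.
    apply: is_derive_mul; first exact/is_derive_pow/is_derive_invr.
    apply: (@is_derive_chain1 expR (fun y : R => - y^-1)).
    exact/is_derive_opp/is_derive_invr.
  case: m => [|m] /=; first by rewrite !mul0r; ring.
  by rewrite !exprS; ring.
- rewrite !flat_exp_le0 // mulr0 subr0; apply: (@is_derive_quadratic _ _ m.+2`!%:R).
  by move=> h; rewrite add0r (flat_exp_le0 m (lexx 0)) subr0 ger0_norm ?flat_exp_ge0 // flat_exp_quadratic.
Unshelve. all: by end_near. Qed.

Lemma Ck_flat_exp k m : Ck k setT (flat_exp m).
Proof.
elim: k m => [|k IH] m.
  by move=> x _; apply: is_derive_continuous; exact: is_derive_flat_exp.
apply: Ck_derive1 (fun x _ => is_derive_flat_exp m x) _; first exact: openT.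
have h := @Ck_scale _ _ _ _ _ _ (- m%:R) openT (IH m.+1).
apply: eq_Ck (CkD openT (IH m.+2) h) => [|x _]; first exact: openT.
by rewrite -mulNr.
Qed.

Definition smooth_step (y : R) : R :=
  flat_exp 0 y / (flat_exp 0 y + flat_exp 0 (1 - y)).

Lemma smooth_step_den y : 0 < flat_exp 0 y + flat_exp 0 (1 - y).
Proof.
have [y0|y0] := ltP 0 y.
  by rewrite ltr_wpDr ?flat_exp_ge0 // flat_exp0_gt0.
by rewrite ltr_wpDl ?flat_exp_ge0 // flat_exp0_gt0 //; lra.
Qed.

Lemma smooth_step_itv y : 0 <= smooth_step y <= 1.
Proof.
rewrite /smooth_step divr_ge0 ?flat_exp_ge0 //=; last exact/ltW/smooth_step_den.
by rewrite ler_pdivrMr ?smooth_step_den // mul1r lerDl flat_exp_ge0.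
Qed.

Lemma smooth_step_le0 y : y <= 0 -> smooth_step y = 0.
Proof. by move=> y0; rewrite /smooth_step flat_exp_le0 // mul0r. Qed.

Lemma smooth_step_ge1 y : 1 <= y -> smooth_step y = 1.
Proof.
move=> y1; rewrite /smooth_step (@flat_exp_le0 _ (1 - y)) ?addr0; last lra.
by rewrite mulfV // gt_eqF // flat_exp0_gt0; lra.
Qed.

Lemma Ck_affine k (U : set R) (a b : R) : open U -> Ck k U (fun x : R => a * x + b).
Proof.
move=> oU.
exact: (CkD oU (@Ck_scale _ _ _ _ _ _ a oU (Ck_id k U)) (Ck_cst _ _ b)).
Qed.

Lemma Ck_comp_affine k (f : R -> R) (a b : R) :
  Ck k setT f -> Ck k setT (fun x => f (a * x + b)).
Proof.
move=> h; apply: (@Ck_comp1 _ _ _ _ setT f (fun x => a * x + b)) => //.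
  exact: openT.
exact: Ck_affine openT.
Qed.

Lemma Ck_smooth_step k : Ck k setT smooth_step.
Proof.
have h := Ck_flat_exp k 0.
have h' : Ck k setT (fun y : R => flat_exp 0 (1 - y)).
  apply: eq_Ck (Ck_comp_affine (-1) 1 h) => [|y _]; first exact: openT.
  by congr flat_exp; ring.
have hd := CkD openT h h'.
apply: (CkM openT h); apply: (@Ck_comp1 _ _ _ _ [set y : R | 0 < y] (fun y => y^-1)) hd.
- exact: openT.
- by move=> y _; exact: smooth_step_den.
- by apply: Ck_inv; [exact: open_gt0|move=> x /= x0; rewrite gt_eqF].
Qed.

(** The function h integrates the slope C beta E^(beta-1) of C E^beta,
    multiplied by a bump function that is 1 on [2d, 1-2d] and 0 outside [d,
    1-d]: this bounds hd from above, and h 1 from below by the increment of C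
    E^beta over [2d, 1-2d]. *)
Lemma smooth_profile (beta C d : R) : 0 < beta -> 0 < C -> 0 < d < 4^-1 ->
  exists h hd : R -> R, [/\ Cinfty setT h,
    forall E, is_derive E (1 : R) h (hd E),
    forall E, 0 <= hd E /\ (0 < E -> hd E <= C * (beta * E `^ (beta - 1))),
    (forall E, E <= d -> h E = 0) /\ (forall E, 1 - d <= E -> h E = h 1) &
    C * ((1 - 2 * d) `^ beta - (2 * d) `^ beta) <= h 1].
Proof.
move=> beta0 C0 /andP[d0 d4].
pose b E := smooth_step (d^-1 * E + (- 1)) * smooth_step (- d^-1 * E + ((1 - d) / d)).
have b01 E : 0 <= b E <= 1.
  have /andP[? ?] := smooth_step_itv (d^-1 * E + (- 1)).
  have /andP[? ?] := smooth_step_itv (- d^-1 * E + ((1 - d) / d)).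
  by rewrite /b mulr_ge0 //= mulr_ile1.
have bl E : E <= d -> b E = 0.
  move=> Ed; rewrite /b smooth_step_le0 ?mul0r // subr_le0 mulrC ler_pdivrMr //; lra.
have br E : 1 - d <= E -> b E = 0.
  move=> Ed; rewrite /b (@smooth_step_le0 (_ + _ / _)) ?mulr0 //.
  rewrite mulNr addrC subr_le0 (mulrC _ E) ler_pM2r ?invr_gt0 //.
have bm E : 2 * d <= E <= 1 - 2 * d -> b E = 1.
  move=> /andP[E1 E2]; rewrite /b !smooth_step_ge1 ?mulr1 //.
    rewrite mulNr -mulrC -mulNr -mulrDl ler_pdivlMr //; lra.
  rewrite lerBrDr mulrC ler_pdivlMr //; lra.
pose hd E := b E * (C * (beta * E `^ (beta - 1))).
have hdl E : E <= d -> hd E = 0 by move=> /bl h; rewrite /hd h mul0r.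
have hdr E : 1 - d <= E -> hd E = 0 by move=> /br h; rewrite /hd h mul0r.
have hd0 E : 0 <= hd E.
  rewrite /hd mulr_ge0 //; first by have /andP[] := b01 E.
  by apply: mulr_ge0; [exact: ltW|apply: mulr_ge0; [exact: ltW|exact: powR_ge0]].
have hdE E : 0 < E -> hd E = b E * (C * (beta * expR ((beta - 1) * ln E))).
  by move=> E0; rewrite /hd /powR gt_eqF.
have hdC k : Ck k setT hd.
  have h1 : Ck k [set E : R | E < d] hd.
    by apply: eq_Ck (Ck_cst _ _ 0) => [|E /ltW /hdl ->]; first exact: open_lt.
  have h2 : Ck k [set E : R | 0 < E] hd.
    apply: (@eq_Ck _ _ _ _ _ (fun E => b E * (C * (beta * expR ((beta - 1) * ln E))))).
    - exact: open_gt0.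
    - by move=> E /= E0; rewrite hdE.
    apply: CkM; first exact: open_gt0.
      apply: (@CkS _ _ _ _ setT) => //.
      by apply: (CkM openT); apply: Ck_comp_affine; exact: Ck_smooth_step.
    apply: (@Ck_scale _ _ _ _ _ (fun E => beta * expR ((beta - 1) * ln E))).
      exact: open_gt0.
    apply: (@Ck_scale _ _ _ _ _ (fun E => expR ((beta - 1) * ln E))).
      exact: open_gt0.
    apply: (@Ck_comp1 _ _ _ _ setT expR (fun E => (beta - 1) * ln E)) => //.
      exact/Ck_expR/openT.
    apply: (@Ck_scale _ _ _ _ _ (@ln R)); first exact: open_gt0.
    exact: Ck_ln.
  apply: CkS (CkU h1 h2) => E _ /=; have [?|?] := ltP E d; [by left|right].
  by apply: lt_le_trans d0 _.
have hdc : continuous hd by move=> E; exact: (hdC 0%N E I).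
have [U dU] := antiderivative (-1) hdc.
pose h E := if E <= 0 then 0 else U E - U 0.
have U0 E : 0 <= E <= d -> U E = U 0.
  move=> /andP[E0 Ed]; apply/eqP; rewrite -subr_eq0; apply/eqP.
  have := @increment_eq U hd (cst 0) 0 E E0; rewrite subrr; apply.
    by move=> t /andP[t0 _]; apply: dU; lra.
  by move=> t /andP[_ tE]; rewrite hdl; [exact: is_derive_cst|lra].
have hl E : E <= d -> h E = 0.
  move=> Ed; rewrite /h; case: leP => // E0; rewrite U0 ?subrr //.
  by rewrite ltW.
have dh E : is_derive E (1 : R) h (hd E).
  have [Ed|Ed] := ltP E d.
    rewrite hdl ?ltW //; apply: (@near_eq_is_derive _ _ _ (cst 0)).
    by near=> z; rewrite hl // ltW //; near: z; exact: lt_nbhsl.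
  apply: (@near_eq_is_derive _ _ _ (fun z : R => U z + (- U 0))).
    near=> z; rewrite /h ifF //; apply/negbTE; rewrite -ltNge.
    by near: z; apply: lt_nbhsr; lra.
  rewrite -[hd E]addr0; apply: is_derive_add; first by apply: dU; lra.
have mono x y : x <= y -> h x <= h y.
  move=> xy; have := @increment_le (cst 0) (cst 0) h hd x y xy.
  rewrite /cst subrr subr_ge0; apply => t _; exact: hd0.
exists h, hd; split.
- case=> [|k]; first by move=> x _; exact: is_derive_continuous (dh x).
  by apply: Ck_derive1 (fun x _ => dh x) (hdC k); exact: openT.
- exact: dh.
- move=> E; split=> // E0; rewrite /hd ler_piMl //; last by have /andP[] := b01 E.
  by apply: mulr_ge0; [exact: ltW|apply: mulr_ge0; [exact: ltW|exact: powR_ge0]].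
- split=> // E dE.
  have e (x y : R) : 1 - d <= x -> x <= y -> h y = h x.
    move=> dx xy; apply/eqP; rewrite -subr_eq0; apply/eqP.
    have := @increment_eq h hd (cst 0) x y xy; rewrite subrr; apply.
    by move=> t /andP[tx _]; rewrite hdr; [exact: is_derive_cst|lra].
  by have [E1|E1] := leP E 1; [rewrite (e E 1)|rewrite (e 1 E) //; lra].
- apply: (@le_trans _ _ (h (1 - 2 * d) - h (2 * d))); last first.
    have := mono (1 - 2 * d) 1; have := mono 0 (2 * d).
    rewrite (hl 0); last by rewrite ltW.
    by move=> h1 h2; have := h1 _; have := h2 _; lra.
  rewrite mulrBr.
  apply: (@increment_le (fun E : R => C * E `^ beta) hd h hd) => //; first lra.
  move=> t /andP[t1 t2]; rewrite /hd bm ?t1 ?mul1r //.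
  apply: is_derive_scale.
  have t0 : t \in `]0, +oo[%R by rewrite in_itv /= andbT; lra.
  by split; [exact: derivable_powR|rewrite -derive1E powR_derive1].
Unshelve. all: by end_near. Qed.

End one_variable.

(** * Angles and winding numbers *)

Section angles.
Context {R : realType}.

Lemma periodic_int (T : Type) (f : R -> T) : (forall t, f (t + 1) = f t) ->
  forall t (z : int), f (t + z%:~R) = f t.
Proof.
move=> H.
have Hn n t : f (t + n%:R) = f t.
  elim: n t => [|n IH] t; first by rewrite addr0.
  by rewrite -natr1 addrA H IH.
move=> t [n|n]; first exact: Hn.
rewrite NegzE mulrNz -[in RHS](subrK n.+1%:R t).
by rewrite -[(n.+1)%:~R]/(n.+1%:R) Hn.
Qed.

Lemma cos_2piint (z : int) : cos (2 * pi * z%:~R) = 1 :> R.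
Proof.
have := @periodic_int R (fun t => cos (2 * pi * t)) _ 0 z.
rewrite mulr0 cos0 add0r; apply=> t.
by rewrite mulrDr mulr1 mulr_natl cosD2pi.
Qed.

Lemma sin_2piint (z : int) : sin (2 * pi * z%:~R) = 0 :> R.
Proof.
have := @periodic_int R (fun t => sin (2 * pi * t)) _ 0 z.
rewrite mulr0 sin0 add0r; apply=> t.
by rewrite mulrDr mulr1 mulr_natl sinD2pi.
Qed.

Lemma cos_2pi_periodic (t u : R) : u \is a Num.int ->
  cos (2 * pi * (t + u)) = cos (2 * pi * t).
Proof.
by move=> /intrP[z ->]; rewrite mulrDr cosD cos_2piint sin_2piint mulr1 mulr0 subr0.
Qed.

Lemma sin_2pi_periodic (t u : R) : u \is a Num.int ->
  sin (2 * pi * (t + u)) = sin (2 * pi * t).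
Proof.
by move=> /intrP[z ->]; rewrite mulrDr sinD cos_2piint sin_2piint mulr1 mulr0 addr0.
Qed.

Lemma cos_2pi_eq1 (t : R) : cos (2 * pi * t) = 1 -> t \is a Num.int.
Proof.
move=> h.
pose u := t - (Num.floor t)%:~R.
have u0 : 0 <= u by rewrite subr_ge0 floor_le.
have u1 : u < 1 by have := floorD1_gt t; rewrite intrD1 /u; lra.
have cu : cos (2 * pi * u) = 1.
  by rewrite /u -mulrNz cos_2pi_periodic.
suff u0' : u = 0 by rewrite -(subrK (Num.floor t)%:~R t) -/u u0' add0r intr_int.
apply: contrapT => /eqP un.
have p0 := pi_gt0 R.
have : 0 < sin (pi * u).
  apply: sin_gt0_pi; rewrite mulr_gt0 //=; last by rewrite lt_neqAle eq_sym un.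
  by rewrite -[ltRHS]mulr1 ltr_pM2l.
suff : sin (pi * u) ^+ 2 = 0 by move/eqP; rewrite sqrf_eq0 => /eqP ->; rewrite ltxx.
have e : 2 * pi * u = (pi * u) *+ 2 by rewrite mulr2n; ring.
move: cu; rewrite e cos_mulr2n cos2sin2 => h'; lra.
Qed.

Lemma cos_sin_2pi_eq (a b : R) : cos (2 * pi * a) = cos (2 * pi * b) ->
  sin (2 * pi * a) = sin (2 * pi * b) -> a - b \is a Num.int.
Proof.
move=> h1 h2; apply: cos_2pi_eq1; rewrite mulrBr cosB h1 h2.
by rewrite -!expr2 cos2Dsin2.
Qed.

Lemma angle_exists (c s : R) : c ^+ 2 + s ^+ 2 = 1 ->
  exists x, cos (2 * pi * x) = c /\ sin (2 * pi * x) = s.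
Proof.
move=> h.
have c1 : -1 <= c <= 1.
  rewrite -ler_norml -(@ler_pXn2r _ 2) ?nnegrE // expr1n real_normK ?num_real //.
  by have := sqr_ge0 s; lra.
have p0 := pi_gt0 R.
have E y : 2 * pi * (y / (2 * pi)) = y :> R by rewrite mulrC divfK //; lra.
have ss : Num.sqrt (1 - c ^+ 2) = `|s|.
  by rewrite (_ : 1 - _ = s ^+ 2) ?sqrtr_sqr //; lra.
have [s0|s0] := leP 0 s.
  exists (acos c / (2 * pi)); rewrite E acosK ?sin_acos ?ss ?ger0_norm //.
exists (- acos c / (2 * pi)); rewrite E cosN sinN acosK ?sin_acos ?ss ?ltr0_norm ?opprK //.
Qed.

Lemma int_continuous_const (g : R -> R) : continuous g ->
  (forall t, g t \is a Num.int) -> forall a b, g a = g b.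
Proof.
move=> cg gi.
suff H a b : a < b -> g a = g b.
  by move=> a b; have [/H|/H|->] := ltgtP a b.
move=> ab; apply: contrapT => /eqP gab.
have /intrP[k kE] := gi a; have /intrP[l lE] := gi b.
pose m : int := Num.min k l.
have kl : k != l by apply: contra gab => /eqP e; rewrite kE lE e.
have [||c cab gc] := @IVT R g a b (m%:~R + 2^-1) (ltW ab).
- exact: continuous_subspaceT.
- rewrite kE lE /m; have [h|h] := ltP k l.
  + have : k + 1 <= l by rewrite lezD1.
    rewrite -(ler_int R) intrD /= => h'.
    by rewrite min_l ?max_r; [apply/andP; split| |]; lra.
  + have : l + 1 <= k by rewrite lezD1 lt_neqAle eq_sym kl.
    rewrite -(ler_int R) intrD /= => h'.
    by rewrite min_r ?max_l; [apply/andP; split| |]; lra.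
have /intrP[z zE] := gi c.
have h1 : (m < z)%R by rewrite -(ltr_int R) -zE gc; lra.
have h2 : (z < m + 1)%R by rewrite -(ltr_int R) -zE gc intrD /=; lra.
by move: h1 h2; rewrite ltzD1 leNgt => ->.
Qed.

Section winding.
Variables (C S : R * R -> R).
Hypotheses (cC : continuous C) (cS : continuous S)
  (CS1 : forall z, C z ^+ 2 + S z ^+ 2 = 1)
  (C_per : forall s t, C (s, t + 1) = C (s, t))
  (S_per : forall s t, S (s, t + 1) = S (s, t)).

Let lifts (s : R) := exists x : R -> R, [/\ continuous x,
  forall t, x (t + 1) = x t &
  forall t, cos (2 * pi * x t) = C (s, t) /\ sin (2 * pi * x t) = S (s, t)].

(** The scalar product of the two unit vectors is 1 when s = s0; it stays
    positive near s0, uniformly in t because a period is compact. *)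
Lemma winding_tube s0 :
  \forall s \near s0, forall t, 0 < C (s0, t) * C (s, t) + S (s0, t) * S (s, t).
Proof.
have nc := (compact_near_coveringP _).1 (@segment_compact R 0 1).
pose P s t := 0 < C (s0, t) * C (s, t) + S (s0, t) * S (s, t).
have H : forall t : R, `[0, 1]%classic t -> \forall t' \near t & s \near s0, P s t'.
  move=> t _; pose Phi (z : R * R) := C (s0, z.1) * C (z.2, z.1) + S (s0, z.1) * S (z.2, z.1).
  have c1 (G : R * R -> R) : continuous G -> {for (t, s0), continuous (fun z : R * R => G (s0, z.1))}.
    move=> cG; apply: (@continuous_comp _ _ _ (fun z : R * R => (s0, z.1)) G); last exact: cG.
    have f1 : {for (t, s0), continuous (fun z : R * R => z.1)} by exact: cvg_fst.
    exact: cvg_pair (cvg_cst s0) f1.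
  have c2 (G : R * R -> R) : continuous G -> {for (t, s0), continuous (fun z : R * R => G (z.2, z.1))}.
    move=> cG; apply: (@continuous_comp _ _ _ (fun z : R * R => (z.2, z.1)) G); last exact: cG.
    have f1 : {for (t, s0), continuous (fun z : R * R => z.1)} by exact: cvg_fst.
    have f2 : {for (t, s0), continuous (fun z : R * R => z.2)} by exact: cvg_snd.
    exact: cvg_pair f2 f1.
  have cPhi : {for (t, s0), continuous Phi}.
    exact: cvgD (cvgM (c1 _ cC) (c2 _ cC)) (cvgM (c1 _ cS) (c2 _ cS)).
  have := cPhi [set r | 0 < r]; apply; apply: open_nbhs_nbhs; split; first exact: open_gt.
  by rewrite /Phi /= -!expr2 CS1.
have nP := nc R (nbhs s0) P (nbhs_filter s0) H.
apply: (filterS _ nP) => s hs t.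
have := hs (t - (Num.floor t)%:~R) _; rewrite /P.
have e (G : R * R -> R) s' : (forall s t, G (s, t + 1) = G (s, t)) ->
    G (s', t - (Num.floor t)%:~R) = G (s', t).
  by move=> h; rewrite -mulrNz (@periodic_int _ (fun t => G (s', t))).
rewrite !(e C) // !(e S) //; apply.
rewrite /= in_itv /= subr_ge0 floor_le /=.
by have := floorD1_gt t; rewrite intrD1; lra.
Qed.

(** The angle from the loop at s to the loop at s' stays in (-pi/2, pi/2), so
    it is the arcsine of the determinant of the two unit vectors; adding this
    periodic function to a periodic angle of the first loop gives one of the
    second loop. *)
Lemma winding_step s s' : (forall t, 0 < C (s, t) * C (s', t) + S (s, t) * S (s', t)) ->
  lifts s -> lifts s'.
Proof.
move=> pos [x [cx px xE]].
pose b t := C (s, t) * S (s', t) - S (s, t) * C (s', t).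
pose a t := C (s, t) * C (s', t) + S (s, t) * S (s', t).
have ab t : a t ^+ 2 = 1 - b t ^+ 2.
  have h1 := CS1 (s, t); have h2 := CS1 (s', t); rewrite /a /b.
  have : (C (s, t) ^+ 2 + S (s, t) ^+ 2) * (C (s', t) ^+ 2 + S (s', t) ^+ 2) = 1.
    by rewrite h1 h2 mulr1.
  by move=> <-; ring.
have b1 t : -1 < b t < 1.
  rewrite -ltr_norml -(@ltr_pXn2r _ 2) ?nnegrE // expr1n real_normK ?num_real //.
  have : 0 < a t ^+ 2 by rewrite exprn_gt0 //; exact: pos.
  by rewrite ab; lra.
have cb : continuous b.
  move=> t; have cG (G : R * R -> R) s1 : continuous G -> {for t, continuous (fun t => G (s1, t))}.
    by move=> cG; exact: (partial_continuous (x := s1) cG).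
  exact: cvgB (cvgM (cG C s cC) (cG S s' cS)) (cvgM (cG S s cS) (cG C s' cC)).
have p0 := pi_gt0 R.
exists (fun t => x t + asin (b t) / (2 * pi)); split.
- move=> t; apply: cvgD; first exact: cx.
  apply: cvgMl; apply: (@continuous_comp _ _ _ b (@asin R)); first exact: cb.
  exact: continuous_asin.
- by move=> t; rewrite px /b !C_per !S_per.
move=> t; have [h1 h2] := xE t.
have E : 2 * pi * (x t + asin (b t) / (2 * pi)) = 2 * pi * x t + asin (b t).
  by rewrite mulrDr [2 * pi * (asin _ / _)]mulrC divfK //; lra.
have /andP[bl br] := b1 t.
have bi : -1 <= b t <= 1 by rewrite !ltW.
have sb : sin (asin (b t)) = b t by rewrite asinK.
have ca : cos (asin (b t)) = a t.
  by rewrite cos_asin // -ab sqrtr_sqr gtr0_norm //; exact: pos.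
have h3 := CS1 (s, t).
rewrite E cosD sinD ca sb h1 h2 /a /b; split.
  by rewrite -[RHS]mul1r; rewrite -[X in _ = X * _]h3; ring.
by rewrite -[RHS]mul1r; rewrite -[X in _ = X * _]h3; ring.
Qed.

(** The set of the s for which the loop has a periodic angle is open and
    closed and contains 1. At s = 0, a periodic angle differs from k t by a
    continuous function with integral values, hence by a constant, which is
    possible only if k = 0. *)
Lemma winding_number_zero (k : int) (c1 s1 : R) :
  (forall t, C (0, t) = cos (2 * pi * (k%:~R * t)) /\
             S (0, t) = sin (2 * pi * (k%:~R * t))) ->
  (forall t, C (1, t) = c1 /\ S (1, t) = s1) -> k = 0.
Proof.
move=> H0 H1.
have l1 : lifts 1.
  have [e1 e2] := H1 0; have [x [xc xs]] := angle_exists (CS1 (1, 0)).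
  exists (cst x); split => //; first exact: cst_continuous.
  by move=> t; have [-> ->] := H1 t; rewrite xc xs.
have near_eq s0 : \forall s \near s0, lifts s0 <-> lifts s.
  apply: filterS (winding_tube s0) => s hs; split; apply: winding_step => // t.
  by rewrite mulrC [S _ * _]mulrC.
have lT : [set s | lifts s] = setT.
  have cT : connected [set: R] by apply/connected_intervalP.
  apply: cT; first by exists 1.
    exists [set s | lifts s]; last by rewrite setTI.
    by rewrite openE => s ls; apply: filterS (near_eq s) => s' [h _]; exact: h.
  exists [set s | lifts s]; last by rewrite setTI.
  rewrite -openC openE => s ls; apply: filterS (near_eq s) => s' [_ h] /h; exact: ls.
have [x [cx px xE]] : lifts 0 by have : [set: R] 0 by []; rewrite -lT.
pose g t := x t - k%:~R * t.
have cg : continuous g.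
  move=> t; apply: cvgB; first exact: cx.
  by apply: cvgMr; exact: cvg_id.
have gi t : g t \is a Num.int.
  have [h1 h2] := xE t; have [h3 h4] := H0 t.
  by apply: cos_sin_2pi_eq; rewrite ?h1 ?h2 ?h3 ?h4.
have := int_continuous_const cg gi 0 1.
rewrite /g mulr0 mulr1 -(px 0) add0r => h; apply/eqP; rewrite -(eqr_int R); apply/eqP; lra.
Qed.

End winding.
End angles.

(** * Flat norms, geodesics and the systole *)

Section pairing.
Context {R : realType} {n : nat}.
Implicit Types p v w : 'rV[R]_n.

Lemma pairingC p v : pairing p v = pairing v p.
Proof. by apply: eq_bigr => i _; rewrite mulrC. Qed.

Lemma pairingDr p v w : pairing p (v + w) = pairing p v + pairing p w.
Proof. by rewrite -big_split; apply: eq_bigr => i _; rewrite mxE mulrDr. Qed.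

Lemma pairingDl p v w : pairing (p + w) v = pairing p v + pairing w v.
Proof. by rewrite !(pairingC _ v) pairingDr. Qed.

Lemma pairingZl p v t : pairing (t *: p) v = t * pairing p v.
Proof. by rewrite !(pairingC _ v) pairingZr. Qed.

Lemma pairingNr p v : pairing p (- v) = - pairing p v.
Proof. by rewrite -scaleN1r pairingZr mulN1r. Qed.

Lemma pairingNl p v : pairing (- p) v = - pairing p v.
Proof. by rewrite -scaleN1r pairingZl mulN1r. Qed.

Lemma pairingBr p v w : pairing p (v - w) = pairing p v - pairing p w.
Proof. by rewrite pairingDr pairingNr. Qed.

Lemma pairingBl p v w : pairing (p - w) v = pairing p v - pairing w v.
Proof. by rewrite pairingDl pairingNl. Qed.

Lemma pairing0r p : pairing p 0 = 0.
Proof. by rewrite /pairing big1 // => i _; rewrite mxE mulr0. Qed.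

Lemma pairing0l p : pairing 0 p = 0.
Proof. by rewrite pairingC pairing0r. Qed.

Lemma pairing_sumr p (I : Type) (r : seq I) (v : I -> 'rV[R]_n) :
  pairing p (\sum_(i <- r) v i) = \sum_(i <- r) pairing p (v i).
Proof.
elim: r => [|i r IH]; first by rewrite !big_nil pairing0r.
by rewrite !big_cons pairingDr IH.
Qed.

Lemma pairing_delta p i : pairing p (delta_mx 0 i) = p 0 i.
Proof.
rewrite /pairing (bigD1 i) //= !mxE !eqxx mulr1 big1 ?addr0 // => j /negbTE ji.
by rewrite mxE ji andbF mulr0.
Qed.

Lemma pairing_mulmx p v : pairing p v = (p *m v^T) 0 0.
Proof. by rewrite mxE; apply: eq_bigr => i _; rewrite mxE. Qed.

Lemma pairing_eq v w : (forall p, pairing p v = pairing p w) -> v = w.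
Proof.
by move=> h; apply/rowP => i; rewrite -!pairing_delta !(pairingC _ (delta_mx _ _)) h.
Qed.

Lemma is_derive_pairing (V : normedModType R) (p : 'rV[R]_n) (f : V -> 'rV[R]_n) (x v : V) df :
  is_derive x v f df -> is_derive x v (fun y => pairing p (f y)) (pairing p df).
Proof.
move=> [d <-]; apply: is_derive_bigsum => i; apply: is_derive_scale.
have d' := (derivable_mxP _ _ _).1 d.
by apply: DeriveDef => //; rewrite derive_mx // mxE.
Qed.

Lemma continuous_pairing p : continuous (pairing p).
Proof. exact: (@partial_continuous _ _ _ _ p (@pairing_continuous R n)). Qed.

End pairing.

Lemma pairing_mulmxr (R : realType) (n m : nat) (p : 'rV[R]_n) (v : 'rV[R]_m) (A : 'M[R]_(n, m)) :
  pairing (p *m A) v = pairing p (v *m A^T).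
Proof. by rewrite !pairing_mulmx trmx_mul trmxK mulmxA. Qed.

Lemma coord_norm_le (R : realType) (n : nat) (v : 'rV[R]_n) i : `|v 0 i| <= `|v|.
Proof.
rewrite [leRHS]/Num.Def.normr /= mx_normrE.
exact: (@le_bigmax _ _ _ 0 (fun ij : 'I_1 * 'I_n => `|v ij.1 ij.2|) (0, i)).
Qed.

Lemma norm_le_coord (R : realType) (n : nat) (v : 'rV[R]_n) (M : R) : 0 <= M ->
  (forall i, `|v 0 i| <= M) -> `|v| <= M.
Proof.
move=> M0 h; rewrite [leLHS]/Num.Def.normr /= mx_normrE.
by apply: bigmax_le => // -[i j] _; rewrite (ord1 i); exact: h.
Qed.

Section flat_norm.
Context {R : realType} {n : nat}.
Implicit Types (f : 'rV[R]_n -> R) (v w : 'rV[R]_n).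

(** A flat reversible Finsler norm, seen in one fibre; for a homogeneous
    function, convexity is subadditivity. *)
Record flat_norm f : Prop := FlatNorm {
  fn_continuous : continuous f ;
  fn_differentiable : forall v, v != 0 -> differentiable f v ;
  fn_pos : forall v, v != 0 -> 0 < f v ;
  fn_homogeneous : forall v t, 0 < t -> f (t *: v) = t * f v ;
  fn_sym : forall v, f (- v) = f v ;
  fn_subadd : forall v w, f (v + w) <= f v + f w }.

Lemma fn0 f : flat_norm f -> f 0 = 0.
Proof.
move=> hf; have := fn_homogeneous hf 0 (ltr0Sn R 1).
by rewrite scaler0 => h; lra.
Qed.

Lemma fn_ge0 f v : flat_norm f -> 0 <= f v.
Proof.
move=> hf; have [->|v0] := eqVneq v 0; first by rewrite fn0.
exact/ltW/fn_pos.
Qed.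

Lemma fnZ f v t : flat_norm f -> f (t *: v) = `|t| * f v.
Proof.
move=> hf; have [t0|t0|->] := ltgtP t 0; last by rewrite scale0r normr0 mul0r fn0.
- rewrite ltr0_norm // -(fn_sym hf) -scaleNr fn_homogeneous // ?oppr_gt0 //.
- by rewrite gtr0_norm // fn_homogeneous.
Qed.

Lemma fn_lower_bound f : flat_norm f -> exists2 c, 0 < c & forall v, c * `|v| <= f v.
Proof.
move=> hf; pose K := [set v : 'rV[R]_n | `|v| = 1].
have [K0|/set0P/negP/negPn/eqP K0] := pselect (K !=set0); last first.
  exists 1 => // v; have [->|v0] := eqVneq v 0; first by rewrite normr0 mulr0 fn0.
  have : K (`|v|^-1 *: v).
    by rewrite /K /= normrZ normfV normr_id mulVf // normr_eq0.
  by rewrite K0.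
have [u Ku umin] := compact_EVT_min K0 (@sphere_compact R n)
  (continuous_subspaceT (fn_continuous hf)).
rewrite inE in Ku; have u0 : u != 0 by exact: norm1_neq0.
exists (f u); first exact: fn_pos.
move=> v; have [->|v0] := eqVneq v 0; first by rewrite normr0 mulr0 fn0.
have nv : 0 < `|v| by rewrite normr_gt0.
have : f u <= f (`|v|^-1 *: v).
  by apply: umin; rewrite inE /K /= normrZ normfV normr_id mulVf // gt_eqF.
by rewrite fn_homogeneous ?invr_gt0 // ler_pdivlMl // mulrC.
Qed.

(** A supporting functional of the norm at u is its differential at u; the
    last clause is the first-order expansion from above. *)
Lemma fn_support f u : flat_norm f -> u != 0 -> exists w, [/\ pairing w u = f u,
  forall v, `|pairing w v| <= f v &
  forall e, 0 < e -> exists2 d, 0 < d & forall v, `|v| <= d ->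
    f (u + v) <= f u + pairing w v + e * `|v|].
Proof.
move=> hf u0; have df := fn_differentiable hf u0.
pose w : 'rV[R]_n := \row_i 'd f u (delta_mx 0 i).
have wE v : 'd f u v = pairing w v.
  rewrite {1}(row_sum_delta v) linear_sum /pairing; apply: eq_bigr => i _.
  by rewrite linearZ mxE /= mulrC.
have [_ e] := (diff_locallyP _ _).1 df.
have H eps : 0 < eps -> exists2 d, 0 < d & forall v, `|v| <= d ->
    `|f (u + v) - (f u + pairing w v)| <= eps * `|v|.
  move=> eps0; move/eqaddoP : e => /(_ eps eps0) /nbhs_normP[d /= d0 Hd].
  exists (d / 2); first by rewrite divr_gt0.
  move=> v vd; have := Hd v; rewrite /= sub0r normrN => h.
  have {h} := h (le_lt_trans vd _).
  rewrite ltr_pdivrMr // ltr_pMr // ltr1n => /(_ isT).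
  by rewrite !fctE /= wE [v + u]addrC.
have le_eps (a b c : R) : (forall eps, 0 < eps -> a <= b + eps * c) -> a <= b.
  move=> h; rewrite leNgt; apply/negP => ba.
  have := h ((a - b) / (2 * (`|c| + 1))).
  have c1 : 0 < `|c| + 1 by rewrite ltr_wpDl.
  rewrite divr_gt0 ?subr_gt0 ?mulr_gt0 // => /(_ isT).
  have : (a - b) / (2 * (`|c| + 1)) * c <= (a - b) / 2.
    rewrite invfM mulrA -mulrA ler_piMr ?divr_ge0 ?subr_ge0 ?ltW //.
    by rewrite mulrC ltr_pdivrMr // mul1r (le_lt_trans (ler_norm c)) // ltrDl.
  lra.
have up v : pairing w v <= f v.
  apply: (le_eps _ _ `|v|) => eps eps0; have [d d0 Hd] := H eps eps0.
  pose t := d / (`|v| + 1).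
  have v1 : 0 < `|v| + 1 by rewrite ltr_wpDl.
  have t0 : 0 < t by rewrite divr_gt0.
  have := Hd (t *: v); rewrite normrZ (gtr0_norm t0) pairingZr.
  have tv : t * `|v| <= d by rewrite /t mulrAC ler_pdivrMr // ler_pM2l //; lra.
  move=> /(_ tv); rewrite ler_norml => /andP[h _].
  have := fn_subadd hf u (t *: v); rewrite fn_homogeneous // => h'.
  rewrite -(ler_pM2l t0); nra.
exists w; split.
- apply/eqP; rewrite eq_le up /=.
  apply: (le_eps _ _ `|u|) => eps eps0; have [d d0 Hd] := H eps eps0.
  pose t := d / (`|u| + 1).
  have u1 : 0 < `|u| + 1 by rewrite ltr_wpDl.
  have t0 : 0 < t by rewrite divr_gt0.
  have := Hd (t *: u); rewrite normrZ (gtr0_norm t0) pairingZr.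
  have tv : t * `|u| <= d by rewrite /t mulrAC ler_pdivrMr // ler_pM2l //; lra.
  move=> /(_ tv); rewrite ler_norml => /andP[_ h].
  have h' : f (u + t *: u) = (1 + t) * f u.
    by rewrite -[X in X + _]scale1r -scalerDl fn_homogeneous //; lra.
  move: h; rewrite h' => h; rewrite -(ler_pM2l t0); nra.
- move=> v; rewrite ler_norml up andbT lerNl -pairingNr -(fn_sym hf v).
  exact: up.
- move=> eps eps0; have [d d0 Hd] := H eps eps0; exists d => // v /Hd.
  by rewrite ler_norml => /andP[_]; lra.
Qed.

Lemma continuous_mulmxr m (A : 'M[R]_(n, m)) : continuous (mulmxr A : 'rV[R]_n -> 'rV[R]_m).
Proof.
move=> v; apply: differentiable_continuous; apply: differentiable_rV => i.
rewrite (_ : (fun x => _) = \sum_j (fun x : 'rV[R]_n => A j i * x 0 j)).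
  apply: differentiable_sum => j.
  exact: (@differentiableZ _ _ _ (fun x : 'rV[R]_n => x 0 j) (A j i) v (differentiable_coord _ _ _)).
by apply/funext => x; rewrite fct_sumE mxE; apply: eq_bigr => j _; rewrite mulrC.
Qed.

(** Smoothness away from the zero section is expressed in charts of the torus
    bundle; restricting it to a fibre gives differentiability. *)
Lemma flat_finsler_norm (F : torus R n * 'rV[R]_n -> R) :
  finsler F -> flat F -> reversible F ->
  exists2 f, flat_norm f & forall q v, F (q, v) = f v.
Proof.
move=> hF [f fE] hr; exists f => //; pose q0 := torus_proj (0 : 'rV[R]_n).
split.
- rewrite (_ : f = fun v => F (q0, v)); last by apply/funext => v; rewrite fE.
  exact: (partial_continuous (x := q0) (finsler_continuous hF)).
- move=> v v0.
  have b0 : ball (0 : 'rV[R]_n) 2^-1 (0 : 'rV[R]_n) by apply: ballxx; rewrite invr_gt0.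
  have d0 w : cs_dom (0 : cs_index (torus_bundle R n)) (q0, w) by exists 0.
  have [g [U [oU Uv gU gE]]] := @finsler_smooth _ _ F hF (q0, v) v0 0 (d0 v).
  have chE w : cs_chart (0 : cs_index (torus_bundle R n)) (q0, w) = w *m row_mx 0 1%:M.
    by rewrite /= torus_liftE // mul_mx_row mulmx0 mulmx1.
  rewrite chE in Uv.
  pose J : {linear 'rV[R]_n -> 'rV[R]_(n + n)} := mulmxr (row_mx 0 1%:M).
  have cJ : continuous J by exact: continuous_mulmxr.
  have dJ : differentiable J v by exact: linear_differentiable.
  have dg : differentiable g (J v) by have [+ _] := gU 1%N; apply.
  have D := differentiable_comp dJ dg.
  have E : \forall w \near v, (g \o J) w = f w.
    have N : nbhs v (J @^-1` U) by apply: cJ; exact: open_nbhs_nbhs.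
    have N0 : \forall w \near v, w != 0.
      exact: (@cvgr_neq0 _ _ _ _ (nbhs_filter v) id v (@cvg_id _ _) v0).
    apply: filterS2 N N0 => w Uw w0.
    rewrite -(fE q0 w) (gE (q0, w)) // ?chE //.
  by have [] := near_differentiable E D.
- by move=> v v0; rewrite -(fE q0); exact: finsler_pos.
- by move=> v t t0; rewrite -!(fE q0) (finsler_homogeneous hF).
- by move=> v; rewrite -!(fE q0) hr opprK.
move=> v w; have h2 : (0 : R) < 2 by [].
have := @finsler_convex _ _ F hF q0 (2 *: v) (2 *: w) 2^-1.
rewrite invr_ge0 ler0n invf_le1 // ler1n => /(_ isT).
have -> : 1 - 2^-1 = 2^-1 :> R by lra.
by rewrite !scalerA mulVf // !scale1r !(finsler_homogeneous hF) // !fE !mulrA mulVf // !mul1r.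
Qed.

End flat_norm.
Section systole.
Context {R : realType} {n : nat}.
Implicit Types (f : 'rV[R]_n -> R) (x : R -> 'rV[R]_n).

Definition intv (k : 'rV[int]_n) : 'rV[R]_n := map_mx intr k.

Lemma intv_eq0 k : (intv k == 0) = (k == 0).
Proof.
apply/eqP/eqP => [/rowP h|->].
  by apply/rowP => i; have := h i; rewrite !mxE => /eqP; rewrite intr_eq0 => /eqP.
by apply/rowP => i; rewrite !mxE.
Qed.

Lemma torus_proj_int (x y : 'rV[R]_n) : torus_proj x = torus_proj y <->
  exists k : 'rV[int]_n, x = y + intv k.
Proof.
split=> [/torus_projP/forallP h|[k ->]].
  exists (\row_i Num.floor (x 0 i - y 0 i)); apply/rowP => i; rewrite !mxE.
  by have := h i; rewrite intrEfloor => /eqP ->; rewrite addrC subrK.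
apply/torus_projP/forallP => i; rewrite !mxE addrAC subrr add0r; exact: intr_int.
Qed.

(** A norm is bounded below by a multiple of the sup norm, so only the
    finitely many integer vectors with coordinates less than B compete. *)
Lemma shortest_int_vector f : flat_norm f -> (0 < n)%N ->
  exists2 k : 'rV[int]_n, k != 0 & forall k', k' != 0 -> f (intv k) <= f (intv k').
Proof.
move=> hf n0; have [c c0 cf] := fn_lower_bound hf.
pose e0 : 'rV[int]_n := delta_mx 0 (Ordinal n0).
have e00 : e0 != 0.
  by apply/eqP => /rowP /(_ (Ordinal n0)); rewrite !mxE !eqxx.
pose B := (Num.trunc (f (intv e0) / c)).+1.
have hB : f (intv e0) < c * B%:R.
  by rewrite mulrC -ltr_pdivrMr // truncnS_gt.
pose vec (g : {ffun 'I_n -> 'I_(2 * B).+1}) : 'rV[int]_n := \row_i ((g i : nat)%:Z - B%:Z).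
have small k : f (intv k) <= f (intv e0) -> exists g, k = vec g.
  move=> h; have hk i : `|k 0 i| < B%:Z.
    rewrite -(ltr_int R) intr_norm.
    have : c * `|intv k| < c * B%:R by apply: le_lt_trans (cf _) (le_lt_trans h hB).
    rewrite ltr_pM2l // => h'; apply: le_lt_trans h'.
    by have := coord_norm_le (intv k) i; rewrite mxE.
  exists [ffun i => inord `|(k 0%R i + B%:Z)%R|%N].
  apply/rowP => i; rewrite !mxE ffunE inordK; have := hk i; rewrite ltr_norml; lia.
have [g0 g0E] := small e0 (lexx _).
have P0 : vec g0 != 0 by rewrite -g0E.
case: (@arg_minP _ _ _ g0 (fun g => vec g != 0) (fun g => f (intv (vec g))) P0) => g gP gmin.
exists (vec g) => // k' k'0.
have [h|h] := leP (f (intv k')) (f (intv e0)).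
  by have [g' E] := small _ h; rewrite E; apply: gmin; rewrite -E.
apply: le_trans (ltW h); rewrite g0E; exact: gmin.
Qed.

Lemma Cinfty_curve x : Cinfty setT x ->
  (forall t, is_derive t (1 : R) x (derive1 x t)) /\ continuous (derive1 x).
Proof.
move=> h; have [h1 h2] := h 1%N; split.
  by move=> t; rewrite derive1E; apply/derivableP/derivable1_diffP; exact: h1.
by move=> t; have := h2 1 t I; rewrite (_ : derive1 x = 'D_1 x) //; apply/funext => s; exact: derive1E.
Qed.

Section length.
Variables (F : torus R n * 'rV[R]_n -> R) (f : 'rV[R]_n -> R).
Hypotheses (hf : flat_norm f) (FE : forall q v, F (q, v) = f v).

Lemma length_flat a b x :
  finsler_length F a b x = \int[lebesgue_measure]_(t in `[a, b]) f (derive1 x t).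
Proof. by rewrite /finsler_length; apply: eq_Rintegral => t _; rewrite FE. Qed.

Lemma continuous_speed x : Cinfty setT x -> continuous (fun t => f (derive1 x t)).
Proof.
move=> /Cinfty_curve[_ c] t; apply: (@continuous_comp _ _ _ (derive1 x) f); first exact: c.
exact: fn_continuous.
Qed.

Lemma pairing_length w a b x : a < b -> Cinfty setT x ->
  \int[lebesgue_measure]_(t in `[a, b]) pairing w (derive1 x t) =
  pairing w (x b - x a) /\ continuous (fun t => pairing w (derive1 x t)).
Proof.
move=> ab /Cinfty_curve[d c].
have cw : continuous (fun t => pairing w (derive1 x t)).
  move=> t; apply: (@continuous_comp _ _ _ (derive1 x) (pairing w)); first exact: c.
  exact: continuous_pairing.
split=> //; rewrite pairingBr; apply: (Rintegral_FTC (U := fun t => pairing w (x t))) => //.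
by move=> t; exact: is_derive_pairing (d t).
Qed.

Lemma length_ge_pairing w a b x : a < b -> Cinfty setT x ->
  (forall v, pairing w v <= f v) -> pairing w (x b - x a) <= finsler_length F a b x.
Proof.
move=> ab hx hw; have [<- cw] := pairing_length w ab hx; rewrite length_flat.
apply: le_Rintegral => //; try exact: segment_integrable.
exact/segment_integrable/continuous_speed.
Qed.

Lemma derive1_line (v : 'rV[R]_n) t : derive1 (fun t : R => t *: v) t = v.
Proof.
rewrite derive1E deriveE; last exact: ex_diff.
by rewrite diff_val scale1r.
Qed.

Lemma length_line (v : 'rV[R]_n) : finsler_length F 0 1 (fun t => t *: v) = f v.
Proof.
rewrite length_flat.
rewrite (_ : (fun t => _) = cst (f v)); last by apply/funext => t; rewrite derive1_line.
by rewrite Rintegral_cst //= lebesgue_measure_itv /= lte_fin ltr01 oppr0 adde0 mulr1.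
Qed.

Lemma derive_slice1 (W : normedModType R) (y : R * R -> W) (s t : R) :
  differentiable y (s, t) ->
  is_derive t (1 : R) (fun t => y (s, t)) ('D_(0, 1) y (s, t)).
Proof.
move=> dy; have [d e] : is_derive (s, t) ((0, 1) : R * R) y ('D_(0, 1) y (s, t)).
  exact/derivableP/diff_derivable.
have E : (fun h : R => h^-1 *: (((fun t => y (s, t)) \o shift t) (h *: (1 : R)) - y (s, t))) =
         (fun h : R => h^-1 *: ((y \o shift (s, t)) (h *: ((0, 1) : R * R)) - y (s, t))).
  apply/funext => h; congr (_ *: (y _ - _)); rewrite /= .
  by congr pair; rewrite /= -?[h *: 0]/(h * 0) ?mulr0 ?add0r.
by split; [rewrite /derivable E; exact: d|rewrite /derive E; exact: e].
Qed.

Lemma derive_slice0 (W : normedModType R) (y : R * R -> W) (s t : R) :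
  differentiable y (s, t) ->
  is_derive s (1 : R) (fun s => y (s, t)) ('D_(1, 0) y (s, t)).
Proof.
move=> dy; have [d e] : is_derive (s, t) ((1, 0) : R * R) y ('D_(1, 0) y (s, t)).
  exact/derivableP/diff_derivable.
have E : (fun h : R => h^-1 *: (((fun s => y (s, t)) \o shift s) (h *: (1 : R)) - y (s, t))) =
         (fun h : R => h^-1 *: ((y \o shift (s, t)) (h *: ((1, 0) : R * R)) - y (s, t))).
  apply/funext => h; congr (_ *: (y _ - _)); rewrite /= .
  by congr pair; rewrite /= -?[h *: 0]/(h * 0) ?mulr0 ?add0r.
by split; [rewrite /derivable E; exact: d|rewrite /derive E; exact: e].
Qed.

Lemma Cinfty_line (v : 'rV[R]_n) : Cinfty setT (fun t : R => t *: v).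
Proof.
move=> k; apply: Ck_rV => [|i]; first exact: openT.
apply: eq_Ck (Ck_affine k (v 0 i) 0 openT) => [|t _]; first exact: openT.
by rewrite mxE addr0 mulrC.
Qed.

Lemma Cinfty_slice (y : R * R -> 'rV[R]_n) (s : R) : Cinfty setT y ->
  Cinfty setT (fun t => y (s, t)).
Proof.
move=> hy k; elim: k y hy => [|k IH] y h.
  move=> t _; have c := h 0%N (s, t) I.
  exact: (@continuous_comp _ _ _ (fun t => (s, t)) y t (cvg_pair (cvg_cst s) cvg_id) c).
have dy p : differentiable y p by have [+ _] := h 1%N; apply.
split=> [t _|u].
  by apply/derivable1_diffP; have [] := derive_slice1 (dy (s, t)).
have h1 : Ck k setT (fun t => 'D_(0, 1) y (s, t)).
  by apply: (IH ('D_(0, 1) y)) => k'; have [_] := h k'.+1; exact.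
apply: eq_Ck (Ck_scale u openT h1) => [|t _]; first exact: openT.
have [d e] := derive_slice1 (dy (s, t)).
rewrite fctE -e; move/derivable1_diffP : d => d.
by rewrite !deriveE // -[in RHS](mulr1 u) -[_ * 1]/(u *: 1) linearZ.
Qed.

(** The velocities of the varied curve have a fixed integral, so the
    supporting functional w contributes a constant to the length. What remains
    is the integral of f - w, which is nonnegative and, by the first-order
    expansion of f at v, at most a small multiple of the parameter. *)
Lemma line_geodesic (v : 'rV[R]_n) : v != 0 -> geodesic F (fun t => t *: v).
Proof.
move=> v0; split; [exact: Cinfty_line|by move=> t; rewrite derive1_line|].
move=> a b y ab Cy y0 yends.
have [w [wv wf wd]] := fn_support hf v0.
pose z (s t : R) := 'D_(0, 1) y (s, t).
have dy p : differentiable y p by have [+ _] := Cy 1%N; apply.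
have Cz : Cinfty setT ('D_(0, 1) y) by move=> k; have [_] := Cy k.+1; exact.
have dz p : differentiable ('D_(0, 1) y) p by have [+ _] := Cz 1%N; apply.
have czz : continuous ('D_(1, 0) ('D_(0, 1) y)).
  by move=> p; have [_ h] := Cz 1%N; have := h (1, 0) p I.
have cz : continuous ('D_(0, 1) y) by move=> p; exact: differentiable_continuous.
have y1 s t : derive1 (fun t => y (s, t)) t = z s t.
  by rewrite derive1E; have [_ ->] := derive_slice1 (dy (s, t)).
have z0 t : z 0 t = v.
  by rewrite -y1 (_ : (fun t => _) = (fun t => t *: v)) ?derive1_line //; exact/funext.
have Cs s : Cinfty setT (fun t => y (s, t)) by exact: Cinfty_slice.
have [M M0 zM] : exists2 M, 0 <= M & forall s t, `|s| <= 1 -> a <= t <= b ->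
    `|z s t - v| <= M * `|s|.
  pose K : set (R * R) := `[(-1), 1]%classic `*` `[a, b]%classic.
  have cK : compact K by apply: compact_setX; exact: segment_compact.
  have nf : {within K, continuous (fun p => `|'D_(1, 0) ('D_(0, 1) y) p|)}.
    apply: continuous_subspaceT => p.
    apply: (@continuous_comp _ _ _ ('D_(1, 0) ('D_(0, 1) y)) (fun v => `|v|)).
      exact: czz.
    exact: norm_continuous.
  have K0 : K !=set0.
    by exists (0, a); split; rewrite /= in_itv /= ?lexx ?ltW //; apply/andP; split; lra.
  have [p0 _ pmax] := compact_EVT_max K0 cK nf.
  exists `|'D_(1, 0) ('D_(0, 1) y) p0| => // s t s1 tab.
  apply: norm_le_coord => [|i]; first by rewrite mulr_ge0.
  rewrite -(z0 t) 2!mxE.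
  apply: (@lipschitz_derive _ (fun s => z s t 0 i) (fun s => 'D_(1, 0) ('D_(0, 1) y) (s, t) 0 i)).
  move=> r rs; split.
    have := is_derive_pairing (delta_mx 0 i) (derive_slice0 (dz (r, t))).
    rewrite pairingC pairing_delta; congr is_derive; apply/funext => r'.
    by rewrite pairingC pairing_delta.
  apply: le_trans (coord_norm_le _ _) _; apply: pmax; rewrite inE; split=> /=.
    by rewrite in_itv /= -ler_norml; exact: le_trans rs s1.
  by rewrite in_itv.
pose psi s t := f (z s t) - pairing w (z s t).
have zE s : (fun t => z s t) = derive1 (fun t => y (s, t)).
  by apply/funext => t; rewrite y1.
have cfz s : continuous (fun t => f (z s t)).
  by have := continuous_speed (Cs s); under [in X in X -> _]eq_fun do rewrite y1.
have cwz s : continuous (fun t => pairing w (z s t)).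
  have [_] := pairing_length w ab (Cs s).
  by under [in X in X -> _]eq_fun do rewrite y1.
have cpsi s : continuous (psi s) by move=> t; exact: cvgB (cfz s t) (cwz s t).
have yE s : finsler_length F a b (fun t => y (s, t)) =
    \int[lebesgue_measure]_(t in `[a, b]) psi s t + pairing w (b *: v - a *: v).
  have [h1 h2] := pairing_length w ab (Cs s).
  have [ya yb] := yends s; rewrite -ya -yb -h1 length_flat.
  rewrite -RintegralD //.
  - by apply: eq_Rintegral => t _; rewrite /psi y1 subrK.
  - exact: segment_integrable.
  - exact: segment_integrable.
have psi0 : \int[lebesgue_measure]_(t in `[a, b]) psi 0 t = 0.
  have -> : psi 0 = cst 0 by apply/funext => t; rewrite /psi z0 wv subrr.
  by rewrite Rintegral_cst //= mul0r.
apply: is_derive_littleo => e e0.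
pose e' := e / ((M + 1) * (b - a)).
have den : 0 < (M + 1) * (b - a) by rewrite mulr_gt0 ?subr_gt0 //; lra.
have e'0 : 0 < e' by rewrite divr_gt0.
have [d d0 Hd] := wd e' e'0.
exists (Num.min 1 (d / (M + 1))).
  by rewrite lt_min ltr01 /= divr_gt0 //; lra.
move=> h; rewrite le_min => /andP[h1 hd].
rewrite add0r !yE psi0 add0r addrK.
apply: le_trans (le_normr_Rintegral _ _) _ => //; first exact: segment_integrable.
have cn : continuous (fun t => `|psi h t|).
  move=> t; apply: (@continuous_comp _ _ _ (psi h) (fun r : R => `|r|)); first exact: cpsi.
  exact: norm_continuous.
have bnd t : `[a, b]%classic t -> `|psi h t| <= e' * (M * `|h|).
  rewrite /= in_itv /= => tab; have zv := zM h t h1 tab.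
  have zd : `|z h t - v| <= d.
    apply: le_trans zv _; move: hd; rewrite ler_pdivlMr; last lra.
    by have := normr_ge0 h; nra.
  have := Hd _ zd; rewrite addrC subrK pairingBr wv => up.
  have := wf (z h t); rewrite ler_norml => /andP[_ lo].
  rewrite ger0_norm /psi ?subr_ge0 //.
  have : e' * `|z h t - v| <= e' * (M * `|h|) by rewrite ler_pM2l.
  lra.
apply: (@le_trans _ _ (\int[lebesgue_measure]_(t in `[a, b]) cst (e' * (M * `|h|)) t)).
  apply: le_Rintegral => //; first exact: segment_integrable.
  by apply: segment_integrable; exact: cst_continuous.
rewrite Rintegral_cst //= lebesgue_measure_itv /= lte_fin ab /=.
rewrite /e'; have -> : e / ((M + 1) * (b - a)) * (M * `|h|) * (b - a) = e * `|h| * (M / (M + 1)).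
  by field; apply/andP; split; lra.
have eh : 0 <= e * `|h| by apply: mulr_ge0 => //; exact: ltW.
by apply: ler_piMr => //; rewrite ler_pdivrMr; lra.
Qed.

(** The lift of the loop is translated by an integer vector k over a period.
    If k were 0, shrinking the lift to a point would contract the loop;
    pairing the velocity with a supporting functional at k bounds the length
    from below. *)
Lemma closed_geodesic_length x : closed_geodesic F x ->
  ~ contractible_loop (@torus_proj R n \o x) ->
  exists2 k : 'rV[int]_n, k != 0 & f (intv k) <= finsler_length F 0 1 x.
Proof.
move=> [[Cx _ _] per] nc.
have [dx _] := Cinfty_curve Cx.
have cx : continuous x by move=> t; exact: (Cx 0%N t I).
have ci i : continuous (fun t => x t 0 i).
  move=> t; apply: (@continuous_comp _ _ _ x (fun v : 'rV[R]_n => v 0 i)); first exact: cx.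
  exact: coord_continuous.
have shift_int t i : x (t + 1) 0 i - x t 0 i \is a Num.int.
  by have /torus_projP/forallP := per t; exact.
have shift_cst t : x (t + 1) - x t = x 1 - x 0.
  apply/rowP => i; rewrite !mxE.
  have := @int_continuous_const R (fun t => x (t + 1) 0 i - x t 0 i) _ (fun t => shift_int t i) t 0.
  rewrite add0r; apply => s; apply: cvgB; last exact: ci.
  apply: (@continuous_comp _ _ _ (fun t : R => t + 1) (fun t => x t 0 i)); last exact: ci.
  by apply: cvgD; [exact: cvg_id|exact: cvg_cst].
have /torus_proj_int[k kE] := per 0; rewrite add0r in kE.
have k1 : x 1 - x 0 = intv k by rewrite kE addrC addKr.
have k0 : k != 0.
  apply: contra_notN nc => /eqP k0.
  have p1 t : x (t + 1) = x t.
    apply/eqP; rewrite -subr_eq0 shift_cst k1 k0; apply/eqP.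
    by apply/rowP => i; rewrite !mxE.
  exists (fun z => torus_proj ((1 - z.1) *: x z.2)); split.
  - move=> z; apply: (@continuous_comp _ _ _ (fun z : R * R => (1 - z.1) *: x z.2) (@torus_proj R n)); last exact: torus_proj_continuous.
    have f1 : {for z, continuous (fun z : R * R => 1 - z.1)}.
      by apply: cvgB; [exact: cvg_cst|exact: cvg_fst].
    have f2 : {for z, continuous (fun z : R * R => x z.2)}.
      by apply: (@continuous_comp _ _ _ snd x); [exact: cvg_snd|exact: cx].
    exact: cvgZ f1 f2.
  - by move=> s t; rewrite /= p1.
  - by move=> t; rewrite /= subr0 scale1r.
  - by exists (torus_proj 0) => t; rewrite /= subrr scale0r.
exists k => //.
have ik0 : intv k != 0 by rewrite intv_eq0.
have [w [wk wf _]] := fn_support hf ik0.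
rewrite -wk -k1; apply: length_ge_pairing => // v.
exact: le_trans (ler_norm _) (wf v).
Qed.

End length.

(** An arbitrary section of the projection, which is not continuous; it serves
    to evaluate periodic functions on the torus. *)
Definition torus_rep (q : torus R n) : 'rV[R]_n := sval (cid (torus_proj_surj q)).

Lemma torus_repK q : torus_proj (torus_rep q) = q.
Proof. exact: svalP (cid (torus_proj_surj q)). Qed.

Lemma torus_rep_proj (x0 : 'rV[R]_n) : exists k : 'rV[int]_n, torus_rep (torus_proj x0) = x0 + intv k.
Proof. by apply/torus_proj_int; rewrite torus_repK. Qed.

Definition torus_cos i (q : torus R n) : R := cos (2 * pi * torus_rep q 0 i).
Definition torus_sin i (q : torus R n) : R := sin (2 * pi * torus_rep q 0 i).

Lemma torus_cosE i (x0 : 'rV[R]_n) : torus_cos i (torus_proj x0) = cos (2 * pi * x0 0 i).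
Proof.
have [k kE] := torus_rep_proj x0; by rewrite /torus_cos kE !mxE cos_2pi_periodic.
Qed.

Lemma torus_sinE i (x0 : 'rV[R]_n) : torus_sin i (torus_proj x0) = sin (2 * pi * x0 0 i).
Proof.
have [k kE] := torus_rep_proj x0; by rewrite /torus_sin kE !mxE sin_2pi_periodic.
Qed.

(** The projection is open and onto. *)
Lemma torus_continuous (T : topologicalType) (f : torus R n -> T) :
  continuous (f \o @torus_proj R n) -> continuous f.
Proof.
move=> cf q; have [x0 <-] := torus_proj_surj q => A nA.
have N : nbhs x0 ((f \o @torus_proj R n) @^-1` A) by exact: cf.
have : nbhs (torus_proj x0) (@torus_proj R n @` ((f \o @torus_proj R n) @^-1` A)°).
  apply: open_nbhs_nbhs; split; first exact/torus_proj_open/open_interior.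
  by exists x0 => //; exact: nbhs_singleton (nbhs_interior N).
by apply: filterS => _ [y /interior_subset Ay <-].
Qed.

Lemma continuous_torus_trig i : continuous (torus_cos i) /\ continuous (torus_sin i).
Proof.
have c (u : R -> R) : continuous u -> continuous (fun x0 : 'rV[R]_n => u (2 * pi * x0 0 i)).
  move=> cu x0; apply: (@continuous_comp _ _ _ (fun x0 : 'rV[R]_n => 2 * pi * x0 0 i) u); last exact: cu.
  exact: cvgM (cvg_cst _) (@coord_continuous R 1 n 0 i x0).
split; apply: torus_continuous.
  rewrite (_ : _ \o _ = fun x0 : 'rV[R]_n => cos (2 * pi * x0 0 i)); first exact/c/continuous_cos.
  by apply/funext => x0 /=; rewrite torus_cosE.
rewrite (_ : _ \o _ = fun x0 : 'rV[R]_n => sin (2 * pi * x0 0 i)); first exact/c/continuous_sin.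
by apply/funext => x0 /=; rewrite torus_sinE.
Qed.

Lemma torus_trig_inj (q q' : torus R n) : (forall i, torus_cos i q = torus_cos i q') ->
  (forall i, torus_sin i q = torus_sin i q') -> q = q'.
Proof.
move=> hc hs; rewrite -(torus_repK q) -(torus_repK q').
by apply/torus_projP/forallP => i; exact: cos_sin_2pi_eq (hc i) (hs i).
Qed.

(** A contraction of the line in the direction k would contract, through the
    i-th angle of the torus, a loop of winding number k_i. *)
Lemma line_noncontractible (k : 'rV[int]_n) : k != 0 ->
  ~ contractible_loop (@torus_proj R n \o (fun t : R => t *: intv k)).
Proof.
move=> k0 [h [ch hper h0 [q h1]]].
have [i ki] : exists i, k 0 i != 0.
  apply: contrapT => H; case/negP: k0; apply/eqP/rowP => i; rewrite !mxE.
  by apply/eqP/negPn/negP => ki; apply: H; exists i.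
have [cc cs] := continuous_torus_trig i.
have := @winding_number_zero R (torus_cos i \o h) (torus_sin i \o h) _ _ _ _ _
  (k 0 i) (torus_cos i q) (torus_sin i q).
move=> H; case/negP: ki; apply/eqP; apply: H.
- by move=> z; apply: continuous_comp; [exact: ch|exact: cc].
- by move=> z; apply: continuous_comp; [exact: ch|exact: cs].
- by move=> z; exact: cos2Dsin2.
- by move=> s t /=; rewrite hper.
- by move=> s t /=; rewrite hper.
- by move=> t /=; rewrite h0 /= torus_cosE torus_sinE !mxE [t * _]mulrC.
- by move=> t /=; rewrite h1.
Qed.

(** The line in the direction of a shortest integer vector realizes the
    infimum. *)
Lemma systole_flat (F : torus R n * 'rV[R]_n -> R) f (k : 'rV[int]_n) :
  flat_norm f -> (forall q v, F (q, v) = f v) -> k != 0 ->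
  (forall k', k' != 0 -> f (intv k) <= f (intv k')) -> systole F = f (intv k).
Proof.
move=> hf FE k0 kmin; rewrite /systole; set A := [set l | _].
have Ak : A (f (intv k)).
  exists (fun t => t *: intv k); split.
  - split; first by apply: (line_geodesic hf FE); rewrite intv_eq0.
    move=> t; apply/torus_proj_int; exists k.
    by rewrite scalerDl scale1r.
  - exact: line_noncontractible.
  - by rewrite (length_line FE).
have lbA : lbound A (f (intv k)).
  move=> _ [x [gx nx ->]].
  have [k' k'0 h] := closed_geodesic_length hf FE gx nx.
  exact: le_trans (kmin _ k'0) h.
apply/eqP; rewrite eq_le; apply/andP; split.
  by apply: ge_inf => //; exists (f (intv k)).
by apply: lb_le_inf => //; exists (f (intv k)).
Qed.

End systole.

(** * Recognizing symplectic embeddings *)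

Section embeddings.
Context {R : realType}.

(** A continuous injection of a compact set into a Hausdorff space is a
    homeomorphism onto its image; extending f to such an injection thus
    controls the topology of the image of f. *)
Lemma compact_embedding (M N : topologicalType) (O K : set M) (O' : set N) (F : M -> N)
    (f : O -> O') : hausdorff_space N -> compact K -> O `<=` K ->
  {within K, continuous F} -> {in K &, injective F} ->
  (forall z, set_val (f z) = F (set_val z)) ->
  injective f /\ forall A : set O, open A ->
    exists2 B : set O', open B & f @` A = B `&` range f.
Proof.
move=> hN cK OK cF iF fE.
have valO (z : O) : O (set_val z) by exact: set_valP.
have finj : injective f.
  move=> z z' e; apply: val_inj; apply: iF; rewrite ?inE; try exact/OK/valO.
  by rewrite -[LHS]fE -[RHS]fE e.
split=> // A [D oD <-].
have cKD : compact (K `\` D) by apply: compact_closedI => //; exact: open_closedC.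
have cFKD : compact (F @` (K `\` D)).
  apply: continuous_compact cKD; apply: continuous_subspaceW cF; exact: subDsetl.
exists (set_val @^-1` ~` (F @` (K `\` D))).
  exists (~` (F @` (K `\` D))) => //; apply: closed_openC; exact: compact_closed.
apply/seteqP; split.
  move=> _ [z Dz <-]; split; last by exists z.
  rewrite /preimage /= fE => -[y [Ky Dy] yz]; apply: Dy.
  rewrite (iF y (set_val z)) // ?inE //; exact/OK/valO.
move=> y [h [z _ zy]]; exists z => //; apply: contrapT => Dz; apply: h.
by rewrite -zy fE; exists (set_val z) => //; split => //; exact/OK/valO.
Qed.

(** Pulling back the matrix of a form is pulling back the form on directional
    derivatives. *)
Lemma form_eval_jacobian m (g : 'rV[R]_m -> 'rV[R]_m) (x : 'rV[R]_m) (W : 'M[R]_m) u v :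
  differentiable g x ->
  form_eval ('J g x *m W *m ('J g x)^T) u v = form_eval W ('D_u g x) ('D_v g x).
Proof.
move=> dg; rewrite /form_eval !mulmxA -[_ *m _ *m v^T]mulmxA -trmx_mul.
by rewrite !deriveEjacobian //.
Qed.

Lemma form_eval_inj m (W W' : 'M[R]_m) :
  (forall u v, form_eval W u v = form_eval W' u v) -> W = W'.
Proof.
move=> h; apply/matrixP => i j; have := h (delta_mx 0 i) (delta_mx 0 j).
rewrite /form_eval -!rowE trmx_delta -!colE !mxE //.
Qed.

(** All the local representations of f at a point have the same germ, hence
    the same Jacobian: it suffices to find, for each pair of charts, one
    representation whose derivative preserves the forms. *)
Lemma symplectic_embedding_local m (M1 M2 : symplectic_manifold R m) (f : M1 -> M2) :
  (forall i : cs_index M1, cs_bdry i = false) -> continuous f -> injective f ->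
  (forall A : set M1, open A -> exists2 B : set M2, open B & f @` A = B `&` range f) ->
  (forall i j p, cs_dom i p -> cs_dom j (f p) -> exists G U,
    [/\ open U, U (cs_chart i p), Cinfty U G,
        forall q, cs_dom i q -> cs_dom j (f q) -> U (cs_chart i q) ->
          cs_chart j (f q) = G (cs_chart i q) &
        forall u v, form_eval (sm_form j (f p)) ('D_u G (cs_chart i p)) ('D_v G (cs_chart i p)) =
          form_eval (sm_form i p) u v]) ->
  symplectic_embedding f.
Proof.
move=> bd cf fi fo H; split => //.
  split=> // j p jp i ip; have [G [U [oU Up CG GE _]]] := H i j p ip jp.
  by exists G, U; split=> // q jq iq Uq; exact: GE.
move=> i j p g ip jp [U' [oU' Up' Cg gE]].
have [G [U [oU Up CG GE GW]]] := H i j p ip jp.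
have oj : open (f @^-1` cs_dom j) by apply: open_comp => [z _|]; [exact: cf|exact: mf_dom_open].
have E : \forall x \near cs_chart i p, G x = g x.
  apply: filterS3 (constant_near_chart bd oj jp ip)
    (open_nbhs_nbhs (conj oU Up)) (open_nbhs_nbhs (conj oU' Up')).
  by move=> _ [q [jq iq <-]] Uq U'q; rewrite -GE // -gE.
have dG : differentiable G (cs_chart i p) by have [+ _] := CG 1%N; apply.
have [dg eg] := near_differentiable E dG.
have Eu w : 'D_w G (cs_chart i p) = 'D_w g (cs_chart i p) by exact: near_eq_derive.
apply: form_eval_inj => u v; apply: etrans (esym (GW u v)) _; rewrite !Eu.
by apply: esym; apply: form_eval_jacobian; exact: dg.
Qed.

Variable n : nat.
Implicit Types u v w : 'rV[R]_(n + n).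

Lemma standard_formE u v : form_eval (standard_mx R n) u v =
  pairing (lsubmx u) (rsubmx v) - pairing (rsubmx u) (lsubmx v).
Proof.
rewrite /form_eval -{1}(hsubmxK u) -{1}(hsubmxK v) /standard_mx mul_row_block.
rewrite !mulmx0 mulmx1 mulmxN mulmx1 add0r addr0 tr_row_mx mul_row_col mulNmx.
by rewrite !pairing_mulmx !mxE addrC.
Qed.

Lemma canonical_formE u v : form_eval (canonical_mx R n) u v =
  pairing (rsubmx u) (lsubmx v) - pairing (lsubmx u) (rsubmx v).
Proof.
rewrite canonical_mxE /form_eval mulmxN mulNmx !mxE.
by have := standard_formE u v; rewrite /form_eval mxE => ->; rewrite opprB.
Qed.

Lemma pairing_row_mx (a b : 'rV[R]_n) w :
  pairing (row_mx a b) w = pairing a (lsubmx w) + pairing b (rsubmx w).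
Proof.
rewrite /pairing big_split_ord; congr (_ + _); apply: eq_bigr => i _.
  by rewrite row_mxEl mxE.
by rewrite row_mxEr mxE.
Qed.

Lemma pairing_lr u v : pairing (lsubmx u) (rsubmx v) =
  \sum_j u 0 (lshift n j) * v 0 (rshift n j).
Proof. by apply: eq_bigr => j _; rewrite !mxE. Qed.

Lemma pairing_rl u v : pairing (rsubmx u) (lsubmx v) =
  \sum_j u 0 (rshift n j) * v 0 (lshift n j).
Proof. by apply: eq_bigr => j _; rewrite !mxE. Qed.

Lemma Ck_pairing m k (U : set 'rV[R]_m) (c : 'rV[R]_m) : open U -> Ck k U (pairing c).
Proof.
move=> oU; apply: Ck_sum => // i; apply: (@Ck_scale _ _ _ _ _ (fun x : 'rV[R]_m => x 0 i)) => //.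
exact: Ck_coordR.
Qed.

Lemma derive_pairing m (c u x : 'rV[R]_m) : is_derive x u (pairing c) (pairing c u).
Proof. exact: (is_derive_pairing c (is_derive_id x u)). Qed.

End embeddings.

(** * The upper bound: embedding the disc bundle into a cylinder *)

Section upper_bound.
Context {R : realType} {n : nat}.
Implicit Types (f : 'rV[R]_n -> R).

(** A shortest integer vector is primitive, so it is a row of a unimodular
    matrix: the Smith form of k exhibits k as a multiple of such a row, and
    minimality forces the multiple to be no shorter. *)
Lemma shortest_vector_unimodular f (j0 : 'I_n) : flat_norm f -> j0 = 0%N :> nat ->
  exists B B' : 'M[int]_n, [/\ B *m B' = 1%:M, B' *m B = 1%:M &
    forall k : 'rV[int]_n, k != 0 -> f (intv (row j0 B)) <= f (intv k)].
Proof.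
move=> hf j00; have n0 : (0 < n)%N by rewrite -j00 ltn_ord.
have [k k0 kmin] := shortest_int_vector hf n0.
have [L _ [B uB [d _ kE]]] := int_Smith_normal_form k.
exists B, (invmx B); split; [exact: mulmxV|exact: mulVmx|].
pose c := L 0 0 * d`_0.
have kc : k = c *: row j0 B.
  rewrite kE; apply/rowP => j; rewrite !mxE (bigD1 j0) //= big1 ?addr0; last first.
    move=> i ij; rewrite !mxE big1 ?mul0r // => i' _; rewrite !mxE (ord1 i') /=.
    rewrite (_ : (0%N == i) = false) ?mulr0n ?mulr0 //.
    by apply/negbTE; apply: contra ij => /eqP e; apply/eqP/val_inj; rewrite /= -e j00.
  by rewrite !mxE big_ord1 !mxE j00 eqxx mulr1n.
have c0 : c != 0 by apply: contra k0 => /eqP c0; rewrite kc c0 scale0r.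
move=> k' k'0; apply: le_trans (kmin _ k'0).
have -> : intv k = c%:~R *: (intv (row j0 B) : 'rV[R]_n).
  by apply/rowP => j; rewrite !mxE {1}kc !mxE intrM.
rewrite fnZ // ler_peMl ?fn_ge0 // -intr_norm -[1]/(1%:~R) ler_int.
by rewrite -gtz0_ge1 normr_gt0.
Qed.

Section polar.
Variables (B B' : 'M[int]_n) (a : 'I_n -> R).
Hypotheses (BB' : B *m B' = 1%:M) (B'B : B' *m B = 1%:M).

Let T : 'M[R]_n := map_mx intr B.
Let T' : 'M[R]_n := map_mx intr B'.

Let TT' : T *m T' = 1%:M.
Proof. by rewrite -map_mxM BB' map_mx1. Qed.
Let T'T : T' *m T = 1%:M.
Proof. by rewrite -map_mxM B'B map_mx1. Qed.

(** With the rows of T as a basis of the lattice, (q T^-1, p T^T) are again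
    canonical coordinates; they are the pairings with these covectors. *)
Definition angle_covector (j : 'I_n) : 'rV[R]_(n + n) := row_mx (col j T')^T 0.
Definition action_covector (j : 'I_n) : 'rV[R]_(n + n) := row_mx 0 (row j T).

Lemma angleE j w : pairing (angle_covector j) w = (lsubmx w *m T') 0 j.
Proof.
rewrite pairing_row_mx pairing0l addr0 mxE; apply: eq_bigr => i _.
by rewrite !mxE mulrC.
Qed.

Lemma actionE j w : pairing (action_covector j) w = (rsubmx w *m T^T) 0 j.
Proof.
rewrite pairing_row_mx pairing0l add0r mxE; apply: eq_bigr => i _.
by rewrite !mxE mulrC.
Qed.

Definition radius j w : R := Num.sqrt (pi^-1 * (pairing (action_covector j) w + a j)).
Definition polar_x j w : R := radius j w * cos (2 * pi * pairing (angle_covector j) w).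
Definition polar_y j w : R := radius j w * sin (2 * pi * pairing (angle_covector j) w).

(** Polar coordinates in each plane, where the angle is 2 pi X and the area of
    the disc is P + a, so that the area form is dP dX. The constants a keep
    the area positive. *)
Definition polar_map (w : 'rV[R]_(n + n)) : 'rV[R]_(n + n) :=
  row_mx (\row_j polar_x j w) (\row_j polar_y j w).

Definition polar_dom : set 'rV[R]_(n + n) :=
  [set w | forall j, 0 < pairing (action_covector j) w + a j].

Lemma polar_dom_open : open polar_dom.
Proof.
rewrite openE => w Dw.
have H j : \forall w' \near w, 0 < pairing (action_covector j) w' + a j.
  have c : {for w, continuous (fun w' => pairing (action_covector j) w' + a j)}.
    exact: cvgD (@continuous_pairing R _ (action_covector j) w) (cvg_cst _).
  by apply: (c [set r | 0 < r]); apply: open_nbhs_nbhs; split; [exact: open_gt|exact: Dw].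
have h : \forall w' \near w, forall j, 0 < pairing (action_covector j) w' + a j.
  exact: (@filter_forall _ _ (fun j w' => 0 < pairing (action_covector j) w' + a j) _ _ H).
by apply: (filterS _ h) => w'.
Qed.

Lemma Ck_radius k j : Ck k polar_dom (radius j).
Proof.
have oD := polar_dom_open.
apply: (@Ck_comp1 _ _ _ _ [set x : R | 0 < x] Num.sqrt
  (fun w => pi^-1 * (pairing (action_covector j) w + a j))) => //.
- by move=> w Dw; rewrite /= mulr_gt0 ?invr_gt0 ?pi_gt0.
- exact: Ck_sqrt.
apply: (@Ck_scale _ _ _ _ _ (fun w => pairing (action_covector j) w + a j)) => //.
by apply: (@CkD _ _ _ _ _ (pairing (action_covector j)) (cst (a j))) => //; [exact: Ck_pairing|exact: Ck_cst].
Qed.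

Lemma Ck_trig k j (t : R -> R) : Ck k setT t ->
  Ck k polar_dom (fun w => t (2 * pi * pairing (angle_covector j) w)).
Proof.
have oD := polar_dom_open.
move=> ht; apply: (@Ck_comp1 _ _ _ _ setT t (fun w => 2 * pi * pairing (angle_covector j) w)) => //.
by apply: (@Ck_scale _ _ _ _ _ (pairing (angle_covector j))) => //; exact: Ck_pairing.
Qed.

Lemma Cinfty_polar : Cinfty polar_dom polar_map.
Proof.
move=> k; have oD := polar_dom_open; have [hs hc] := Ck_sin_cos k (@openT R).
apply: Ck_rV => // i; case: (split_ordP i) => j ->.
  apply: (@eq_Ck _ _ _ _ _ (polar_x j)) => // [w _|]; first by rewrite row_mxEl mxE.
  by apply: CkM => //; [exact: Ck_radius|exact: Ck_trig].
apply: (@eq_Ck _ _ _ _ _ (polar_y j)) => // [w _|]; first by rewrite row_mxEr mxE.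
by apply: CkM => //; [exact: Ck_radius|exact: Ck_trig].
Qed.

Lemma derive_radius j w u : polar_dom w ->
  is_derive w u (radius j)
    ((2 * radius j w)^-1 * (pi^-1 * pairing (action_covector j) u)).
Proof.
move=> Dw; have p0 : 0 < pi^-1 * (pairing (action_covector j) w + a j).
  by rewrite mulr_gt0 ?invr_gt0 ?pi_gt0.
apply: (@is_derive_chain _ _ Num.sqrt (fun w => pi^-1 * (pairing (action_covector j) w + a j))).
- have [+ _] : Ck 1 setT (fun w => pi^-1 * (pairing (action_covector j) w + a j)).
    apply: (@Ck_scale _ _ _ _ _ (fun w => pairing (action_covector j) w + a j)); first exact: openT.
    apply: (@CkD _ _ _ _ _ (pairing (action_covector j)) (cst (a j))); first exact: openT.
      exact: Ck_pairing openT.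
    exact: Ck_cst.
  exact.
- exact: is_derive1_sqrt.
apply: is_derive_scale; rewrite -[X in is_derive _ _ _ X]addr0.
by apply: is_derive_add; exact: derive_pairing.
Qed.

Lemma derive_trig j w u (t : R -> R) dt :
  is_derive (2 * pi * pairing (angle_covector j) w) (1 : R) t dt ->
  is_derive w u (fun w => t (2 * pi * pairing (angle_covector j) w))
    (dt * (2 * pi * pairing (angle_covector j) u)).
Proof.
move=> ht; apply: (@is_derive_chain _ _ t (fun w => 2 * pi * pairing (angle_covector j) w)) => //.
  have [+ _] : Ck 1 setT (fun w => 2 * pi * pairing (angle_covector j) w).
    apply: (@Ck_scale _ _ _ _ _ (pairing (angle_covector j))); first exact: openT.
    exact: Ck_pairing openT.
  exact.
apply: is_derive_scale; exact: derive_pairing.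
Qed.

Lemma derive_polar_x j w u : polar_dom w ->
  'D_u polar_map w 0 (lshift n j) =
  radius j w * (- sin (2 * pi * pairing (angle_covector j) w) * (2 * pi * pairing (angle_covector j) u))
  + cos (2 * pi * pairing (angle_covector j) w) * ((2 * radius j w)^-1 * (pi^-1 * pairing (action_covector j) u)).
Proof.
move=> Dw; have [+ _] := Cinfty_polar 1%N; move=> /(_ w Dw) d.
rewrite -derive_coordE //.
rewrite (_ : (fun x => _) = polar_x j); last by apply/funext => x; rewrite row_mxEl mxE.
have h := derive_trig u (is_derive_cos (2 * pi * pairing (angle_covector j) w)).
by have [_ ->] := is_derive_mul (derive_radius j u Dw) h.
Qed.

Lemma derive_polar_y j w u : polar_dom w ->
  'D_u polar_map w 0 (rshift n j) =
  radius j w * (cos (2 * pi * pairing (angle_covector j) w) * (2 * pi * pairing (angle_covector j) u))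
  + sin (2 * pi * pairing (angle_covector j) w) * ((2 * radius j w)^-1 * (pi^-1 * pairing (action_covector j) u)).
Proof.
move=> Dw; have [+ _] := Cinfty_polar 1%N; move=> /(_ w Dw) d.
rewrite -derive_coordE //.
rewrite (_ : (fun x => _) = polar_y j); last by apply/funext => x; rewrite row_mxEr mxE.
have h := derive_trig u (is_derive_sin (2 * pi * pairing (angle_covector j) w)).
by have [_ ->] := is_derive_mul (derive_radius j u Dw) h.
Qed.

(** In each plane, the product of the radius by its derivative is the constant
    multiple (2 pi)^-1 of dP, and the derivatives of the cosine and of the
    sine combine to 1. *)
Lemma polar_symplectic w u v : polar_dom w ->
  form_eval (standard_mx R n) ('D_u polar_map w) ('D_v polar_map w) =
  form_eval (canonical_mx R n) u v.
Proof.
move=> Dw; rewrite standard_formE canonical_formE.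
have -> : pairing (rsubmx u) (lsubmx v) - pairing (lsubmx u) (rsubmx v) =
    \sum_j (pairing (action_covector j) u * pairing (angle_covector j) v
            - pairing (angle_covector j) u * pairing (action_covector j) v).
  rewrite sumrB; congr (_ - _).
    transitivity (pairing (rsubmx u *m T^T) (lsubmx v *m T')).
      by rewrite pairing_mulmxr trmxK -mulmxA T'T mulmx1.
    by apply: eq_bigr => j _; rewrite actionE angleE.
  transitivity (pairing (lsubmx u *m T') (rsubmx v *m T^T)).
    by rewrite pairing_mulmxr -mulmxA -trmx_mul T'T trmx1 mulmx1.
  by apply: eq_bigr => j _; rewrite actionE angleE.
rewrite pairing_lr pairing_rl -sumrB; apply: eq_bigr => j _.
have combine (x1 x2 x3 x4 y1 y2 y3 y4 : R) : x1 = y1 -> x2 = y2 -> x3 = y3 -> x4 = y4 ->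
  x1 * x2 - x3 * x4 = y1 * y2 - y3 * y4 by move=> -> -> -> ->.
apply: etrans (combine _ _ _ _ _ _ _ _ (derive_polar_x j u Dw) (derive_polar_y j v Dw)
  (derive_polar_y j u Dw) (derive_polar_x j v Dw)) _.
have r0 : radius j w != 0.
  by rewrite gt_eqF // sqrtr_gt0 mulr_gt0 ?invr_gt0 ?pi_gt0.
have p0 : pi != 0 :> R by rewrite gt_eqF // pi_gt0.
have := cos2Dsin2 (2 * pi * pairing (angle_covector j) w).
move: (cos _) (sin _) => c s cs.
move: (pairing (angle_covector j) u) (pairing (angle_covector j) v) => x1 x2.
move: (pairing (action_covector j) u) (pairing (action_covector j) v) => p1 p2.
transitivity ((p1 * x2 - x1 * p2) * (c ^+ 2 + s ^+ 2)); last by rewrite cs mulr1.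
by move: (radius j w) r0 pi p0 => r r0 p p0; field; rewrite r0 p0.
Qed.

Lemma continuous_polar_map : continuous polar_map.
Proof.
have cr j : continuous (radius j).
  move=> w; apply: (@continuous_comp _ _ _ (fun w => pi^-1 * (pairing (action_covector j) w + a j)) Num.sqrt).
    exact: cvgM (cvg_cst _) (cvgD (@continuous_pairing R _ (action_covector j) w) (cvg_cst _)).
  exact: sqrt_continuous.
have ct (t : R -> R) j : continuous t -> continuous (fun w => t (2 * pi * pairing (angle_covector j) w)).
  move=> ht w; apply: (@continuous_comp _ _ _ (fun w => 2 * pi * pairing (angle_covector j) w) t); last exact: ht.
  exact: cvgM (cvg_cst _) (@continuous_pairing R _ (angle_covector j) w).
suff h : Ck 0 setT polar_map by move=> w; exact: h.
apply: Ck_rV => [|i]; first exact: openT.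
move=> w _; case: (split_ordP i) => j ->.
  rewrite (_ : (fun w => _) = polar_x j); last by apply/funext => x; rewrite row_mxEl mxE.
  exact: cvgM (cr j w) (ct _ j (@continuous_cos R) w).
rewrite (_ : (fun w => _) = polar_y j); last by apply/funext => x; rewrite row_mxEr mxE.
exact: cvgM (cr j w) (ct _ j (@continuous_sin R) w).
Qed.

Definition torus_polar (z : torus R n * 'rV[R]_n) : 'rV[R]_(n + n) :=
  polar_map (row_mx (torus_rep z.1) z.2).

Lemma torus_polar_proj w : torus_polar (torus_bundle_proj w) = polar_map w.
Proof.
rewrite /torus_polar /=; have [k ->] := torus_rep_proj (lsubmx w).
have P j : pairing (action_covector j) (row_mx (lsubmx w + intv k) (rsubmx w)) =
    pairing (action_covector j) w.
  by rewrite !actionE row_mxKr.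
have A j : exists2 m, m \is a Num.int &
    pairing (angle_covector j) (row_mx (lsubmx w + intv k) (rsubmx w)) =
    pairing (angle_covector j) w + m.
  exists ((intv k *m T') 0 j); last by rewrite !angleE row_mxKl mulmxDl mxE.
  by rewrite -map_mxM mxE intr_int.
rewrite /polar_map /polar_x /polar_y /radius; congr row_mx; apply/rowP => j;
  rewrite !mxE P; have [m mi ->] := A j.
- by rewrite cos_2pi_periodic.
- by rewrite sin_2pi_periodic.
Qed.

Lemma torus_bundle_chartK (c : cs_index (torus_bundle R n)) (z : torus_bundle R n) :
  cs_dom c z -> torus_bundle_proj (cs_chart c z) = z.
Proof.
case: z => q p [x cx /= <-]; rewrite torus_liftE //.
by rewrite /torus_bundle_proj row_mxKl row_mxKr.
Qed.

Lemma torus_polar_chart (c : cs_index (torus_bundle R n)) (z : torus_bundle R n) :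
  cs_dom c z -> torus_polar z = polar_map (cs_chart c z).
Proof. by move=> cz; rewrite -torus_polar_proj torus_bundle_chartK. Qed.

Lemma continuous_torus_polar : continuous (torus_polar : torus_bundle R n -> 'rV[R]_(n + n)).
Proof.
move=> z; have [c cz] := mf_cover z.
have N : \forall z' \near z, polar_map (cs_chart c z') = torus_polar z'.
  apply: filterS (open_nbhs_nbhs (conj (mf_dom_open c) cz)) => z' cz'.
  by rewrite (torus_polar_chart cz').
have h : (fun z' => polar_map (cs_chart c z')) @ z --> torus_polar z.
  rewrite (torus_polar_chart cz).
  apply: (@continuous_comp _ _ _ (cs_chart c) polar_map); first exact: mf_chart_continuous.
  exact: continuous_polar_map.
by apply: cvg_trans h; exact: near_eq_cvg.
Qed.

(** The radii give p, and equal angles mean that the base points differ by an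
    integer vector in the lattice basis. *)
Lemma torus_polar_inj (z z' : torus R n * 'rV[R]_n) :
  (forall j, 0 < (z.2 *m T^T) 0 j + a j) -> (forall j, 0 < (z'.2 *m T^T) 0 j + a j) ->
  torus_polar z = torus_polar z' -> z = z'.
Proof.
have [w ->] : exists w, z = torus_bundle_proj w.
  exists (row_mx (torus_rep z.1) z.2).
  by rewrite /torus_bundle_proj row_mxKl row_mxKr torus_repK; case: z.
have [w' ->] : exists w', z' = torus_bundle_proj w'.
  exists (row_mx (torus_rep z'.1) z'.2).
  by rewrite /torus_bundle_proj row_mxKl row_mxKr torus_repK; case: z'.
rewrite !torus_polar_proj /= => h h' /eq_row_mx[/rowP ex /rowP ey].
have radE v j : 0 < pairing (action_covector j) v + a j ->
    polar_x j v ^+ 2 + polar_y j v ^+ 2 = pi^-1 * (pairing (action_covector j) v + a j) /\ 0 < radius j v.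
  move=> v0; have p0 : 0 < pi^-1 * (pairing (action_covector j) v + a j).
    by rewrite mulr_gt0 ?invr_gt0 ?pi_gt0.
  split; last by rewrite sqrtr_gt0.
  rewrite /polar_x /polar_y !exprMn -mulrDr cos2Dsin2 mulr1 sqr_sqrtr //; exact: ltW.
have hw j : 0 < pairing (action_covector j) w + a j by rewrite actionE.
have hw' j : 0 < pairing (action_covector j) w' + a j by rewrite actionE.
have eP j : pairing (action_covector j) w = pairing (action_covector j) w'.
  have [e _] := radE w j (hw j); have [e' _] := radE w' j (hw' j).
  have := ex j; have := ey j; rewrite !mxE => e1 e2.
  have : pi^-1 * (pairing (action_covector j) w + a j) =
         pi^-1 * (pairing (action_covector j) w' + a j) by rewrite -e -e' e1 e2.
  by move/(mulfI (invr_neq0 (lt0r_neq0 (pi_gt0 R))))/addIr.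
congr pair; last first.
  have e : rsubmx w *m T^T = rsubmx w' *m T^T.
    by apply/rowP => j; rewrite -!actionE.
  by rewrite -[LHS]mulmx1 -[RHS]mulmx1 -trmx1 -T'T trmx_mul !mulmxA e.
have eX j : pairing (angle_covector j) w - pairing (angle_covector j) w' \is a Num.int.
  have [_ r0] := radE w j (hw j).
  have rE : radius j w' = radius j w by rewrite /radius eP.
  apply: cos_sin_2pi_eq.
    by have := ex j; rewrite !mxE /polar_x rE => /(mulfI (lt0r_neq0 r0)).
  by have := ey j; rewrite !mxE /polar_y rE => /(mulfI (lt0r_neq0 r0)).
apply/torus_proj_int; exists ((\row_j Num.floor (pairing (angle_covector j) w - pairing (angle_covector j) w')) *m B).
rewrite /intv map_mxM -[X in _ *m X]/T.
have -> : map_mx intr (\row_j Num.floor (pairing (angle_covector j) w - pairing (angle_covector j) w')) =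
   lsubmx w *m T' - lsubmx w' *m T'.
  apply/rowP => j; rewrite [LHS]mxE [X in _%:~R = X]mxE [X in _ = _ + X]mxE -!angleE mxE.
  by have := eX j; rewrite intrEfloor => /eqP.
by rewrite mulmxBl -!mulmxA T'T !mulmx1 addrC subrK.
Qed.

Definition box_lo (b : 'I_n -> R) : 'rV[R]_(n + n) := row_mx 0 (\row_j - b j).
Definition box_hi (b : 'I_n -> R) : 'rV[R]_(n + n) := row_mx (const_mx 1) (\row_j b j).

(** The set of the points with |P_j| <= b_j, written as the image of a box to
    make it compact: a unit cube covers the torus. *)
Definition action_box (b : 'I_n -> R) : set (torus_bundle R n) :=
  (fun v : 'rV[R]_(n + n) => torus_bundle_proj (row_mx (lsubmx v) (rsubmx v *m T'^T))) @`
  [set v : 'rV[R]_(n + n) | forall i, `[box_lo b 0 i, box_hi b 0 i]%classic (v 0 i)].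

Lemma action_box_compact b : compact (action_box b).
Proof.
apply: continuous_compact; last first.
  apply: (@rV_compact _ _ (fun i => `[box_lo b 0 i, box_hi b 0 i]%classic)) => i.
  exact: segment_compact.
apply: continuous_subspaceT => v.
apply: (@continuous_comp _ _ _ (fun v : 'rV[R]_(n + n) => row_mx (lsubmx v) (rsubmx v *m T'^T)) (@torus_bundle_proj R n)); last exact: torus_bundle_proj_continuous.
apply: (@continuous_comp _ _ _ (fun v : 'rV[R]_(n + n) => (lsubmx v, rsubmx v *m T'^T))
  (fun z : 'rV[R]_n * 'rV[R]_n => row_mx z.1 z.2)); last exact: row_mx_continuous.
have c2 : {for v, continuous (fun v : 'rV[R]_(n + n) => rsubmx v *m T'^T)}.
  apply: (@continuous_comp _ _ _ (@rsubmx R 1 n n) (mulmxr T'^T)).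
    exact: continuous_rsubmx.
  exact: continuous_mulmxr.
exact: cvg_pair (@continuous_lsubmx R 1 n n v) c2.
Qed.

Lemma action_boxP b z : action_box b z <-> forall j, `|(z.2 *m T^T) 0 j| <= b j.
Proof.
split=> [[v vb <-] j|h].
  rewrite /= row_mxKr -mulmxA -trmx_mul TT' trmx1 mulmx1.
  have := vb (rshift n j); rewrite /box_lo /box_hi /= !row_mxEr !mxE in_itv /=.
  by rewrite ler_norml.
pose x : 'rV[R]_n := \row_i (torus_rep z.1 0 i - (Num.floor (torus_rep z.1 0 i))%:~R).
exists (row_mx x (z.2 *m T^T)).
  move=> i; rewrite /box_lo /box_hi; case: (split_ordP i) => j ->.
    rewrite !row_mxEl !mxE /= in_itv /= subr_ge0 floor_le /=.
    by have := floorD1_gt (torus_rep z.1 0 j); rewrite intrD1; lra.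
  by rewrite !row_mxEr !mxE /= in_itv /= -ler_norml; have := h j; rewrite mxE.
rewrite row_mxKl row_mxKr -mulmxA -trmx_mul T'T trmx1 mulmx1 /torus_bundle_proj row_mxKl row_mxKr.
rewrite (_ : torus_proj x = z.1); first by case: z h x.
rewrite -[RHS]torus_repK; apply/torus_proj_int.
exists (- \row_i Num.floor (torus_rep z.1 0 i)); apply/rowP => i; rewrite !mxE.
by rewrite mulrNz.
Qed.

End polar.

Lemma disc_bundle_flat (F : torus R n * 'rV[R]_n -> R) f z : finsler F -> flat_norm f ->
  (forall q v, F (q, v) = f v) ->
  disc_bundle F z <-> forall v, v != 0 -> pairing z.2 v < f v.
Proof.
move=> hF hf FE; split=> [/(disc_bundleP _ hF) h v v0|h]; last first.
  by apply/(disc_bundleP _ hF) => v /norm1_neq0 v0; rewrite FE; exact: h.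
have nv : 0 < `|v| by rewrite normr_gt0.
have := h (`|v|^-1 *: v); rewrite FE (fn_homogeneous hf) ?invr_gt0 // pairingZr.
rewrite ltr_pM2l ?invr_gt0 //; apply.
by rewrite normrZ normfV normr_id mulVf // gt_eqF.
Qed.

Lemma disc_bundle_flat_abs (F : torus R n * 'rV[R]_n -> R) f z : finsler F -> flat_norm f ->
  (forall q v, F (q, v) = f v) ->
  disc_bundle F z -> forall v, v != 0 -> `|pairing z.2 v| < f v.
Proof.
move=> hF hf FE /(disc_bundle_flat _ hF hf FE) h v v0.
rewrite ltr_norml h // andbT ltrNl -pairingNr -(fn_sym hf v).
by apply: h; rewrite oppr_eq0.
Qed.

(** On the disc bundle, the action along the j-th lattice vector lies between
    -f and f of that vector, so the first disc has area at most 2 f plus e. *)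
Lemma disc_bundle_in_cylinder (F : torus R n * 'rV[R]_n -> R) (hF : finsler F) f
    (B B' : 'M[int]_n) (j0 : 'I_n) (e : R) :
  flat_norm f -> (forall q v, F (q, v) = f v) -> j0 = 0%N :> nat ->
  B *m B' = 1%:M -> B' *m B = 1%:M -> 0 < e ->
  exists phi : disc_cotangent_bundle hF ->
    @symplectic_cylinder R n (Num.sqrt (pi^-1 * (2 * f (intv (row j0 B)) + e))),
  symplectic_embedding phi.
Proof.
move=> hf FE j00 BB' B'B e0.
pose b j := f (intv (row j B)); pose a j := b j + e.
have row0 j : intv (row j B) != 0 :> 'rV[R]_n.
  rewrite intv_eq0; apply/eqP => h.
  have := congr1 (fun M : 'M[int]_n => M j j) BB'.
  have -> : (B *m B') j j = (row j B *m B') 0 j.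
    by rewrite -row_mul [RHS]mxE.
  by rewrite h mul0mx !mxE eqxx.
have b0 j : 0 < b j by exact: fn_pos.
have DP z j : disc_bundle F z -> `|(z.2 *m (map_mx intr B)^T) 0 j| < b j.
  move=> Dz; have := disc_bundle_flat_abs hF hf FE Dz (row0 j).
  rewrite /pairing mxE; congr (`|_| < _); apply: eq_bigr => i _; by rewrite !mxE.
pose PF := torus_polar B B' a.
pose K := action_box B' b.
have DK : disc_bundle F `<=` K.
  by move=> z Dz; apply/(action_boxP BB' B'B) => j; apply: ltW; exact: DP.
have pos z j : K z -> 0 < (z.2 *m (map_mx intr B)^T) 0 j + a j.
  move=> /(action_boxP BB' B'B) /(_ j); rewrite ler_norml => /andP[h _].
  by rewrite /a; lra.
have cyl z : disc_bundle F z -> cylinder_set (n := n) (Num.sqrt (pi^-1 * (2 * f (intv (row j0 B)) + e))) (PF z).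
  move=> Dz j j1; have -> : j = j0 by apply/val_inj; rewrite /= j1.
  have p0 : 0 < (pi : R)^-1 by rewrite invr_gt0 pi_gt0.
  rewrite /sqr_modulus sqr_sqrtr; last by rewrite mulr_ge0 ?ltW //; have := b0 j0; rewrite /b; lra.
  have Pj := pos z j0 (DK z Dz).
  rewrite row_mxEl row_mxEr !mxE /polar_x /polar_y !exprMn -mulrDr cos2Dsin2 mulr1.
  rewrite /radius actionE row_mxKr sqr_sqrtr; last by rewrite mulr_ge0 ?ltW.
  rewrite ltr_pM2l //; have := DP z j0 Dz; rewrite ltr_norml /a /b => /andP[_]; lra.
have dv (z : disc_cotangent_bundle hF) : disc_bundle F (set_val z) by exact: set_valP.
pose phi (z : disc_cotangent_bundle hF) : @symplectic_cylinder R n _ :=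
  exist _ (PF (set_val z)) (mem_set (cyl _ (dv z))).
exists phi.
have [inj opn] : injective phi /\ forall A : set (disc_cotangent_bundle hF), open A ->
    exists2 B : set (@symplectic_cylinder R n _), open B & phi @` A = B `&` range phi.
  apply: (@compact_embedding _ _ _ K _ PF) => //.
  - exact: action_box_compact.
  - by apply: continuous_subspaceT; exact: continuous_torus_polar.
  - move=> z z'; rewrite !inE => Kz Kz'; apply: (torus_polar_inj B'B) => j; exact: pos.
apply: symplectic_embedding_local => //.
- apply: continuous_comp_initial => z.
  apply: (@continuous_comp _ _ _ (@set_val _ (disc_bundle F)) PF); first exact: initial_continuous.
  exact: continuous_torus_polar.
- move=> i j z iz jz.
  have Dz : polar_dom B a (cs_chart i z).
    move=> j'; rewrite actionE.
    have -> : rsubmx (cs_chart i z) = (set_val z).2 by rewrite /= row_mxKr.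
    exact: pos (DK _ (dv z)).
  exists (polar_map B B' a), (polar_dom B a); split.
  + exact: polar_dom_open.
  + exact: Dz.
  + exact: Cinfty_polar.
  + move=> q iq _ _; exact: (torus_polar_chart B B' a iq).
  + move=> u v; exact: (polar_symplectic B'B u v Dz).
Qed.

Lemma capacity_disc_bundle_le (F : torus R n * 'rV[R]_n -> R) (hF : finsler F) f
    (c : symplectic_manifold R (n + n) -> \bar R) :
  (0 < n)%N -> flat_norm f -> (forall q v, F (q, v) = f v) -> symplectic_capacity c ->
  exists2 k : 'rV[int]_n, k != 0 /\ (forall k', k' != 0 -> f (intv k) <= f (intv k')) &
  (c (disc_cotangent_bundle hF) <= (2 * f (intv k))%:E)%E.
Proof.
move=> n0 hf FE hc; pose j0 := Ordinal n0.
have [B [B' [BB' B'B kmin]]] := shortest_vector_unimodular hf (erefl : j0 = 0%N :> nat).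
exists (row j0 B); first (split; last exact: kmin).
  apply/eqP => h; have := congr1 (fun M : 'M[int]_n => M j0 j0) BB'.
  have -> : (B *m B') j0 j0 = (row j0 B *m B') 0 j0 by rewrite -row_mul [RHS]mxE.
  by rewrite h mul0mx !mxE eqxx.
apply/lee_addgt0Pr => e e0.
have [phi hphi] := disc_bundle_in_cylinder hF hf FE (erefl : j0 = 0%N :> nat) BB' B'B e0.
apply: le_trans (capacity_embedding hc hphi) _.
have pos : 0 < pi^-1 * (2 * f (intv (row j0 B)) + e).
  by rewrite mulr_gt0 ?invr_gt0 ?pi_gt0 // ltr_wpDl // mulr_ge0 // fn_ge0.
rewrite capacity_cylinder ?sqrtr_gt0 // sqr_sqrtr; last exact: ltW.
by rewrite mulVKf ?lt0r_neq0 ?pi_gt0 // -EFinD.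
Qed.

End upper_bound.

(** * A radial profile for the ball *)

Section row_calculus.
Context {R : realType}.
Variables (V : normedModType R) (m : nat).
Implicit Types (f g : V -> 'rV[R]_m) (x v : V).

Lemma is_derive_rV f x v (df : 'rV[R]_m) :
  (forall i, is_derive x v (fun y => f y 0 i) (df 0 i)) -> is_derive x v f df.
Proof.
move=> h; have d : derivable f x v.
  by apply/derivable_mxP => i j; rewrite (ord1 i); have [] := h j.
apply: DeriveDef => //; rewrite derive_mx //; apply/rowP => i.
by rewrite mxE; have [_ ->] := h i.
Qed.

Lemma is_derive_coord f x v df i : is_derive x v f df ->
  is_derive x v (fun y => f y 0 i) (df 0 i).
Proof.
move=> [d <-]; have d' := (derivable_mxP _ _ _).1 d.
by apply: DeriveDef => //; rewrite derive_mx // mxE.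
Qed.

Lemma is_derive_scalev (c : V -> R) f x v dc df :
  is_derive x v c dc -> is_derive x v f df ->
  is_derive x v (fun y => c y *: f y) (dc *: f x + c x *: df).
Proof.
move=> hc hf; apply: is_derive_rV => i; apply: is_derive_eq.
  rewrite (_ : (fun y => _) = (fun y => c y * f y 0 i)); last by apply/funext => y; rewrite mxE.
  exact: is_derive_mul hc (is_derive_coord i hf).
by rewrite !mxE addrC; congr (_ + _); rewrite mulrC.
Qed.

Lemma is_derive_pairing2 f g x v df dg :
  is_derive x v f df -> is_derive x v g dg ->
  is_derive x v (fun y => pairing (f y) (g y)) (pairing df (g x) + pairing (f x) dg).
Proof.
move=> hf hg; apply: is_derive_eq.
  apply: is_derive_bigsum => i; exact: is_derive_mul (is_derive_coord i hf) (is_derive_coord i hg).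
by rewrite big_split addrC /=; congr (_ + _); apply: eq_bigr => i _; rewrite mulrC.
Qed.

Lemma Ck_scalev k (U : set V) (c : V -> R) f : open U -> Ck k U c -> Ck k U f ->
  Ck k U (fun y => c y *: f y).
Proof.
move=> oU hc hf; apply: Ck_rV => // i.
apply: eq_Ck (CkM oU hc (Ck_coord i oU hf)) => // y _; by rewrite mxE.
Qed.

Lemma Ck_pairing2 k (U : set V) f g : open U -> Ck k U f -> Ck k U g ->
  Ck k U (fun y => pairing (f y) (g y)).
Proof.
by move=> oU hf hg; apply: Ck_sum => // i; exact: CkM oU (Ck_coord i oU hf) (Ck_coord i oU hg).
Qed.

Lemma Ck_mulmxr m' k (U : set V) f (A : 'M[R]_(m, m')) : open U -> Ck k U f ->
  Ck k U (fun y => f y *m A).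
Proof.
move=> oU hf; apply: Ck_rV => // j.
apply: (@eq_Ck _ _ _ _ _ (fun y => \sum_i A i j * f y 0 i)) => // [y _|].
  by rewrite mxE; apply: eq_bigr => i _; rewrite mulrC.
apply: Ck_sum => // i; apply: (@Ck_scale _ _ _ _ _ (fun y => f y 0 i)) => //.
exact: Ck_coord oU hf.
Qed.

Lemma Ck_row_mx m' k (U : set V) f (g : V -> 'rV[R]_m') : open U -> Ck k U f -> Ck k U g ->
  Ck k U (fun y => row_mx (f y) (g y)).
Proof.
move=> oU hf hg; apply: Ck_rV => // i; case: (split_ordP i) => j ->.
  by apply: eq_Ck (Ck_coord j oU hf) => // y _; rewrite row_mxEl.
by apply: eq_Ck (Ck_coord j oU hg) => // y _; rewrite row_mxEr.
Qed.

End row_calculus.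

Section submx_calculus.
Context {R : realType}.

Lemma is_derive_mulmxr (V : normedModType R) m m' (f : V -> 'rV[R]_m) (x v : V) df (A : 'M[R]_(m, m')) :
  is_derive x v f df -> is_derive x v (fun y => f y *m A) (df *m A).
Proof.
move=> hf; apply: is_derive_rV => j; apply: is_derive_eq.
  rewrite (_ : (fun y => _) = (fun y => \sum_i A i j * f y 0 i)); last first.
    by apply/funext => y; rewrite mxE; apply: eq_bigr => i _; rewrite mulrC.
  by apply: is_derive_bigsum => i; apply: is_derive_scale; exact: is_derive_coord hf.
by rewrite mxE; apply: eq_bigr => i _; rewrite mulrC.
Qed.

Lemma Ck_lsubmx k m1 m2 (U : set 'rV[R]_(m1 + m2)) : open U -> Ck k U (@lsubmx R 1 m1 m2).
Proof.
move=> oU; apply: Ck_rV => // i; apply: eq_Ck (Ck_coordR k (lshift m2 i) oU) => // y _.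
by rewrite mxE.
Qed.

Lemma Ck_rsubmx k m1 m2 (U : set 'rV[R]_(m1 + m2)) : open U -> Ck k U (@rsubmx R 1 m1 m2).
Proof.
move=> oU; apply: Ck_rV => // i; apply: eq_Ck (Ck_coordR k (rshift m1 i) oU) => // y _.
by rewrite mxE.
Qed.

Lemma is_derive_lsubmx m1 m2 (x v : 'rV[R]_(m1 + m2)) :
  is_derive x v (@lsubmx R 1 m1 m2) (lsubmx v).
Proof.
apply: is_derive_rV => i; rewrite (_ : (fun y => _) = fun y : 'rV[R]_(m1 + m2) => y 0 (lshift m2 i)).
  rewrite mxE; exact: is_derive_coord (is_derive_id x v).
by apply/funext => y; rewrite mxE.
Qed.

Lemma is_derive_rsubmx m1 m2 (x v : 'rV[R]_(m1 + m2)) :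
  is_derive x v (@rsubmx R 1 m1 m2) (rsubmx v).
Proof.
apply: is_derive_rV => i; rewrite (_ : (fun y => _) = fun y : 'rV[R]_(m1 + m2) => y 0 (rshift m1 i)).
  rewrite mxE; exact: is_derive_coord (is_derive_id x v).
by apply/funext => y; rewrite mxE.
Qed.

Lemma is_derive_lsubmx_row (V : normedModType R) m1 m2 (f : V -> 'rV[R]_(m1 + m2)) (x v : V) df :
  is_derive x v f df -> is_derive x v (fun y => lsubmx (f y)) (lsubmx df).
Proof.
move=> h; apply: is_derive_rV => i; rewrite mxE.
have [d E] := is_derive_coord (lshift m2 i) h; split.
  by rewrite (_ : (fun y => _) = fun y => f y 0 (lshift m2 i)) //; apply/funext => y; rewrite mxE.
by rewrite -E; congr ('D_v _ x); apply/funext => y; rewrite mxE.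
Qed.

Lemma is_derive_rsubmx_row (V : normedModType R) m1 m2 (f : V -> 'rV[R]_(m1 + m2)) (x v : V) df :
  is_derive x v f df -> is_derive x v (fun y => rsubmx (f y)) (rsubmx df).
Proof.
move=> h; apply: is_derive_rV => i; rewrite (_ : (fun y => _) = fun y => f y 0 (rshift m1 i)).
  by rewrite mxE; exact: is_derive_coord h.
by apply/funext => y; rewrite mxE.
Qed.

Lemma is_derive_row_mx (V : normedModType R) m1 m2 (f : V -> 'rV[R]_m1) (g : V -> 'rV[R]_m2) (x v : V) df dg :
  is_derive x v f df -> is_derive x v g dg ->
  is_derive x v (fun y => row_mx (f y) (g y)) (row_mx df dg).
Proof.
move=> hf hg; apply: is_derive_rV => i; case: (split_ordP i) => j ->.
  rewrite row_mxEl (_ : (fun y => _) = fun y => f y 0 j); first exact: is_derive_coord hf.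
  by apply/funext => y; rewrite row_mxEl.
rewrite row_mxEr (_ : (fun y => _) = fun y => g y 0 j); first exact: is_derive_coord hg.
by apply/funext => y; rewrite row_mxEr.
Qed.

End submx_calculus.

Section ball_profile.
Context {R : realType}.
Variables (rho : R) (N : nat).
Hypothesis rho0 : 0 < rho.

Let t (i : nat) : R := i%:R / N.+1%:R.
Let w (i : nat) (s : R) : R := rho ^+ 2 - s * t i ^+ 2.

Let N0 : 0 < N.+1%:R :> R. Proof. by rewrite ltr0n. Qed.

Let t01 i : (i <= N.+1)%N -> 0 <= t i <= 1.
Proof.
move=> iN; rewrite /t divr_ge0 ?ler0n //= ler_pdivrMr // mul1r ler_nat //.
Qed.

Let w_gt0 i s : (i <= N.+1)%N -> s < rho ^+ 2 -> 0 < w i s.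
Proof.
move=> iN srho; have /andP[t0 t1] := t01 iN; rewrite subr_gt0.
have t2 : 0 <= t i ^+ 2 <= 1 by rewrite exprn_ge0 //= exprn_ile1.
have r2 : 0 < rho ^+ 2 by rewrite exprn_gt0.
by case/andP: t2 => *; have [s0|s0] := leP 0 s; nra.
Qed.

(** Left Riemann sums of the integral h(s) of sqrt (rho^2 - s t^2) over t in
    [0, 1], for which r h(r^2) is the integral of sqrt (rho^2 - x^2) over [0,
    r], a quarter of the area of a disc at r = rho. The sums are as good as
    the integral below, and visibly smooth. *)
Definition disc_profile (s : R) : R :=
  N.+1%:R^-1 * \sum_(0 <= i < N.+1) Num.sqrt (w i s).

Definition disc_profile' (s : R) : R :=
  N.+1%:R^-1 * \sum_(0 <= i < N.+1) (2 * Num.sqrt (w i s))^-1 * (- t i ^+ 2).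

Local Notation U := [set s : R | s < rho ^+ 2].

Let oU : open U. Proof. exact: open_lt. Qed.

Let Ck_sqrt_w k i : (i <= N.+1)%N -> Ck k U (fun s => Num.sqrt (w i s)).
Proof.
move=> iN; apply: (@Ck_comp1 _ _ _ _ [set x : R | 0 < x] Num.sqrt (w i)) => //.
- by move=> s /= srho; exact: w_gt0.
- exact: Ck_sqrt.
apply: eq_Ck (Ck_affine k (- t i ^+ 2) (rho ^+ 2) oU) => // s _.
by rewrite /w mulNr mulrC addrC.
Qed.

Lemma Cinfty_disc_profile : Cinfty U disc_profile.
Proof.
move=> k; apply: (@Ck_scale _ _ _ _ _ (fun s => \sum_(0 <= i < N.+1) Num.sqrt (w i s))) => //.
apply: (@eq_Ck _ _ _ _ _ (fun s => \sum_(i < N.+1) Num.sqrt (w i s))) => // [s _|].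
  by rewrite big_mkord.
by apply: Ck_sum => // i; apply: Ck_sqrt_w; rewrite ltnW.
Qed.

Lemma Cinfty_disc_profile' : Cinfty U disc_profile'.
Proof.
move=> k; apply: (@Ck_scale _ _ _ _ _ (fun s => \sum_(0 <= i < N.+1) (2 * Num.sqrt (w i s))^-1 * (- t i ^+ 2))) => //.
apply: (@eq_Ck _ _ _ _ _ (fun s => \sum_(i < N.+1) (2 * Num.sqrt (w i s))^-1 * (- t i ^+ 2))) => // [s _|].
  by rewrite big_mkord.
apply: Ck_sum => // i; have iN : (i <= N.+1)%N by rewrite ltnW.
apply: (@CkM _ _ _ _ (fun s => (2 * Num.sqrt (w i s))^-1) (cst (- t i ^+ 2))) => //; last exact: Ck_cst.
apply: (@Ck_comp1 _ _ _ _ [set x : R | 0 < x] (fun x => x^-1) (fun s => 2 * Num.sqrt (w i s))) => //.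
- by move=> s /= srho; rewrite mulr_gt0 // sqrtr_gt0 w_gt0.
- by apply: Ck_inv; [exact: open_gt0|move=> x /= x0; rewrite gt_eqF].
by apply: (@Ck_scale _ _ _ _ _ (fun s => Num.sqrt (w i s))) => //; exact: Ck_sqrt_w.
Qed.

Lemma derive_disc_profile s : s < rho ^+ 2 ->
  is_derive s (1 : R) disc_profile (disc_profile' s).
Proof.
move=> srho; apply: is_derive_scale; rewrite !big_mkord.
rewrite (_ : (fun y => _) = fun y => \sum_(i < N.+1) Num.sqrt (w i y)); last first.
  by apply/funext => y; rewrite big_mkord.
apply: is_derive_bigsum => i; have iN : (i <= N.+1)%N by rewrite ltnW.
apply: is_derive_chain1; first by apply: is_derive1_sqrt; exact: w_gt0.
rewrite (_ : w i = fun s => rho ^+ 2 + - (t i ^+ 2 * s)); last first.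
  by apply/funext => s'; rewrite /w mulrC.
rewrite -[X in is_derive _ _ _ X]add0r; apply: is_derive_add.
apply: is_derive_opp; rewrite -[X in is_derive _ _ _ X]mulr1.
exact: is_derive_scale.
Qed.

Lemma disc_profile'_le0 s : s < rho ^+ 2 -> disc_profile' s <= 0.
Proof.
move=> srho; rewrite /disc_profile' pmulr_rle0 ?invr_gt0 // big_mkord.
apply: sumr_le0 => i _; have iN : (i <= N.+1)%N by rewrite ltnW.
rewrite pmulr_rle0; first by rewrite oppr_le0 sqr_ge0.
by rewrite invr_gt0 mulr_gt0 // sqrtr_gt0 w_gt0.
Qed.

(** The left side is the derivative in r of the integral of sqrt (rho^2 - x^2)
    over [0, r], where s = r^2. The Riemann sum that replaces it has a
    decreasing integrand, hence dominates it: each term is at least the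
    increment of t sqrt (rho^2 - s t^2) over its interval. *)
Lemma disc_profile_slope s : 0 <= s < rho ^+ 2 ->
  Num.sqrt (rho ^+ 2 - s) <= disc_profile s + 2 * s * disc_profile' s.
Proof.
move=> /andP[s0 srho].
pose F i := t i * Num.sqrt (w i s).
have tN : t N.+1 = 1 by rewrite /t divff // gt_eqF.
have -> : Num.sqrt (rho ^+ 2 - s) = \sum_(0 <= i < N.+1) (F i.+1 - F i).
  by rewrite telescope_sumr // /F tN /t mul0r mul0r subr0 /w tN expr1n mulr1 mul1r.
rewrite /disc_profile /disc_profile' mulrCA -mulrDr mulr_sumr -big_split /= mulr_sumr.
rewrite !big_mkord; apply: ler_sum => i _; have iN : (i <= N.+1)%N by rewrite ltnW.
have iN1 : (i.+1 <= N.+1)%N by [].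
have w0 := w_gt0 iN srho; have w1 := w_gt0 iN1 srho.
rewrite /F; set a := Num.sqrt (w i s); set b := Num.sqrt (w i.+1 s).
have a0 : 0 < a by rewrite sqrtr_gt0. have b0 : 0 < b by rewrite sqrtr_gt0.
have aE : a ^+ 2 = w i s by rewrite sqr_sqrtr // ltW.
have bE : b ^+ 2 = w i.+1 s by rewrite sqr_sqrtr // ltW.
have /andP[t0 _] := t01 iN.
have tE : t i.+1 = t i + N.+1%:R^-1 by rewrite /t -natr1 mulrDl mul1r.
have d0 : 0 < N.+1%:R^-1 :> R by rewrite invr_gt0.
move: tE d0 t0 aE bE; rewrite /w => ->; move: (t i) (N.+1%:R^-1) => x d d0 x0 aE bE.
have -> : d * (a + 2 * s * ((2 * a)^-1 * (- x ^+ 2))) = d * (a ^+ 2 - s * x ^+ 2) / a.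
  by field; rewrite gt_eqF.
rewrite ler_pdivlMr //.
have ab : a * b <= a ^+ 2 - s * (2 * x * d + d ^+ 2) / 2.
  have := sqr_ge0 (a - b); rewrite sqrrB => h; nra.
have sx : 0 <= s * x by rewrite mulr_ge0.
have sd : 0 <= s * d by rewrite mulr_ge0 // ltW.
have h1 : (x + d) * (a * b) <= (x + d) * (a ^+ 2 - s * (2 * x * d + d ^+ 2) / 2).
  by rewrite ler_wpM2l //; lra.
have h2 : 0 <= s * d * d * x * 3 / 2 + s * d * d * d / 2.
  by rewrite addr_ge0 // divr_ge0 // ?mulr_ge0 // ltW.
nra.
Qed.

Let Phi (x : R) := 2^-1 * (x + sin x * cos x).

Lemma sin_le_id (x : R) : 0 <= x -> sin x <= x.
Proof.
move=> x0; have := @increment_le R sin cos id (cst 1) 0 x x0.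
rewrite sin0 !subr0; apply => u _; exact: cos_le1.
Qed.

(** Phi is a primitive of cos^2. *)
Lemma disc_area_increment (a b : R) : 0 <= a -> a <= b -> b <= pi / 2 ->
  (sin b - sin a) * cos b <= Phi b - Phi a.
Proof.
move=> a0 ab b2.
have dPhi (x : R) : is_derive x (1 : R) Phi (cos x ^+ 2).
  apply: is_derive_eq; have := cos2Dsin2 x; rewrite /GRing.scale /=; lra.
have := @increment_le R (fun x => cos b * sin x) (fun x => cos b * cos x) Phi (fun x => cos x ^+ 2) a b ab.
rewrite -mulrBr mulrC; apply => x /andP[ax xb].
have p0 := pi_gt0 R.
rewrite expr2 ler_wpM2r //; first by apply: cos_ge0_pihalf; lra.
have [->//|xb'] := eqVneq x b.
by rewrite ltW // ltr_cos // ?in_itv /=; [rewrite lt_neqAle xb' xb| |]; lra.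
Qed.

(** The substitution r t = rho sin x turns the left side into a left Riemann
    sum of rho^2 cos^2 x over an interval inside [0, pi/2]. The sum shifted by
    one index is at most the integral, hence at most rho^2 pi/4, and the shift
    costs at most the first term, rho^2/(N+1). *)
Lemma disc_profile_area (r : R) : 0 <= r < rho ->
  r * disc_profile (r ^+ 2) <= rho ^+ 2 * (pi / 4 + N.+1%:R^-1).
Proof.
move=> /andP[r0 rrho]; have p0 := pi_gt0 R.
have r2 : r ^+ 2 < rho ^+ 2 by rewrite ltr_pXn2r ?nnegrE // ltW.
pose th i := asin (r * t i / rho).
have rt i : (i <= N.+1)%N -> 0 <= r * t i / rho < 1.
  move=> iN; have /andP[t0 t1] := t01 iN.
  apply/andP; split; first by apply: divr_ge0; [exact: mulr_ge0|exact: ltW].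
  by rewrite ltr_pdivrMr // mul1r; apply: le_lt_trans rrho; rewrite ler_piMr.
have rti i : (i <= N.+1)%N -> -1 <= r * t i / rho <= 1.
  by move=> /rt /andP[h1 h2]; apply/andP; split; lra.
have sth i : (i <= N.+1)%N -> sin (th i) = r * t i / rho.
  by move=> iN; rewrite asinK // in_itv /=; exact: rti.
have cth i : (i <= N.+1)%N -> rho * cos (th i) = Num.sqrt (w i (r ^+ 2)).
  move=> iN; rewrite cos_asin ?rti //.
  have {1}-> : rho = Num.sqrt (rho ^+ 2) by rewrite sqrtr_sqr gtr0_norm.
  rewrite -sqrtrM ?sqr_ge0 //.
  congr Num.sqrt; rewrite /w; field; by rewrite gt_eqF.
have th2 i : (i <= N.+1)%N -> th i <= pi / 2 by move=> iN; apply: asin_lepi2; exact: rti.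
have thN i : (i <= N.+1)%N -> - (pi / 2) <= th i by move=> iN; apply: asin_geNpi2; exact: rti.
have thmono i : (i < N.+1)%N -> th i <= th i.+1.
  move=> iN; rewrite leNgt; apply/negP => h.
  have := @ltr_sin R (th i.+1) (th i); rewrite !in_itv /= !th2 ?thN // 1?ltnW //= h.
  move=> /(_ isT isT); rewrite !sth // 1?ltnW // => /idP.
  apply/negP; rewrite -leNgt ler_pM2r ?invr_gt0 // ler_wpM2l // /t ler_pM2r ?invr_gt0 // ler_nat //.
have th0 i : (i <= N.+1)%N -> 0 <= th i.
  move=> iN; rewrite leNgt; apply/negP => h.
  have := @ltr_sin R (th i) 0; rewrite !in_itv /= th2 ?thN //= h.
  have -> : (- ((pi : R) / 2) <= 0) && (0 <= (pi : R) / 2) by apply/andP; split; lra.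
  move=> /(_ isT isT); rewrite sin0 sth // => /idP.
  by apply/negP; rewrite -leNgt; have /andP[] := rt i iN.
pose L i := N.+1%:R^-1 * (r * Num.sqrt (w i (r ^+ 2))).
have LE i : (i < N.+1)%N -> L i.+1 <= rho ^+ 2 * (Phi (th i.+1) - Phi (th i)).
  move=> iN; have := disc_area_increment (th0 i (ltnW iN)) (thmono i iN) (th2 i.+1 iN).
  rewrite -(ler_pM2l (exprn_gt0 2 rho0)); apply: le_trans; rewrite le_eqVlt; apply/orP; left; apply/eqP.
  rewrite /L -cth // !sth // 1?ltnW //.
  have -> : t i.+1 = t i + N.+1%:R^-1 by rewrite /t -natr1 mulrDl mul1r.
  by field; rewrite gt_eqF //= addrC natr1 gt_eqF.
have -> : r * disc_profile (r ^+ 2) = \sum_(0 <= i < N.+1) L i.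
  by rewrite /disc_profile mulrCA mulr_sumr mulr_sumr.
have L0 i : 0 <= L i.
  by rewrite /L mulr_ge0 ?invr_ge0 ?(ltW N0) // mulr_ge0 // sqrtr_ge0.
have Lshift : \sum_(0 <= i < N.+1) L i <= L 0%N + \sum_(0 <= i < N.+1) L i.+1.
  rewrite big_nat_recl //= lerD2l [leRHS]big_nat_recr //= lerDl.
  exact: L0.
apply: le_trans Lshift _.
have Lsum : \sum_(0 <= i < N.+1) L i.+1 <= rho ^+ 2 * (Phi (th N.+1) - Phi (th 0%N)).
  rewrite -(telescope_sumr (fun i => Phi (th i))) // mulr_sumr !big_nat.
  by apply: ler_sum => i /andP[_ iN]; exact: LE.
have Ph0 : Phi (th 0%N) = 0.
  have -> : th 0%N = 0.
    rewrite /th /t mul0r mulr0 mul0r -[X in asin X](sin0 R) sinK // in_itv /=.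
    by apply/andP; split; lra.
  by rewrite /Phi sin0 mul0r addr0 mulr0.
have PhN : Phi (th N.+1) <= pi / 4.
  rewrite /Phi; have := th2 _ (leqnn N.+1); have := th0 _ (leqnn N.+1).
  move: (th N.+1) => x x0 x2.
  have c0 : 0 <= cos x by apply: cos_ge0_pihalf; apply/andP; split; lra.
  have h : cos x <= pi / 2 - x.
    have := @sin_le_id (pi / 2 - x); rewrite sinB cos_pihalf sin_pihalf mul1r mul0r subr0.
    by apply; lra.
  have := sin_le1 x; nra.
have LL : L 0%N <= rho ^+ 2 * N.+1%:R^-1.
  rewrite /L /w /t mul0r expr0n /= mulr0 subr0 sqrtr_sqr gtr0_norm // mulrC ler_pM2r ?invr_gt0 //.
  by rewrite expr2 ler_pM2r // ltW.
have r20 : 0 < rho ^+ 2 by rewrite exprn_gt0.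
rewrite Ph0 subr0 in Lsum.
apply: le_trans (lerD LL (le_trans Lsum (ler_wpM2l (ltW r20) PhN))) _.
by rewrite mulrDr addrC.
Qed.

End ball_profile.

(** * Mapping the ball to the cotangent bundle of Euclidean space *)

Section euclidean_pairing.
Context {R : realType} {n : nat}.
Implicit Types u v : 'rV[R]_n.

Lemma pairing_ge0 v : 0 <= pairing v v.
Proof. by apply: sumr_ge0 => i _; rewrite -expr2 sqr_ge0. Qed.

Lemma pairing_eq0 v : pairing v v = 0 -> v = 0.
Proof.
move=> /eqP; rewrite psumr_eq0; last by move=> i _; rewrite -expr2 sqr_ge0.
move=> /allP h; apply/rowP => i; rewrite mxE; apply/eqP.
by have := h i (mem_index_enum _); rewrite /= mulf_eq0 orbb.
Qed.

Lemma pairing_Cauchy u v : pairing u v ^+ 2 <= pairing u u * pairing v v.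
Proof.
have [v0|v0] := eqVneq (pairing v v) 0.
  by rewrite (pairing_eq0 v0) !pairing0r expr0n mulr0.
have vp : 0 < pairing v v by rewrite lt_neqAle eq_sym v0 pairing_ge0.
have := pairing_ge0 (u - (pairing u v / pairing v v) *: v).
rewrite pairingBl !pairingBr !pairingZl !pairingZr (pairingC v u).
have -> : pairing u u - pairing u v / pairing v v * pairing u v -
  (pairing u v / pairing v v * pairing u v - pairing u v / pairing v v * (pairing u v / pairing v v * pairing v v))
  = pairing u u - pairing u v ^+ 2 / pairing v v by field.
by rewrite subr_ge0 ler_pdivrMr.
Qed.

End euclidean_pairing.

Section ball_map.
Context {R : realType} {n : nat}.
Variables (rho : R) (N : nat) (S Si : 'M[R]_n).
Hypotheses (rho0 : 0 < rho) (SSi : S *m Si = 1%:M) (SiS : Si *m S = 1%:M).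
Implicit Types z u v : 'rV[R]_(n + n).

Local Notation h := (disc_profile rho N).
Local Notation h' := (disc_profile' rho N).
Let s z := pairing (rsubmx z) (rsubmx z).
(* The derivative of r h (r^2), i.e. the slope of the radial map along rays. *)
Let kap (r : R) := h r + 2 * r * h' r.

Definition ball_dom : set 'rV[R]_(n + n) := [set z | s z < rho ^+ 2].

Definition ball_base z : 'rV[R]_n := h (s z) *: rsubmx z.

(** The solution P of x = A P, where A is the differential at y of the radial
    map y -> h (|y|^2) y. *)
Definition ball_fibre z : 'rV[R]_n := (h (s z))^-1 *:
  (lsubmx z + (- (2 * h' (s z) * pairing (lsubmx z) (rsubmx z) / kap (s z))) *: rsubmx z).

(** The cotangent lift of the radial map y -> h (|y|^2) y, with (x, y) = z and
    x as the covector at y, followed by the linear change of coordinates given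
    by S. *)
Definition ball_map z : 'rV[R]_(n + n) := row_mx (ball_base z *m Si) (ball_fibre z *m S^T).

Let s_ge0 z : 0 <= s z. Proof. exact: pairing_ge0. Qed.

Let kap_ge z : ball_dom z -> Num.sqrt (rho ^+ 2 - s z) <= kap (s z).
Proof. by move=> Dz; apply: disc_profile_slope => //; rewrite s_ge0. Qed.

Let kap_gt0 z : ball_dom z -> 0 < kap (s z).
Proof. by move=> Dz; apply: lt_le_trans (kap_ge Dz); rewrite sqrtr_gt0 subr_gt0. Qed.

Let h'_le0 z : ball_dom z -> h' (s z) <= 0.
Proof. by move=> Dz; exact: disc_profile'_le0. Qed.

Let kap_le_h z : ball_dom z -> kap (s z) <= h (s z).
Proof.
by move=> Dz; have := h'_le0 Dz; have := s_ge0 z; rewrite /kap; nra.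
Qed.

Let h_gt0 z : ball_dom z -> 0 < h (s z).
Proof. by move=> Dz; apply: lt_le_trans (kap_gt0 Dz) (kap_le_h Dz). Qed.

Let Ck_s k (U : set 'rV[R]_(n + n)) : open U -> Ck k U s.
Proof. by move=> oU; apply: Ck_pairing2 => //; exact: Ck_rsubmx. Qed.

Lemma ball_dom_open : open ball_dom.
Proof.
apply: (@open_comp _ _ s [set r | r < rho ^+ 2]); last exact: open_lt.
by move=> z _; exact: (Ck_s 0 openT).
Qed.

Let Ck_hs k : Ck k ball_dom (fun z => h (s z)).
Proof.
apply: (@Ck_comp1 _ _ _ _ [set r : R | r < rho ^+ 2] h s) => //; first exact: ball_dom_open.
  exact: Cinfty_disc_profile.
exact: Ck_s ball_dom_open.
Qed.

Let Ck_h's k : Ck k ball_dom (fun z => h' (s z)).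
Proof.
apply: (@Ck_comp1 _ _ _ _ [set r : R | r < rho ^+ 2] h' s) => //; first exact: ball_dom_open.
  exact: Cinfty_disc_profile'.
exact: Ck_s ball_dom_open.
Qed.

Let Ck_inv_pos k (f : 'rV[R]_(n + n) -> R) : (forall z, ball_dom z -> 0 < f z) ->
  Ck k ball_dom f -> Ck k ball_dom (fun z => (f z)^-1).
Proof.
move=> f0 hf; apply: (@Ck_comp1 _ _ _ _ [set x : R | 0 < x] (fun x => x^-1) f) => //.
  exact: ball_dom_open.
by apply: Ck_inv; [exact: open_gt0|move=> x /= x0; rewrite gt_eqF].
Qed.

Lemma Ck_ball_base k : Ck k ball_dom ball_base.
Proof.
have oD := ball_dom_open.
by apply: Ck_scalev => //; exact: Ck_rsubmx.
Qed.

Lemma Ck_ball_fibre k : Ck k ball_dom ball_fibre.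
Proof.
have oD := ball_dom_open.
apply: Ck_scalev => //; first by apply: Ck_inv_pos => //; exact: Ck_hs.
apply: CkD => //; first exact: Ck_lsubmx.
apply: Ck_scalev => //; last exact: Ck_rsubmx.
have hk : Ck k ball_dom (fun z => kap (s z)).
  apply: (@CkD _ _ _ _ _ (fun z => h (s z)) (fun z => 2 * s z * h' (s z))) => //.
  apply: (@CkM _ _ _ _ (fun z => 2 * s z) (fun z => h' (s z))) => //.
  by apply: (@Ck_scale _ _ _ _ _ s) => //; exact: Ck_s.
apply: (@eq_Ck _ _ _ _ _ (fun z => -1 * ((2 * h' (s z) * pairing (lsubmx z) (rsubmx z)) * (kap (s z))^-1))) => //.
  by move=> z _; rewrite mulN1r.
apply: (@Ck_scale _ _ _ _ _ (fun z => (2 * h' (s z) * pairing (lsubmx z) (rsubmx z)) * (kap (s z))^-1)) => //.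
apply: (@CkM _ _ _ _ (fun z => 2 * h' (s z) * pairing (lsubmx z) (rsubmx z)) (fun z => (kap (s z))^-1)) => //.
  apply: (@CkM _ _ _ _ (fun z => 2 * h' (s z)) (fun z => pairing (lsubmx z) (rsubmx z))) => //.
    by apply: (@Ck_scale _ _ _ _ _ (fun z => h' (s z))) => //; exact: Ck_h's.
  by apply: Ck_pairing2 => //; [exact: Ck_lsubmx|exact: Ck_rsubmx].
exact: Ck_inv_pos.
Qed.

Lemma Cinfty_ball_map : Cinfty ball_dom ball_map.
Proof.
have oD := ball_dom_open.
move=> k; apply: Ck_row_mx => //; apply: Ck_mulmxr => //.
  exact: Ck_ball_base.
exact: Ck_ball_fibre.
Qed.

(* The differential of the radial map, which is self-adjoint. *)
Let A z (a : 'rV[R]_n) : 'rV[R]_n :=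
  h (s z) *: a + (2 * h' (s z) * pairing (rsubmx z) a) *: rsubmx z.

Lemma ball_fibreE z : ball_dom z -> lsubmx z = A z (ball_fibre z).
Proof.
move=> Dz; have h0 := h_gt0 Dz; have k0 := kap_gt0 Dz.
have yP : pairing (rsubmx z) (ball_fibre z) = pairing (lsubmx z) (rsubmx z) / kap (s z).
  rewrite /ball_fibre pairingZr pairingDr pairingZr -/(s z) (pairingC (rsubmx z)).
  move: k0; rewrite /kap; set k := h _ + _ => k0.
  have kE : h (s z) = k - 2 * s z * h' (s z) by rewrite /k addrK.
  have kn : k != 0 by rewrite gt_eqF.
  have hn : k - 2 * s z * h' (s z) != 0 by rewrite -kE gt_eqF.
  rewrite kE; field; by rewrite kn hn.
rewrite /A yP /ball_fibre scalerA mulfV ?gt_eqF // scale1r -addrA -scalerDl.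
by rewrite (_ : - _ + _ = 0) ?scale0r ?addr0 // mulrA addNr.
Qed.

Lemma pairing_lsubmxA z a : ball_dom z -> pairing (lsubmx z) a = pairing (ball_fibre z) (A z a).
Proof.
move=> Dz; rewrite {1}(ball_fibreE Dz) /A; move: (ball_fibre z) => P.
rewrite pairingDl pairingDr !pairingZl !pairingZr (pairingC P (rsubmx z)); ring.
Qed.

(** The self-adjoint map A has the eigenvalues kap, along y, and h >= kap, so
    that |x| >= kap |P| with kap >= sqrt (rho^2 - |y|^2) > |x|. *)
Lemma ball_fibre_lt1 z : pairing z z < rho ^+ 2 -> ball_dom z /\ pairing (ball_fibre z) (ball_fibre z) < 1.
Proof.
have zE : pairing z z = pairing (lsubmx z) (lsubmx z) + s z.
  by rewrite -{1}(hsubmxK z) pairing_row_mx.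
rewrite zE => zr; have Dz : ball_dom z.
  by have := pairing_ge0 (lsubmx z); rewrite /ball_dom /=; lra.
split=> //; set P := ball_fibre z.
have k0 := kap_gt0 Dz; have kge := kap_ge Dz; have h0 := h_gt0 Dz; have h'0 := h'_le0 Dz.
have rs : 0 < rho ^+ 2 - s z by rewrite subr_gt0.
have k2 : rho ^+ 2 - s z <= kap (s z) ^+ 2.
  rewrite -[leLHS](sqr_sqrtr (ltW rs)) ler_pXn2r ?nnegrE ?sqrtr_ge0 ?(ltW k0) //.
have CS := pairing_Cauchy (rsubmx z) P; rewrite -/(s z) in CS.
have lE : pairing (lsubmx z) (lsubmx z) = h (s z) ^+ 2 * pairing P P
    + 4 * h' (s z) * (h (s z) + h' (s z) * s z) * pairing (rsubmx z) P ^+ 2.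
  rewrite {1 2}(ball_fibreE Dz) -/P /A; clearbody P; rewrite !(pairingDl, pairingDr, pairingZl, pairingZr) -/(s z).
  rewrite (pairingC P (rsubmx z)); ring.
have hh : 0 <= h (s z) + h' (s z) * s z.
  by move: k0; rewrite /kap; have := s_ge0 z; nra.
have lge : kap (s z) ^+ 2 * pairing P P <= pairing (lsubmx z) (lsubmx z).
  rewrite lE /kap; set p := pairing P P in CS *; set q := pairing (rsubmx z) P ^+ 2 in CS *.
  have : 0 <= (- h' (s z)) * (h (s z) + h' (s z) * s z) * (s z * p - q).
    by rewrite !mulr_ge0 // ?oppr_ge0 // subr_ge0.
  move: (h (s z)) (h' (s z)) (s z) => x y r; nra.
have : kap (s z) ^+ 2 * pairing P P < kap (s z) ^+ 2 by apply: le_lt_trans lge _; lra.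
by rewrite -[ltRHS]mulr1 ltr_pM2l // exprn_gt0.
Qed.

Lemma ball_base_bound z : ball_dom z ->
  pairing (ball_base z) (ball_base z) <= (rho ^+ 2 * (pi / 4 + N.+1%:R^-1)) ^+ 2.
Proof.
move=> Dz; rewrite /ball_base pairingZl pairingZr -/(s z).
have -> : h (s z) * (h (s z) * s z) = (Num.sqrt (s z) * h (Num.sqrt (s z) ^+ 2)) ^+ 2.
  by rewrite exprMn sqr_sqrtr //; ring.
have r0 : 0 <= Num.sqrt (s z) < rho.
  rewrite sqrtr_ge0 /= -(ger0_norm (ltW rho0)) -sqrtr_sqr ltr_sqrt //.
  by rewrite exprn_gt0.
have := disc_profile_area N rho0 r0; rewrite ler_pXn2r // nnegrE.
  by rewrite mulr_ge0 ?sqrtr_ge0 // sqr_sqrtr // ltW // h_gt0.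
by rewrite mulr_ge0 ?sqr_ge0 // addr_ge0 ?divr_ge0 ?pi_ge0 ?invr_ge0 ?ler0n.
Qed.

(** The radial map is injective because r h (r^2) increases; then P determines
    x. *)
Lemma ball_map_inj : {in ball_dom &, injective ball_map}.
Proof.
have mono (r1 r2 : R) : 0 <= r1 -> r1 < r2 -> r2 < rho ^+ 2 -> r1 * h r1 ^+ 2 < r2 * h r2 ^+ 2.
  move=> r1p r12 r2p.
  have D x : 0 <= x -> x < rho ^+ 2 -> is_derive x 1 (fun x : R => x * h x ^+ 2) (h x * kap x).
    move=> x0 xr; have dx := derive_disc_profile N rho0 xr.
    have [Dx E] := is_derive_mul (is_derive_id x (1 : R)) (is_derive_pow 2 dx).
    apply: DeriveDef; first exact: Dx.
    apply: etrans E _.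
    by rewrite /kap /=; ring.
  have D1 x : x \in `]r1, r2[ -> is_derive x 1 (fun x : R => x * h x ^+ 2) (h x * kap x).
    by rewrite in_itv /= => /andP[r1x xr2]; apply: D; lra.
  have C : {within `[r1, r2], continuous (fun x : R => x * h x ^+ 2)}.
    apply: derivable_within_continuous => x; rewrite in_itv /= => /andP[r1x xr2].
    by have [] : is_derive x 1 (fun x : R => x * h x ^+ 2) (h x * kap x) by apply: D; lra.
  have [c] := MVT r12 D1 C.
  rewrite in_itv /= => /andP[r1c cr2] E; rewrite -subr_gt0 E mulr_gt0 ?subr_gt0 //.
  have c0 : 0 <= c < rho ^+ 2 by apply/andP; split; lra.
  have kc := disc_profile_slope N rho0 c0.
  have kp : 0 < kap c.
    by apply: lt_le_trans kc; rewrite sqrtr_gt0 subr_gt0; case/andP: c0.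
  have h'c : h' c <= 0 by apply: disc_profile'_le0 => //; case/andP: c0.
  rewrite mulr_gt0 //; apply: lt_le_trans kp _; rewrite /kap.
  by case/andP: c0; nra.
move=> z z'; rewrite !inE => Dz Dz' /eq_row_mx[].
move=> /(congr1 (mulmx^~ S)); rewrite -!mulmxA SiS !mulmx1 => eQ eP.
have {}eP : ball_fibre z = ball_fibre z'.
  move: eP => /(congr1 (mulmx^~ Si^T)); rewrite -!mulmxA -trmx_mul SiS trmx1 !mulmx1 //.
have es : s z = s z'.
  have : s z * h (s z) ^+ 2 = s z' * h (s z') ^+ 2.
    have := congr1 (fun v : 'rV[R]_n => pairing v v) eQ; rewrite /ball_base /= !pairingZl !pairingZr -!/(s _).
    by move=> e; rewrite expr2 mulrC -mulrA e; ring.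
  have [l|l|//] := ltgtP (s z) (s z') => e.
    by have := mono _ _ (s_ge0 z) l Dz'; rewrite e ltxx.
  by have := mono _ _ (s_ge0 z') l Dz; rewrite e ltxx.
have ey : rsubmx z = rsubmx z'.
  move: eQ; rewrite /ball_base es => /(congr1 (fun v : 'rV[R]_n => (h (s z'))^-1 *: v)).
  by rewrite !scalerA mulVf ?scale1r // gt_eqF // h_gt0.
rewrite -(hsubmxK z) -(hsubmxK z') ey; congr row_mx.
by rewrite (ball_fibreE Dz) (ball_fibreE Dz') /A eP es ey.
Qed.

(** Differentiating the relation x . a = P . A a expresses dP . A a; after
    antisymmetrization, the terms coming from the derivative of A cancel,
    because A is the differential of a map and its own derivative is
    symmetric. *)
Lemma ball_map_symplectic z u v : ball_dom z ->
  form_eval (canonical_mx R n) ('D_u ball_map z) ('D_v ball_map z) =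
  form_eval (standard_mx R n) u v.
Proof.
move=> Dz.
have dP w : is_derive z w ball_fibre ('D_w ball_fibre z).
  by apply/derivableP/diff_derivable; have [+ _] := Ck_ball_fibre 1; apply.
have dQ w : is_derive z w ball_base ('D_w ball_base z).
  by apply/derivableP/diff_derivable; have [+ _] := Ck_ball_base 1; apply.
have dG w : 'D_w ball_map z = row_mx ('D_w ball_base z *m Si) ('D_w ball_fibre z *m S^T).
  by have [_ ->] := is_derive_row_mx (is_derive_mulmxr Si (dQ w)) (is_derive_mulmxr S^T (dP w)).
have e a b : pairing (a *m S^T) (b *m Si) = pairing a b.
  by rewrite pairing_mulmxr trmxK -mulmxA SiS mulmx1.
have row_form (b1 b2 a1 a2 : 'rV[R]_n) (w1 w2 : 'rV[R]_(n + n)) :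
    w1 = row_mx (b1 *m Si) (a1 *m S^T) -> w2 = row_mx (b2 *m Si) (a2 *m S^T) ->
    form_eval (canonical_mx R n) w1 w2 = pairing a1 b2 - pairing a2 b1.
  by move=> -> ->; rewrite canonical_formE !row_mxKl !row_mxKr e (pairingC (b1 *m Si)) e.
apply: etrans (row_form _ _ _ _ _ _ (dG u) (dG v)) _.
rewrite standard_formE.
have ds w : is_derive z w s (2 * pairing (rsubmx z) (rsubmx w)).
  apply: is_derive_eq; first exact: is_derive_pairing2 (is_derive_rsubmx z w) (is_derive_rsubmx z w).
  by rewrite (pairingC (rsubmx w)); ring.
have diffs : differentiable s z by have [+ _] := Ck_s 1 openT; apply.
have dhs w : is_derive z w (fun z => h (s z)) (h' (s z) * (2 * pairing (rsubmx z) (rsubmx w))).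
  by apply: is_derive_chain (ds w) => //; exact: derive_disc_profile.
have dh : differentiable h' (s z) by have [+ _] := Cinfty_disc_profile' N rho0 1%N; apply.
pose h2 := derive1 h' (s z).
have dh's w : is_derive z w (fun z => h' (s z)) (h2 * (2 * pairing (rsubmx z) (rsubmx w))).
  apply: is_derive_chain (ds w) => //; rewrite /h2 derive1E.
  exact/derivableP/derivable1_diffP.
have QA w : 'D_w ball_base z = A z (rsubmx w).
  have [_ ->] := is_derive_scalev (dhs w) (is_derive_rsubmx z w).
  by rewrite /A addrC; congr (_ + _ *: _); ring.
pose B (w : 'rV[R]_(n + n)) (a : 'rV[R]_n) := (h' (s z) * (2 * pairing (rsubmx z) (rsubmx w))) *: a
  + ((2 * (h2 * (2 * pairing (rsubmx z) (rsubmx w))) * pairing (rsubmx z) a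
     + 2 * h' (s z) * pairing (rsubmx w) a) *: rsubmx z
     + (2 * h' (s z) * pairing (rsubmx z) a) *: rsubmx w).
have dA w a : is_derive z w (fun z => A z a) (B w a).
  have dya : is_derive z w (fun z => pairing (rsubmx z) a) (pairing a (rsubmx w)).
    rewrite (_ : (fun z => _) = fun z => pairing a (rsubmx z)); last by apply/funext => z'; rewrite pairingC.
    exact: is_derive_pairing (is_derive_rsubmx z w).
  have dc := is_derive_mul (is_derive_scale 2 (dh's w)) dya.
  have [D E] := is_derive_add (is_derive_scalev (dhs w) (is_derive_cst a z w))
    (is_derive_scalev dc (is_derive_rsubmx z w)).
  apply: DeriveDef; first exact: D.
  apply: etrans E _.
  rewrite /B scaler0 addr0 /=; congr (_ + (_ *: _ + _)).
  by rewrite !(pairingC a); ring.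
have key w a : pairing ('D_w ball_fibre z) (A z a) = pairing (lsubmx w) a - pairing (ball_fibre z) (B w a).
  have E : \forall z' \near z, pairing a (lsubmx z') = pairing (ball_fibre z') (A z' a).
    apply: filterS (open_nbhs_nbhs (conj ball_dom_open Dz)) => z' Dz'.
    by rewrite pairingC pairing_lsubmxA.
  have := near_eq_derive w E.
  have [_ ->] := is_derive_pairing a (is_derive_lsubmx z w).
  have [_ ->] := is_derive_pairing2 (dP w) (dA w a).
  by rewrite (pairingC a) => ->; rewrite addrK.
have QK w w' : pairing ('D_w ball_fibre z) ('D_w' ball_base z) =
    pairing (lsubmx w) (rsubmx w') - pairing (ball_fibre z) (B w (rsubmx w')).
  by rewrite -key; exact: (congr1 (pairing _) (QA w')).
apply: etrans (congr2 (fun x y : R => x - y) (QK u v) (QK v u)) _.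
move: (ball_fibre z) => P.
rewrite /B !(pairingDr, pairingZr) (pairingC (rsubmx v) (rsubmx u)) (pairingC (rsubmx u) (lsubmx v)).
rewrite (pairingC (rsubmx z) (rsubmx v)) (pairingC (rsubmx z) (rsubmx u)).
ring.
Qed.

End ball_map.

(** * The lower bound when a flat metric has the same systole *)

Section ball_embedding.
Context {R : realType} {n : nat}.

(** Elimination of the first coordinate: the Schur complement of the first
    entry is again positive definite. *)
Lemma cholesky m (g : 'M[R]_m) : g^T = g -> (forall v, v != 0 -> 0 < form_eval g v v) ->
  exists S : 'M[R]_m, S \in unitmx /\ g = S *m S^T.
Proof.
elim: m g => [|m IH] g gT gp.
  by exists 1%:M; split; [exact: unitmx1|apply/matrixP => -[]].
pose g' : 'M[R]_(1 + m) := g; pose a := g' 0 0; pose b : 'rV[R]_m := ursubmx g'.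
pose d : 'M[R]_m := drsubmx g'.
have g'T : g'^T = g' by [].
have gp' (w : 'rV[R]_(1 + m)) : w != 0 -> 0 < form_eval g' w w by exact: gp.
have g'E : g' = block_mx a%:M b b^T d.
  rewrite -[LHS]submxK; congr block_mx.
    by apply/matrixP => i j; rewrite !ord1 !mxE eqxx mulr1n; congr (g' _ _); exact/val_inj.
  by rewrite /b -[in RHS]g'T trmx_ursub trmxK.
have dT : d^T = d by rewrite /d -[in RHS]g'T trmx_drsub.
have a0 : 0 < a.
  have e0 : delta_mx 0 0 != 0 :> 'rV[R]_m.+1.
    by apply/eqP => /matrixP/(_ 0 0); rewrite !mxE eqxx => /eqP; rewrite oner_eq0.
  by have := gp _ e0; rewrite /form_eval -rowE trmx_delta -colE !mxE.
have aN : a != 0 by rewrite gt_eqF.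
pose d' := d - a^-1 *: (b^T *m b).
have [||S' [S'u d'E]] := IH d'.
- by rewrite /d' linearB linearZ /= trmx_mul trmxK dT.
- move=> v v0; have w0 : row_mx (- a^-1 *: (v *m b^T)) v != 0 :> 'rV[R]_(1 + m).
    apply: contra v0 => /eqP h; apply/eqP.
    by rewrite -(row_mxKr (- a^-1 *: (v *m b^T)) v) h linear0.
  have := gp' _ w0; rewrite /form_eval g'E mul_row_block tr_row_mx mul_row_col.
  rewrite mul_mx_scalar scalerA mulrN mulfV // scaleN1r addNr mul0mx add0r.
  by rewrite -!scalemxAl -mulmxA mulmxDl -scalemxAl -mulmxA scaleNr addrC /d' mulmxBr mulmxBl
    -scalemxAr -scalemxAl !mulmxA.
have sa : Num.sqrt a * Num.sqrt a = a by rewrite -expr2 sqr_sqrtr // ltW.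
have sN : Num.sqrt a != 0 by rewrite gt_eqF // sqrtr_gt0.
pose L : 'M[R]_(1 + m) := block_mx (Num.sqrt a)%:M 0 ((Num.sqrt a)^-1 *: b^T) S'.
have Lu : L \in unitmx.
  rewrite unitmxE det_lblock det_scalar expr1 unitrM -unitmxE S'u andbT.
  by rewrite unitfE.
exists L; split=> //; suff : g' = L *m L^T by [].
rewrite g'E tr_block_mx mulmx_block !tr_scalar_mx trmx0 !mulmx0 !mul0mx !addr0.
congr block_mx.
- by rewrite -scalar_mxM sa.
- by rewrite linearZ /= trmxK mul_scalar_mx scalerA mulfV // scale1r.
- by rewrite mul_mx_scalar scalerA mulfV // scale1r.
- rewrite linearZ /= trmxK -scalemxAl -scalemxAr scalerA -invfM sa -d'E /d'.
  by rewrite addrC subrK.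
Qed.

Lemma sum_sqr_modulus (z : 'rV[R]_(n + n)) : \sum_j sqr_modulus z j = pairing z z.
Proof.
rewrite -[in RHS](hsubmxK z) pairing_row_mx row_mxKl row_mxKr.
rewrite -big_split /=; apply: eq_bigr => j _; by rewrite /sqr_modulus !mxE !expr2.
Qed.

Lemma ball_setE r (z : 'rV[R]_(n + n)) : ball_set r z <-> pairing z z < r ^+ 2.
Proof. by rewrite /ball_set /= sum_sqr_modulus. Qed.

Variables (rho : R) (N : nat) (S Si : 'M[R]_n) (r : R).
Hypotheses (rho0 : 0 < rho) (SSi : S *m Si = 1%:M) (SiS : Si *m S = 1%:M).
Hypotheses (r0 : 0 < r) (r_rho : r < rho).
Hypothesis shortest : forall k : 'rV[int]_n, k != 0 ->
  (2 * (rho ^+ 2 * (pi / 4 + N.+1%:R^-1))) ^+ 2 < pairing (intv k *m S) (intv k *m S).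
Variables (F : torus R n * 'rV[R]_n -> R) (hF : finsler F) (f : 'rV[R]_n -> R).
Hypotheses (hf : flat_norm f) (FE : forall q v, F (q, v) = f v).
Hypothesis f_ge : forall v, Num.sqrt (pairing (v *m S) (v *m S)) <= f v.

Local Notation dom := (@ball_dom R n rho).
Local Notation bm := (ball_map rho N S Si).

Let ball_rho (z : 'rV[R]_(n + n)) : pairing z z <= r ^+ 2 -> pairing z z < rho ^+ 2.
Proof. by move=> h; apply: le_lt_trans h _; rewrite ltr_pXn2r ?nnegrE ?ltW // (lt_trans r0). Qed.

Lemma ball_map_disc_bundle z : pairing z z < rho ^+ 2 -> disc_bundle F (torus_bundle_proj (bm z)).
Proof.
move=> /(ball_fibre_lt1 N rho0)[Dz P1]; apply/(disc_bundle_flat _ hF hf FE) => v v0.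
rewrite /= row_mxKr; apply: lt_le_trans (f_ge v).
have vS0 : 0 < pairing (v *m S) (v *m S).
  rewrite lt_neqAle pairing_ge0 andbT eq_sym; apply: contra v0 => /eqP/pairing_eq0 h.
  by rewrite -(mulmx1 v) -SSi mulmxA h mul0mx.
rewrite pairing_mulmxr trmxK.
have [h|h] := ltP (pairing (ball_fibre rho N z) (v *m S)) 0.
  by apply: lt_le_trans h _; rewrite sqrtr_ge0.
rewrite -[ltLHS](ger0_norm h) -sqrtr_sqr ltr_sqrt //.
apply: le_lt_trans (pairing_Cauchy _ _) _.
by rewrite -[ltRHS]mul1r ltr_pM2r.
Qed.

(** By the parallelogram identity, two points of norm at most q, for q the
    radius in ball_base_bound, are at distance at most 2 q, which is less than
    the norm of any nonzero lattice vector. *)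
Lemma torus_ball_map_inj z z' : dom z -> dom z' ->
  torus_bundle_proj (bm z) = torus_bundle_proj (bm z') -> z = z'.
Proof.
move=> Dz Dz' [/torus_proj_int[k e1] e2]; suff : bm z = bm z' by exact: (ball_map_inj rho0 SiS (mem_set Dz) (mem_set Dz')).
rewrite -(hsubmxK (bm z)) -(hsubmxK (bm z')) e2; congr row_mx.
have [k0|k0] := eqVneq k 0.
  by rewrite e1 k0 /intv map_mx0 addr0.
have b := ball_base_bound N rho0 Dz; have b' := ball_base_bound N rho0 Dz'.
have := shortest k0; have -> : intv k *m S = ball_base rho N z - ball_base rho N z'.
  move: e1; rewrite !row_mxKl => /(congr1 (fun v : 'rV[R]_n => v *m S)).
  by rewrite mulmxDl -!mulmxA SiS !mulmx1 => ->; rewrite addrC addKr.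
have := pairing_ge0 (ball_base rho N z + ball_base rho N z').
move: (ball_base rho N z) (ball_base rho N z') b b' => Q Q'.
rewrite !(pairingBl, pairingBr, pairingDl, pairingDr) (pairingC Q' Q).
set X := rho ^+ 2 * _; move: X => X b b'; rewrite (_ : (2 * X) ^+ 2 = 4 * X ^+ 2); last by ring.
by clear e1 e2; move=> c c'; exfalso; lra.
Qed.

(** A local representation is the map ball_map translated by an integer
    vector; the closed ball of radius r is the compact set that controls the
    topology of the image. *)
Lemma symplectic_ball_embedding :
  exists phi : @symplectic_ball R n r -> disc_cotangent_bundle hF, symplectic_embedding phi.
Proof.
pose K := [set z : 'rV[R]_(n + n) | pairing z z <= r ^+ 2].
have KD z : K z -> dom z by move=> Kz; have [] := ball_fibre_lt1 N rho0 (ball_rho Kz).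
have cpair : continuous (fun z : 'rV[R]_(n + n) => pairing z z).
  rewrite (_ : (fun z => _) = fun z => \sum_j sqr_modulus z j).
    by apply: sum_continuous => j; exact: sqr_modulus_continuous.
  by apply/funext => z; rewrite sum_sqr_modulus.
have cK : compact K.
  apply: bounded_closed_compact.
    exists r; split; first exact: num_real.
    move=> M rM z Kz /=; apply: norm_le_coord; first by rewrite ltW // (lt_trans r0).
    move=> i; apply: le_trans (ltW rM).
    rewrite -(ger0_norm (ltW r0)) -ler_sqr ?nnegrE ?normr_ge0 // !real_normK ?num_real //.
    apply: le_trans Kz; rewrite /pairing (bigD1 i) //= expr2 ler_wpDr //.
    by apply: sumr_ge0 => j _; rewrite -expr2 sqr_ge0.
  rewrite (_ : K = (fun z : 'rV[R]_(n + n) => pairing z z) @^-1` [set x | x <= r ^+ 2]) //.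
  by apply: preimage_closed; [move=> *; exact: cpair|exact: closed_le].
have OK : ball_set r `<=` K by move=> z /ball_setE /ltW.
have cbm z : dom z -> {for z, continuous bm}.
  by move=> Dz; exact: (Cinfty_ball_map N S Si rho0 0%N).
have cF z : dom z -> {for z, continuous (@torus_bundle_proj R n \o bm : 'rV[R]_(n + n) -> torus_bundle R n)}.
  move=> Dz; apply: continuous_comp; first exact: cbm.
  exact: torus_bundle_proj_continuous.
have dv (z : @symplectic_ball R n r) : pairing (set_val z) (set_val z) < rho ^+ 2.
  by apply/ball_rho/ltW/ball_setE; exact: set_valP.
have DD z : pairing z z < rho ^+ 2 -> disc_bundle F (torus_bundle_proj (bm z)).
  exact: ball_map_disc_bundle.
pose phi (z : @symplectic_ball R n r) : disc_cotangent_bundle hF :=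
  exist _ (torus_bundle_proj (bm (set_val z))) (mem_set (DD _ (dv z))).
have dz (z : @symplectic_ball R n r) : dom (set_val z) by have [] := ball_fibre_lt1 N rho0 (dv z).
exists phi.
have [inj opn] : injective phi /\ forall A : set (@symplectic_ball R n r), open A ->
    exists2 B : set (disc_cotangent_bundle hF), open B & phi @` A = B `&` range phi.
  apply: (@compact_embedding _ (torus_bundle R n) (ball_set r) K (disc_bundle F) (@torus_bundle_proj R n \o bm)) => //.
  - exact: torus_bundle_hausdorff.
  - by apply: continuous_in_subspaceT => z; rewrite inE => /KD; exact: cF.
  - by move=> z z'; rewrite !inE => /KD Dz /KD Dz'; exact: torus_ball_map_inj.
apply: symplectic_embedding_local => //.
- apply: continuous_comp_initial => z.
  apply: (@continuous_comp _ _ _ (@set_val _ (ball_set r)) (@torus_bundle_proj R n \o bm)); first exact: initial_continuous.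
  exact: cF.
- move=> i a z iz [x ax xE].
  have [k kE] := (torus_proj_int _ _).1 xE.
  pose kap := row_mx (intv k) 0 : 'rV[R]_(n + n).
  pose U := [set z | dom z /\ ball a 2^-1 (lsubmx (bm z + kap))].
  have lk w : lsubmx (w + kap) = lsubmx w + intv k by rewrite linearD /= row_mxKl.
  have rk (w : 'rV[R]_(n + n)) : rsubmx (w + kap) = rsubmx w by rewrite linearD /= row_mxKr addr0.
  have CG : Cinfty dom (fun w => bm w + kap).
    move=> l; apply: CkD; [exact: ball_dom_open|exact: Cinfty_ball_map|exact: Ck_cst].
  have oU : open U.
    rewrite openE => w [Dw aw].
    have c1 : {for w, continuous (fun w => lsubmx (bm w + kap))}.
      apply: (@continuous_comp _ _ _ (fun w => bm w + kap) (@lsubmx R 1 n n)); last exact: continuous_lsubmx.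
      exact: (CG 0%N).
    apply: filterS2 (open_nbhs_nbhs (conj (@ball_dom_open R n rho) Dw)) (c1 _ (open_nbhs_nbhs (conj (ball_open _ _) aw))).
    by move=> y Dy ay; split.
  exists (fun w => bm w + kap), U; split => //.
  + split; first exact: dz.
    by rewrite lk /= -kE.
  + by move=> l; apply: CkS (CG l) => w [].
  + move=> q iq [x' ax' x'E] [Dq aq]; rewrite /= -(hsubmxK (bm _ + kap)); congr row_mx.
      rewrite -[RHS](torus_liftE aq); congr (torus_lift a _); apply/torus_proj_int.
      by exists (- k); rewrite lk /intv map_mxN addrK.
    by rewrite rk.
  + have dE w : 'D_w (fun y => bm y + kap) (set_val z) = 'D_w bm (set_val z).
      have dw : derivable bm (set_val z) w.
        by apply: diff_derivable; have [+ _] := Cinfty_ball_map N S Si rho0 1%N; apply; exact: dz.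
      have [_ ->] := is_derive_add (derivableP dw) (is_derive_cst kap (set_val z) w).
      by rewrite addr0.
    move=> u v.
    apply: etrans (congr2 (form_eval (canonical_mx R n)) (dE u) (dE v)) _.
    exact: (ball_map_symplectic N rho0 SiS u v (dz z)).
Qed.

End ball_embedding.

Section metric_case.
Context {R : realType} {n : nat}.
Implicit Types F G : torus R n * 'rV[R]_n -> R.

(** As rho^2 (pi/4 + 1/(N+1)) tends to pi r^2/4 < l/2 when rho tends to r and
    N to infinity, suitable rho and N make the image of the radial map lie in
    a ball of radius less than l/2, half of the shortest lattice vector. *)
Lemma ball_in_disc_bundle F (hF : finsler F) f (g : 'M[R]_n) (l r : R) :
  flat_norm f -> (forall q v, F (q, v) = f v) ->
  g^T = g -> (forall v, v != 0 -> 0 < form_eval g v v) ->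
  (forall v, Num.sqrt (form_eval g v v) <= f v) ->
  0 < l -> (forall k : 'rV[int]_n, k != 0 -> l <= Num.sqrt (form_eval g (intv k) (intv k))) ->
  0 < r -> pi * r ^+ 2 < 2 * l ->
  exists phi : @symplectic_ball R n r -> disc_cotangent_bundle hF, symplectic_embedding phi.
Proof.
move=> hf FE gT gp gf l0 lg r0 rl.
have [S [Su gE]] := cholesky gT gp.
have pi0 := pi_gt0 R.
have gS v : form_eval g v v = pairing (v *m S) (v *m S).
  by rewrite /form_eval gE pairing_mulmx trmx_mul !mulmxA.
pose rho := Num.sqrt ((r ^+ 2 + 2 * l / pi) / 2).
have rl' : r ^+ 2 < 2 * l / pi by rewrite ltr_pdivlMr // mulrC.
have r20 : 0 < r ^+ 2 by rewrite exprn_gt0.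
have rhoE : rho ^+ 2 = (r ^+ 2 + 2 * l / pi) / 2 by rewrite sqr_sqrtr //; lra.
have rho0 : 0 < rho by rewrite sqrtr_gt0; lra.
have rrho : r < rho by rewrite -ltr_sqr ?nnegrE ?ltW // rhoE; lra.
have rhol : pi * rho ^+ 2 < 2 * l by rewrite mulrC -ltr_pdivlMr // rhoE; lra.
pose e := (l - pi * rho ^+ 2 / 2) / (2 * rho ^+ 2).
have rho20 : 0 < rho ^+ 2 by rewrite exprn_gt0.
have e0 : 0 < e by rewrite divr_gt0 //; lra.
pose N := Num.truncn e^-1.
have Ne : N.+1%:R^-1 < e.
  by rewrite -[ltRHS]invrK ltf_pV2 ?posrE ?invr_gt0 ?ltr0Sn // truncnS_gt.
apply: (@symplectic_ball_embedding R n rho N S (invmx S) r rho0 (mulmxV Su) (mulVmx Su) r0 rrho _ F hF f hf FE).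
  move=> k k0; rewrite -gS.
  have gk : 0 <= form_eval g (intv k) (intv k) by rewrite gS pairing_ge0.
  rewrite -[ltRHS](sqr_sqrtr gk).
  have q0 : 0 <= 2 * (rho ^+ 2 * (pi / 4 + N.+1%:R^-1)).
    by rewrite mulr_ge0 // mulr_ge0 ?ltW // addr_gt0 ?invr_gt0 ?ltr0Sn // divr_gt0.
  rewrite ltr_pXn2r ?nnegrE ?sqrtr_ge0 //; apply: lt_le_trans (lg k k0).
  have : rho ^+ 2 * N.+1%:R^-1 < rho ^+ 2 * e by rewrite ltr_pM2l.
  have -> : rho ^+ 2 * e = (l - pi * rho ^+ 2 / 2) / 2 by rewrite /e; field; rewrite gt_eqF.
  by rewrite mulrDr; move: (rho ^+ 2 * N.+1%:R^-1) => x; lra.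
by move=> v; rewrite -gS.
Qed.

(** Balls of capacity arbitrarily close to 2 l embed. *)
Lemma capacity_ge_of_metric F (hF : finsler F) f (g : 'M[R]_n) (l : R)
    (c : symplectic_manifold R (n + n) -> \bar R) :
  flat_norm f -> (forall q v, F (q, v) = f v) ->
  g^T = g -> (forall v, v != 0 -> 0 < form_eval g v v) ->
  (forall v, Num.sqrt (form_eval g v v) <= f v) ->
  0 < l -> (forall k : 'rV[int]_n, k != 0 -> l <= Num.sqrt (form_eval g (intv k) (intv k))) ->
  symplectic_capacity c -> ((2 * l)%:E <= c (disc_cotangent_bundle hF))%E.
Proof.
move=> hf FE gT gp gf l0 lg hc; rewrite leNgt; apply/negP.
have := capacity_ge0 hc (disc_cotangent_bundle hF).
case E : (c _) => [x| |] //; rewrite lee_fin lte_fin => x0 xl.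
pose r := Num.sqrt ((x + 2 * l) / 2 / pi).
have pi0 := pi_gt0 R.
have p0 : 0 < (x + 2 * l) / 2 / pi by rewrite divr_gt0 //; lra.
have r0 : 0 < r by rewrite sqrtr_gt0.
have rE : pi * r ^+ 2 = (x + 2 * l) / 2.
  by rewrite sqr_sqrtr ?ltW // mulrC divfK // gt_eqF.
have rl : pi * r ^+ 2 < 2 * l by rewrite rE; lra.
have [phi hphi] := ball_in_disc_bundle hF hf FE gT gp gf l0 lg r0 rl.
have := capacity_embedding hc hphi.
by rewrite capacity_ball // E lee_fin rE; lra.
Qed.

(** The systole of G is the length of a shortest integer vector for the
    metric, and F >= G makes the norm f dominate the metric. *)
Lemma capacity_ge_case_metric F (hF : finsler F) f
    (c : symplectic_manifold R (n + n) -> \bar R) :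
  (0 < n)%N -> flat_norm f -> (forall q v, F (q, v) = f v) -> symplectic_capacity c ->
  (exists G, [/\ finsler G, induced_by_flat_metric G, forall z, G z <= F z & systole F = systole G]) ->
  ((2 * systole F)%:E <= c (disc_cotangent_bundle hF))%E.
Proof.
move=> n0 hf FE hc [G [hG [g [gT gp GE]] GF ->]].
have [|q v|f' hf' FE'] := flat_finsler_norm hG.
- by exists (fun v => Num.sqrt (form_eval g v v)).
- rewrite !GE /form_eval linearN /= mulmxN -!mulNmx opprK //.
have gf' v : f' v = Num.sqrt (form_eval g v v) by rewrite -(FE' (torus_proj 0)) GE.
have [k [k0 kmin]] := shortest_int_vector hf' n0.
rewrite (systole_flat hf' FE' k0 kmin).
apply: (capacity_ge_of_metric hF hf FE gT gp) => //.
- by move=> v; rewrite -(GE (torus_proj 0)) -(FE (torus_proj 0)).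
- by apply: fn_pos => //; rewrite intv_eq0.
- by move=> k' k'0; rewrite -gf'; exact: kmin.
Qed.

End metric_case.

(** * Power sums of linear forms and short orbits *)

Section power_sums.
Context {R : realType} {n m : nat}.
Implicit Types (w : 'I_m -> 'rV[R]_n) (x u : 'rV[R]_n).

Definition psum k w x : R := \sum_i pairing (w i) x ^+ k.

Definition abs_psum k w x : R := \sum_i `|pairing (w i) x| ^+ k.

(** The gradient of psum k.+1. *)
Definition psum_grad k w x : 'rV[R]_n := \sum_i (k.+1%:R * pairing (w i) x ^+ k) *: w i.

Lemma pairing_psum_grad k w x u :
  pairing (psum_grad k w x) u = \sum_i k.+1%:R * pairing (w i) x ^+ k * pairing (w i) u.
Proof.
rewrite /psum_grad pairingC pairing_sumr; apply: eq_bigr => i _.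
by rewrite pairingZr (pairingC u).
Qed.

Lemma is_derive_psum k w (V : normedModType R) (f : V -> 'rV[R]_n) (t v : V) df :
  is_derive t v f df ->
  is_derive t v (fun s => psum k.+1 w (f s)) (pairing (psum_grad k w (f t)) df).
Proof.
move=> h; rewrite pairing_psum_grad; apply: is_derive_bigsum => i.
exact: is_derive_pow (is_derive_pairing (w i) h).
Qed.

Lemma Ck_psum (V : normedModType R) l k w (U : set V) (f : V -> 'rV[R]_n) : open U ->
  Ck l U f -> Ck l U (fun s => psum k w (f s)).
Proof.
move=> oU hf; apply: Ck_sum => // i; apply: CkX => //.
by apply: Ck_pairing2 => //; exact: Ck_cst.
Qed.

Lemma pairing_psum_grad_id k w x : pairing (psum_grad k w x) x = k.+1%:R * psum k.+1 w x.
Proof.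
rewrite pairing_psum_grad mulr_sumr; apply: eq_bigr => i _.
by rewrite exprSr mulrA.
Qed.

Lemma psum_ge0 k w x : odd k -> 0 <= psum k.+1 w x.
Proof. by move=> ok; apply: sumr_ge0 => i _; rewrite exprn_even_ge0 //= ok. Qed.

Lemma abs_psumE k w x : odd k -> psum k.+1 w x = abs_psum k.+1 w x.
Proof.
move=> ok; apply: eq_bigr => i _.
by rewrite -normrX ger0_norm // exprn_even_ge0 //= ok.
Qed.

Lemma abs_psum_ge0 k w x : 0 <= abs_psum k w x.
Proof. by apply: sumr_ge0 => i _; rewrite exprn_ge0. Qed.

(** Young's inequality for the exponents k+1 and (k+1)/k. In the induction,
    the difference of the two sides for k+1 is y times that for k plus the
    product (y^(k+1) - D^(k+1)) (y - D) >= 0. *)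
Lemma young_power k (y D : R) : 0 <= y -> 0 <= D ->
  k.+1%:R * y ^+ k * D <= k%:R * y ^+ k.+1 + D ^+ k.+1.
Proof.
move=> y0 D0; elim: k => [|k IH]; first by rewrite !expr0 !expr1; lra.
have H : 0 <= (y ^+ k.+1 - D ^+ k.+1) * (y - D).
  have [yD|Dy] := leP y D.
    by rewrite mulr_le0 // subr_le0 // ler_pXn2r.
  by rewrite mulr_ge0 // subr_ge0 ?ler_pXn2r ?nnegrE // ltW.
have := ler_wpM2l y0 IH.
rewrite -!natr1 !exprS in H *.
move: (y ^+ k) (D ^+ k) H => a b; nra.
Qed.

Lemma young_psum k w x (D : R) : 0 <= D ->
  k.+1%:R * D * abs_psum k w x <= k%:R * abs_psum k.+1 w x + m%:R * D ^+ k.+1.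
Proof.
move=> D0; rewrite /abs_psum !mulr_sumr.
have -> : m%:R * D ^+ k.+1 = \sum_(i < m) D ^+ k.+1 by rewrite sumr_const card_ord mulr_natl.
rewrite -big_split /=; apply: ler_sum => i _.
by rewrite mulrAC; exact: young_power.
Qed.

End power_sums.

Section short_orbits.
Context {R : realType} {n m : nat}.
Variables (w v : 'I_m -> 'rV[R]_n) (k : nat) (mu D e T lam : R).
Hypotheses (ok : odd k) (e0 : 0 < e) (D0 : 0 < D) (lam0 : 0 < lam) (mu0 : 0 <= mu) (T0 : 0 < T).
Hypothesis pairing_bound : forall i j, `|pairing (v j) (w i)| <= mu.
Hypothesis De : 2 * m%:R * D ^+ k.+1 = e.
Variables x p : R -> 'rV[R]_n.
Hypothesis dx : forall t : R, is_derive t (1 : R) x (- lam *: psum_grad k v (p t)).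
Hypothesis dp : forall t : R, is_derive t (1 : R) p (lam *: psum_grad k w (x t)).
Hypotheses (xT : x T = x 0) (pT : p T = p 0).
Hypothesis energy : forall t, psum k.+1 w (x t) + psum k.+1 v (p t) = e.

Let A : R := k.+1%:R.
Let S (u : 'I_m -> 'rV[R]_n) (y : R -> 'rV[R]_n) t := abs_psum k u (y t).
Let g (u : 'I_m -> 'rV[R]_n) (y : R -> 'rV[R]_n) t := psum k.+1 u (y t).

Let A0 : 0 < A. Proof. exact: ltr0Sn. Qed.

Let continuous_pair (u : 'rV[R]_n) (y dy : R -> 'rV[R]_n) :
  (forall t : R, is_derive t (1 : R) y (dy t)) -> continuous (fun t => pairing u (y t)).
Proof. by move=> h t; exact: is_derive_continuous (is_derive_pairing u (h t)). Qed.

Let continuous_S u (y dy : R -> 'rV[R]_n) :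
  (forall t : R, is_derive t (1 : R) y (dy t)) -> continuous (S u y).
Proof.
move=> h; apply: sum_continuous => i t.
apply: (@continuous_comp _ _ _ (fun t => `|pairing (u i) (y t)|) (fun r : R => r ^+ k)).
  apply: (@continuous_comp _ _ _ (fun t => pairing (u i) (y t)) (fun r : R => `|r|)).
    exact: continuous_pair h t.
  exact: norm_continuous.
exact: exprn_continuous.
Qed.

Let continuous_g u (y dy : R -> 'rV[R]_n) :
  (forall t : R, is_derive t (1 : R) y (dy t)) -> continuous (g u y).
Proof. by move=> h t; exact: is_derive_continuous (is_derive_psum k u (h t)). Qed.

(** Let A = k+1 and let g(x), g(p) be the two power sums in the energy. Since
    x . (p - q) is periodic for every constant q, its derivative has integral
    0. With q = 0 this shows that g(x) and g(p) have the same integral, which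
    is e T/2. In general it bounds the integral of g(x) by the maximum of |v_j
    . (p - q)| times the integral of the sum S(p) of the |p . v_j|^k. Choose q
    as the midpoint between p(0) and p(s), where s halves the total variation
    A lam mu L of p, with L the integral of S(x): then the maximum is at most
    a quarter of this variation. Young's inequality bounds the integrals of
    S(x) and S(p) by e T/(2 D), so that e T/2 <= (A lam mu/4) (e T/(2 D))^2. *)
Lemma no_short_orbit : 8 * D ^+ 2 <= A * lam * mu * e * T.
Proof.
have N10 t : 0 <= t <= T -> -1 < t by move=> /andP[t0 _]; apply: lt_le_trans t0; rewrite ltrN10.
have in0T t a b : 0 <= a -> b <= T -> a <= t <= b -> 0 <= t <= T.
  by move=> ? ? /andP[? ?]; apply/andP; split; lra.
have [L1 dL1] := @antiderivative R _ (-1) (@continuous_S w _ _ dx).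
have [L2 dL2] := @antiderivative R _ (-1) (@continuous_S v _ _ dp).
have [G1 dG1] := @antiderivative R _ (-1) (@continuous_g w _ _ dx).
have [G2 dG2] := @antiderivative R _ (-1) (@continuous_g v _ _ dp).
have T0' : 0 <= T by exact: ltW.
(* The derivative of x . (p - q), by Euler's identity for homogeneous functions. *)
have dxp (q : 'rV[R]_n) t : is_derive t (1 : R) (fun t => pairing (x t) (p t - q))
    (A * lam * (g w x t) - lam * \sum_j A * pairing (v j) (p t) ^+ k * pairing (v j) (p t - q)).
  have dpq : is_derive t (1 : R) (fun t => p t - q) (lam *: psum_grad k w (x t)).
    have [d E] := is_derive_add (dp t) (is_derive_cst (- q) t (1 : R)).
    by apply: DeriveDef; [exact: d|apply: etrans E _; rewrite addr0].
  have [d E] := is_derive_pairing2 (dx t) dpq.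
  apply: DeriveDef; first exact: d.
  apply: etrans E _; rewrite pairingZl pairingZr (pairingC (x t)) pairing_psum_grad_id.
  rewrite pairing_psum_grad /g -/A; ring.
have GT : G1 T - G1 0 = e * T / 2 /\ G2 T - G2 0 = e * T / 2.
  have E1 : G1 T - G1 0 = G2 T - G2 0.
    have dsum t : 0 <= t <= T -> is_derive t (1 : R) (fun t => A * lam * (G1 t - G2 t)) (A * lam * (g w x t - g v p t)).
      move=> h; apply: is_derive_scale; apply: is_derive_add; first exact: dG1 (N10 _ h).
      by apply: is_derive_opp; exact: dG2 (N10 _ h).
    have dxp0 t : 0 <= t <= T -> is_derive t (1 : R) (fun t => pairing (x t) (p t - 0)) (A * lam * (g w x t - g v p t)).
      move=> _; have [d E] := dxp 0 t; apply: DeriveDef; first exact: d.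
      apply: etrans E _; rewrite mulrBr; congr (_ - _); rewrite -mulrA mulrCA; congr (_ * _).
      rewrite mulr_sumr; apply: eq_bigr => j _; by rewrite subr0 exprSr mulrA.
    have := increment_eq T0' dsum dxp0; rewrite xT pT subrr -mulrBr => /eqP.
    rewrite mulf_eq0 (gt_eqF (mulr_gt0 A0 lam0)) /= => /eqP; lra.
  have E2 : (G1 T + G2 T) - (G1 0 + G2 0) = e * T - e * 0.
    apply: (@increment_eq _ (fun t => G1 t + G2 t) (fun=> e) (fun t => e * t)) => // t h.
      have [d E] := is_derive_add (dG1 t (N10 _ h)) (dG2 t (N10 _ h)).
      by apply: DeriveDef; [exact: d|apply: etrans E _; exact: energy].
    have [d E] := is_derive_scale e (is_derive_id t (1 : R)).
    by apply: DeriveDef; [exact: d|apply: etrans E _; rewrite mulr1].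
  lra.
have [G1T G2T] := GT.
(* D is chosen so that both terms of Young's inequality add up to e T/2. *)
have young (u : 'I_m -> 'rV[R]_n) (y : R -> 'rV[R]_n) (L G : R -> R) :
    (forall t : R, -1 < t -> is_derive t (1 : R) L (S u y t)) ->
    (forall t : R, -1 < t -> is_derive t (1 : R) G (g u y t)) ->
    G T - G 0 = e * T / 2 -> D * (L T - L 0) <= e * T / 2.
  move=> dL dG GE.
  have : A * D * L T - A * D * L 0 <= (k%:R * G T + m%:R * D ^+ k.+1 * T) - (k%:R * G 0 + m%:R * D ^+ k.+1 * 0).
    apply: (@increment_le _ (fun t => A * D * L t) (fun t => A * D * S u y t)
      (fun t => k%:R * G t + m%:R * D ^+ k.+1 * t) (fun t => k%:R * g u y t + m%:R * D ^+ k.+1)) => //.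
    - by move=> t h; apply: is_derive_scale; exact: dL (N10 _ h).
    - move=> t h; have [d E] := is_derive_add (is_derive_scale k%:R (dG t (N10 _ h)))
        (is_derive_scale (m%:R * D ^+ k.+1) (is_derive_id t (1 : R))).
      by apply: DeriveDef; [exact: d|apply: etrans E _; rewrite mulr1].
    - by move=> t _; rewrite /S /g abs_psumE //; apply: young_psum; exact: ltW.
  rewrite -mulrBr mulr0 addr0 addrAC -mulrBr GE => h.
  rewrite -(ler_pM2l A0) mulrA; apply: le_trans h _.
  rewrite /A -[k.+1%:R]natr1 -De; lra.
have Y1 := young _ _ _ _ dL1 dG1 G1T; have Y2 := young _ _ _ _ dL2 dG2 G2T.
(* L1 measures the variation of p, tested against the v_j. *)
have osc j a b : 0 <= a -> a <= b -> b <= T ->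
    `|pairing (v j) (p b) - pairing (v j) (p a)| <= A * lam * mu * (L1 b - L1 a).
  move=> a0 ab bT.
  have B t : `|pairing (v j) (lam *: psum_grad k w (x t))| <= A * lam * mu * S w x t.
    rewrite pairingZr normrM (gtr0_norm lam0) pairingC pairing_psum_grad.
    rewrite -[leRHS]mulrA (mulrC A) -mulrA ler_wpM2l //; first exact: ltW.
    apply: le_trans (ler_norm_sum _ _ _) _; rewrite /S /abs_psum !mulr_sumr.
    apply: ler_sum => i _; rewrite !normrM normr_nat normrX -/A -mulrA ler_wpM2l ?(ltW A0) //.
    by rewrite [leRHS]mulrC ler_wpM2l ?exprn_ge0 // pairingC.
  have dL t : a <= t <= b -> is_derive t (1 : R) (fun t => A * lam * mu * L1 t) (A * lam * mu * S w x t).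
    by move=> h; apply: is_derive_scale; apply: dL1; apply: N10; exact: in0T h.
  have dv t : a <= t <= b -> is_derive t (1 : R) (fun t => pairing (v j) (p t)) (pairing (v j) (lam *: psum_grad k w (x t))).
    by move=> _; exact: is_derive_pairing.
  have dvN t : a <= t <= b -> is_derive t (1 : R) (fun t => - pairing (v j) (p t)) (- pairing (v j) (lam *: psum_grad k w (x t))).
    by move=> h; apply: is_derive_opp; exact: dv.
  have I1 := increment_le ab dv dL (fun t _ => le_trans (ler_norm _) (B t)).
  have I2 : - pairing (v j) (p b) - - pairing (v j) (p a) <= A * lam * mu * L1 b - A * lam * mu * L1 a.
    apply: increment_le ab dvN dL _ => t _; apply: le_trans (B t); by rewrite -normrN ler_norm.
  rewrite ler_norml; apply/andP; split; lra.
have L1T : L1 0 <= L1 T.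
  apply: (increment_ge0 T0' (fun t h => dL1 t (N10 t h))) => t _; exact: abs_psum_ge0.
have [s s0T Ls] : exists2 s, s \in `[0, T] & L1 s = (L1 0 + L1 T) / 2.
  apply: IVT => //.
    apply: derivable_within_continuous => t; rewrite in_itv /= => h.
    by have [] := dL1 t (N10 _ h).
  by rewrite minEle maxEle L1T; apply/andP; split; lra.
rewrite in_itv /= in s0T; have /andP[s0 sT] := s0T.
pose q := 2^-1 *: (p 0 + p s).
pose Q := A * lam * mu * (L1 T - L1 0) / 4.
have center j t : 0 <= t <= T -> `|pairing (v j) (p t - q)| <= Q.
  move=> /andP[t0 tT].
  have -> : pairing (v j) (p t - q) = ((pairing (v j) (p t) - pairing (v j) (p 0))
      + (pairing (v j) (p t) - pairing (v j) (p s))) / 2.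
    by rewrite pairingBr pairingZr pairingDr; lra.
  rewrite normrM (ger0_norm (_ : 0 <= 2^-1)) ?invr_ge0 //.
  have h0 := osc j 0 t (lexx _) t0 tT; have hT := osc j t T t0 tT (lexx _).
  rewrite pT distrC in hT.
  have [ts|/ltW st] := leP t s.
    have hs := osc j t s t0 ts sT; rewrite distrC in hs.
    have := ler_normD (pairing (v j) (p t) - pairing (v j) (p 0)) (pairing (v j) (p t) - pairing (v j) (p s)).
    have -> : Q = (A * lam * mu * (L1 s - L1 0)) / 2 by rewrite Ls /Q; field.
    move: h0 hs; rewrite !mulrBr; lra.
  have hs := osc j s t s0 st tT.
  have := ler_normD (pairing (v j) (p t) - pairing (v j) (p 0)) (pairing (v j) (p t) - pairing (v j) (p s)).
  have -> : Q = (A * lam * mu * (L1 T - L1 s)) / 2 by rewrite Ls /Q; field.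
  move: hT hs; rewrite !mulrBr; lra.
have Q0 : 0 <= Q.
  by rewrite /Q divr_ge0 // mulr_ge0 ?subr_ge0 // !mulr_ge0 // ltW.
have GQ : G1 T - G1 0 <= Q * (L2 T - L2 0).
  have : A * lam * (G1 T - Q * L2 T) - A * lam * (G1 0 - Q * L2 0) <= pairing (x T) (p T - q) - pairing (x 0) (p 0 - q).
    apply: (@increment_le _ (fun t => A * lam * (G1 t - Q * L2 t)) (fun t => A * lam * (g w x t - Q * S v p t))
      (fun t => pairing (x t) (p t - q)) _ 0 T T0' _ (fun t _ => dxp q t)) => t h.
      apply: is_derive_scale; apply: is_derive_add; first exact: dG1 (N10 _ h).
      by apply: is_derive_opp; apply: is_derive_scale; exact: dL2 (N10 _ h).
    rewrite mulrBr lerD2l lerN2 /S /abs_psum !mulr_sumr; apply: ler_sum => j _.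
    apply: le_trans (ler_norm _) _; rewrite !normrM normr_nat (gtr0_norm lam0) normrX -/A.
    have K (a b : R) : 0 <= a -> b <= Q -> lam * (A * a * b) <= A * lam * (Q * a).
      move=> a0 bQ; rewrite (_ : lam * (A * a * b) = A * lam * (b * a)); last by ring.
      by rewrite ler_wpM2l ?ler_wpM2r // mulr_ge0 // ltW.
    by apply: K; [rewrite exprn_ge0|exact: center].
  rewrite xT pT subrr -mulrBr pmulr_rle0 ?mulr_gt0 //; lra.
have L2T : L2 0 <= L2 T.
  apply: (increment_ge0 T0' (fun t h => dL2 t (N10 t h))) => t _; exact: abs_psum_ge0.
move: GQ Y1 Y2; rewrite G1T /Q; set M := A * lam * mu; set c := e * T / 2.
rewrite -subr_ge0 in L1T; rewrite -subr_ge0 in L2T.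
have M0 : 0 <= M by rewrite !mulr_ge0 // ltW.
have c0 : 0 < c by rewrite !mulr_gt0.
move: (L1 T - L1 0) (L2 T - L2 0) L1T L2T => l1 l2 l10 l20 GQ Y1 Y2.
have H : c * D ^+ 2 <= M / 4 * c ^+ 2.
  apply: (@le_trans _ _ (M / 4 * ((D * l1) * (D * l2)))).
    apply: le_trans (ler_wpM2r (sqr_ge0 D) GQ) _; rewrite le_eqVlt; apply/orP; left; apply/eqP; ring.
  rewrite ler_wpM2l ?divr_ge0 // expr2; apply: ler_pM => //; apply: mulr_ge0 => //; exact: ltW.
have {}H : D ^+ 2 <= M / 4 * c by rewrite -(ler_pM2l c0) [leRHS]mulrCA -(expr2 c).
have -> : M * e * T = 8 * (M / 4 * c) by rewrite /c; field.
by rewrite ler_pM2l.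
Qed.

End short_orbits.

(** * Finite norming families *)

Section norming_families.
Context {R : realType} {n : nat}.
Variables (f : 'rV[R]_n -> R) (hf : flat_norm f).
Implicit Types u v x p : 'rV[R]_n.

Let unit_sphere : set 'rV[R]_n := [set v | f v = 1].

Lemma fn_sphere_compact : compact unit_sphere.
Proof.
have [c c0 cf] := fn_lower_bound hf.
apply: bounded_closed_compact.
  exists c^-1; split; first exact: num_real.
  move=> M cM v /= fv; apply: le_trans (ltW cM).
  by rewrite -[leRHS]mulr1 ler_pdivlMl // -fv; exact: cf.
rewrite (_ : unit_sphere = f @^-1` [set 1]) //.
by apply: preimage_closed; [move=> v _; exact: (fn_continuous hf)|exact: closed_eq].
Qed.

Lemma fn_normalize v : v != 0 -> f ((f v)^-1 *: v) = 1.
Proof.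
move=> v0; have fv := fn_pos hf v0.
by rewrite (fn_homogeneous hf) ?invr_gt0 // mulVf // gt_eqF.
Qed.

Lemma finite_net eps : 0 < eps -> exists (m : nat) (u : 'I_m -> 'rV[R]_n),
  (forall i, f (u i) = 1) /\ forall v, f v = 1 -> exists i, f (v - u i) < eps.
Proof.
move=> e0; have := fn_sphere_compact; rewrite compact_cover.
move=> /(_ 'rV[R]_n unit_sphere (fun u => [set v | f (v - u) < eps])).
case.
- move=> u _; apply: (@open_comp _ _ (fun v => f (v - u)) [set r | r < eps]); last exact: open_lt.
  move=> v _; apply: (@continuous_comp _ _ _ (fun v => v - u) f); last exact: (fn_continuous hf).
  exact: (Cinfty_translation setT (- u) 0%N v I).
- by move=> v v1; exists v => //=; rewrite subrr (fn0 hf).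
move=> D DS cov; exists (size (finmap.enum_fset D)), (fun i => nth 0 (finmap.enum_fset D) i); split.
  by move=> i; have /DS := mem_nth 0 (ltn_ord i); rewrite inE.
move=> v /cov [u /= uD vu].
have iD : (index u (finmap.enum_fset D) < size (finmap.enum_fset D))%N by rewrite index_mem.
by exists (Ordinal iD); rewrite /= nth_index.
Qed.

Lemma pairing_le_max p : (0 < n)%N -> exists x, f x = 1 /\ forall y, pairing p y <= pairing p x * f y.
Proof.
move=> n0; pose v0 : 'rV[R]_n := delta_mx 0 (Ordinal n0).
have v00 : v0 != 0.
  by apply/eqP => /rowP/(_ (Ordinal n0)); rewrite !mxE !eqxx => /eqP; rewrite oner_eq0.
have S0 : unit_sphere !=set0 by exists ((f v0)^-1 *: v0); exact: fn_normalize.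
have cp : {within unit_sphere, continuous (pairing p)}.
  by apply: continuous_subspaceT => v; exact: continuous_pairing.
have [x Sx xmax] := compact_EVT_max S0 fn_sphere_compact cp.
rewrite inE in Sx; exists x; split=> // y.
have [->|y0] := eqVneq y 0; first by rewrite pairing0r (fn0 hf) mulr0.
have fy := fn_pos hf y0.
have := xmax _ (mem_set (fn_normalize y0 : unit_sphere _)).
by rewrite pairingZr mulrC ler_pdivrMr.
Qed.

(** Take a finite net of the unit sphere of f. Its points, slightly enlarged,
    are the v_j: they detect the maximum of a covector over the sphere up to a
    factor. The supporting functionals at its points, rescaled, are the w_i:
    they detect the norm of a vector up to a factor. A supporting functional
    is at most 1 on a unit vector, whence the bound on their pairings. *)
Lemma norming_families (l eps : R) : (0 < n)%N -> 0 < l -> 0 < eps < 1 ->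
  exists (m : nat) (w v : 'I_m -> 'rV[R]_n), [/\
    forall i j, `|pairing (v j) (w i)| <= 2 / l / (1 - eps) ^+ 2,
    forall p, (forall j, `|pairing (v j) p| < 1) -> forall x, x != 0 -> pairing p x < f x &
    forall x, (forall i, `|pairing (w i) x| < 1) -> f x < l / 2].
Proof.
move=> n0 l0 /andP[e0 e1]; have [m [u [u1 net]]] := finite_net e0.
have u0 i : u i != 0.
  by apply/eqP => h; have := u1 i; rewrite h (fn0 hf) => /eqP; rewrite eq_sym oner_eq0.
have sup i : {w | pairing w (u i) = 1 & forall v, `|pairing w v| <= f v}.
  by apply: cid2; have [w [w1 w2 _]] := fn_support hf (u0 i); exists w; rewrite ?w1.
pose t : R := 1 - eps; have t0 : 0 < t by rewrite /t; lra.
exists m, (fun i => (2 / l / t) *: s2val (sup i)), (fun j => t^-1 *: u j); split.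
- move=> i j; have c0 : 0 < t^-1 * (2 / l / t) by rewrite mulr_gt0 ?invr_gt0 // !divr_gt0.
  rewrite pairingZl pairingZr mulrA normrM (gtr0_norm c0).
  have := s2valP' (sup i) (u j); rewrite u1 pairingC => h1.
  rewrite (_ : 2 / l / (1 - eps) ^+ 2 = t^-1 * (2 / l / t)).
    by rewrite -[leRHS]mulr1 ler_wpM2l // ltW.
  by rewrite -/t; field; rewrite !gt_eqF.
- move=> p hp x x0; have [y [y1 ymax]] := pairing_le_max p n0.
  have [j yj] := net y y1.
  have M0 : 0 <= pairing p y.
    by have := ymax (- y); rewrite pairingNr (fn_sym hf) y1; lra.
  have M1 : pairing p y < 1.
    have := hp j; rewrite pairingZl normrM gtr0_norm ?invr_gt0 // mulrC ltr_pdivrMr // mul1r.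
    rewrite ltr_norml => /andP[_ h1].
    have := ymax (y - u j); rewrite pairingBr (pairingC p (u j)) => h2.
    have := ler_wpM2l M0 (ltW yj); rewrite /t in h1; nra.
  apply: le_lt_trans (ymax x) _; rewrite -[ltRHS]mul1r ltr_pM2r //; exact: fn_pos.
- move=> x hx; have [->|x0] := eqVneq x 0; first by rewrite (fn0 hf) divr_gt0.
  have fx := fn_pos hf x0.
  have [i xi] := net _ (fn_normalize x0).
  have := hx i; case: (sup i) => w /= w1 w2.
  rewrite pairingZl normrM gtr0_norm ?divr_gt0 // => h.
  have h1 : t <= pairing w ((f x)^-1 *: x).
    have := w2 ((f x)^-1 *: x - u i); rewrite ler_norml pairingBr w1 => /andP[h1 _].
    by rewrite /t; lra.
  rewrite pairingZr mulrC ler_pdivlMr // in h1.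
  have h2 : t * f x <= `|pairing w x| by apply: le_trans h1 (ler_norm _).
  have : 2 / l / t * (t * f x) < 1.
    by apply: le_lt_trans h; rewrite ler_wpM2l // ?divr_ge0 // ?ltW // divr_gt0.
  rewrite mulrA divfK ?gt_eqF // mulrAC ltr_pdivrMr //; lra.
Qed.

End norming_families.

(** * An admissible Hamiltonian on the disc bundle *)

Section orbits.
Context {R : realType} {m : nat}.

Lemma is_derive_along (V W : normedModType R) (g : V -> W) (y : R -> V) (t : R) (u : V) :
  differentiable g (y t) -> is_derive t (1 : R) y u -> is_derive t (1 : R) (g \o y) ('d g (y t) u).
Proof.
move=> dg [/derivable1_diffP dy <-].
have d := differentiable_comp dy dg.
apply: DeriveDef; first exact: diff_derivable.
by rewrite (deriveE _ d) diff_comp //= -(deriveE _ dy).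
Qed.

Lemma form_eval_skew (W : 'M[R]_m) u : W^T = - W -> form_eval W u u = 0.
Proof.
move=> WT; have : form_eval W u u = - form_eval W u u.
  rewrite {1}/form_eval; have -> : (u *m W *m u^T) 0 0 = ((u *m W *m u^T)^T) 0 0 by rewrite [RHS]mxE.
  by rewrite !trmx_mul trmxK WT mulNmx mulmxN mulmxA [LHS]mxE.
lra.
Qed.

Variables (M : symplectic_manifold R m) (H : M -> R) (c : R -> M).
Hypothesis orbit : hamiltonian_orbit H c.

Lemma orbit_chart_near (t : R) (i : cs_index M) (U : set 'rV[R]_m) :
  cs_dom i (c t) -> open U -> U (cs_chart i (c t)) ->
  \forall s \near t, cs_dom i (c s) /\ U (cs_chart i (c s)).
Proof.
move=> it oU Ut; have [cc _] := orbit.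
have c1 : {for t, continuous (cs_chart i \o c)}.
  by apply: continuous_comp; [exact: cc|exact: mf_chart_continuous].
have h1 : \forall s \near t, cs_dom i (c s) by exact: (cc t _ (open_nbhs_nbhs (conj (mf_dom_open i) it))).
have h2 : \forall s \near t, U (cs_chart i (c s)) by exact: (c1 _ (open_nbhs_nbhs (conj oU Ut))).
by apply: filterS2 h1 h2 => s; split.
Qed.

(** The derivative of H along its flow is the value of the skew form on a pair
    of equal vectors. *)
Lemma orbit_energy : smooth_on setT H -> forall t, H (c t) = H (c 0).
Proof.
move=> sH t; apply: (@is_derive_0_is_cst _ (H \o c)) => {}t.
have [i it] := mf_cover (c t).
have [g rg] := sH (c t) I i it; have [U [oU Ut Cg gE]] := rg.
have [u du hu] := (orbit.2 t i it).
have dg : differentiable g (cs_chart i (c t)) by have [+ _] := Cg 1%N; apply.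
have := is_derive_along dg du; rewrite -(hu g rg u) form_eval_skew; last exact: sm_skew.
apply: near_eq_is_derive; apply: filterS (orbit_chart_near it oU Ut) => s [si Us] /=.
by rewrite gE.
Qed.

End orbits.

Lemma interior_no_boundary (R : realType) m (M : manifold R m) :
  (forall i : cs_index M, cs_bdry i = false) -> manifold_interior M = setT.
Proof.
move=> bd; apply/seteqP; split=> // p _; have [i ip] := mf_cover p; exists i => //.
have := constant_near_chart bd openT (I : setT p) ip.
by apply: filterS => x [q [_ iq <-]]; exists q.
Qed.

Lemma compact_subspace (T : topologicalType) (O K : set T) : compact K -> K `<=` O ->
  compact (set_val @^-1` K : set O).
Proof.
move=> cK KO F FF FK.
pose G := [set A : set T | F (set_val @^-1` A)].
have GG : ProperFilter G by exact: fmap_proper_filter.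
have [z [Kz zcl]] := cK G GG FK.
exists (exist _ z (mem_set (KO z Kz))); split=> // A B FA nB.
move: nB; rewrite nbhsE => -[C [[D oD <-] Dz] CB].
have GA : F (set_val @^-1` (set_val @` A)) by apply: filterS FA => x Ax; exists x.
have [_ [[x Ax <-] Dx]] := zcl _ _ GA (open_nbhs_nbhs (conj oD Dz)).
by exists x; split=> //; exact: CB.
Qed.

Section torus_hamiltonian.
Context {R : realType} {n m : nat}.
Variables (f : 'rV[R]_n -> R) (k0 : 'rV[int]_n) (w v : 'I_m -> 'rV[R]_n) (K : nat).
Hypotheses (hf : flat_norm f) (k00 : k0 != 0) (oK : odd K).
Hypothesis k0min : forall k : 'rV[int]_n, k != 0 -> f (intv k0) <= f (intv k).
Hypothesis small_base : forall x, (forall i, `|pairing (w i) x| < 1) -> f x < f (intv k0) / 2.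
Hypothesis small_fibre : forall p, (forall j, `|pairing (v j) p| < 1) ->
  forall x, x != 0 -> pairing p x < f x.
Implicit Types (y z : 'rV[R]_(n + n)).

(** A smooth substitute for the gauge of the product of polytopes given by
    |w_i . x| < 1 and |v_j . p| < 1. *)
Definition energy y : R := psum K.+1 w (lsubmx y) + psum K.+1 v (rsubmx y).

Lemma energy_ge0 y : 0 <= energy y.
Proof. by rewrite addr_ge0 // psum_ge0. Qed.

Lemma Ck_energy (V : normedModType R) k (U : set V) (g : V -> 'rV[R]_(n + n)) : open U ->
  Ck k U g -> Ck k U (fun a : V => energy (g a)).
Proof.
move=> oU hg; apply: CkD => //; apply: Ck_psum => //; apply: Ck_rV => // i.
  apply: (@eq_Ck _ _ _ _ _ (fun a : V => g a 0 (lshift n i))) => //; last exact: Ck_coord.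
  by move=> a _; rewrite mxE.
apply: (@eq_Ck _ _ _ _ _ (fun a : V => g a 0 (rshift n i))) => //; last exact: Ck_coord.
by move=> a _; rewrite mxE.
Qed.

Lemma continuous_energy : continuous energy.
Proof.
move=> y.
exact: (@Ck_energy _ 0 setT idfun openT (@Ck_linear _ _ _ 0 setT idfun (fun x => @cvg_id _ _)) y I).
Qed.

Let psum_lt1 (u : 'I_m -> 'rV[R]_n) x : psum K.+1 u x < 1 -> forall i, `|pairing (u i) x| < 1.
Proof.
move=> h i; rewrite -(@ltr_pXn2r _ K.+1) ?nnegrE // expr1n; apply: le_lt_trans h.
rewrite abs_psumE // /abs_psum (bigD1 i) //= lerDl.
by apply: sumr_ge0 => j _; rewrite exprn_ge0.
Qed.

Lemma energy_lt1 y : energy y < 1 ->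
  f (lsubmx y) < f (intv k0) / 2 /\ forall x, x != 0 -> pairing (rsubmx y) x < f x.
Proof.
move=> h; have h1 := psum_ge0 w (lsubmx y) oK; have h2 := psum_ge0 v (rsubmx y) oK.
rewrite /energy in h; split; first by apply/small_base/psum_lt1; lra.
by apply/small_fibre/psum_lt1; lra.
Qed.

(** A deck transformation of the cotangent bundle of the torus. *)
Definition shift (k : 'rV[int]_n) : 'rV[R]_(n + n) := row_mx (intv k) 0.

Lemma torus_bundle_proj_shift y k : torus_bundle_proj (y + shift k) = torus_bundle_proj y.
Proof.
rewrite /torus_bundle_proj !linearD /= row_mxKl row_mxKr addr0; congr pair.
by apply/torus_proj_int; exists k.
Qed.

Lemma torus_bundle_proj_eq y z : torus_bundle_proj y = torus_bundle_proj z ->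
  exists k, y = z + shift k.
Proof.
case=> /torus_proj_int[k e1] e2; exists k.
by rewrite -[LHS]hsubmxK e1 e2 -[z in RHS]hsubmxK add_row_mx addr0.
Qed.

(** Two lifts of low energy differ by an integer vector whose norm is less
    than that of a shortest one. *)
Lemma low_energy_lift_unique y z : energy y < 1 -> energy z < 1 ->
  torus_bundle_proj y = torus_bundle_proj z -> y = z.
Proof.
move=> /energy_lt1[hy _] /energy_lt1[hz _] /torus_bundle_proj_eq[k ykz].
have [k1|k1] := eqVneq k 0; first by rewrite ykz k1 /shift /intv map_mx0 row_mx0 addr0.
have := k0min k1; have -> : intv k = lsubmx y - lsubmx z.
  by rewrite ykz linearD /= row_mxKl addrC addKr.
have := fn_subadd hf (lsubmx y) (- lsubmx z); rewrite (fn_sym hf) => h1 h2.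
exfalso; clear ykz; lra.
Qed.

Variables (h hd : R -> R) (d : R).
Hypotheses (d0 : 0 < d < 4^-1) (h_smooth : Cinfty setT h).
Hypothesis dh : forall e : R, is_derive e (1 : R) h (hd e).
Hypothesis hd_ge0 : forall e, 0 <= hd e.
Hypothesis h_lo : forall e, e <= d -> h e = 0.
Hypothesis h_hi : forall e, 1 - d <= e -> h e = h 1.

(** The function h o energy on the points with a lift of low energy, extended
    by its maximum. The lift is unique, so the choice is harmless. *)
Definition torus_hamiltonian (q : torus_bundle R n) : R :=
  if pselect (exists y, torus_bundle_proj y = q /\ energy y < 1) is left e
  then h (energy (sval (cid e))) else h 1.

Lemma torus_hamiltonianE y : energy y < 1 -> torus_hamiltonian (torus_bundle_proj y) = h (energy y).
Proof.
move=> Ey; rewrite /torus_hamiltonian; case: pselect => [e|]; last by case; exists y.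
by case: (cid e) => z /= [zy Ez]; rewrite (low_energy_lift_unique Ez Ey zy).
Qed.

Lemma torus_hamiltonian_hi q : (forall y, torus_bundle_proj y = q -> 1 - d < energy y) ->
  torus_hamiltonian q = h 1.
Proof.
move=> hi; rewrite /torus_hamiltonian; case: pselect => [e|//].
by case: (cid e) => z /= [zy Ez]; rewrite h_hi // ltW // hi.
Qed.

Lemma low_energy_or q : (exists2 y, torus_bundle_proj y = q & energy y < 1) \/
  (forall y, torus_bundle_proj y = q -> 1 <= energy y).
Proof.
have [h1|h1] := pselect (exists2 y, torus_bundle_proj y = q & energy y < 1); first by left.
by right=> y yq; rewrite leNgt; apply/negP => E1; case: h1; exists y.
Qed.

Let core : set (torus_bundle R n) := @torus_bundle_proj R n @` [set y | energy y <= 1 - d].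

(** In the energy region below 1 - d, both components are bounded by
    energy_lt1. *)
Lemma core_compact : compact core.
Proof.
case/andP: d0 => d00 d1; have [c c0 cf] := fn_lower_bound hf.
apply: continuous_compact.
  by apply: continuous_subspaceT => y; exact: torus_bundle_proj_continuous.
pose l := f (intv k0); pose M := l / (2 * c) + \sum_i f (delta_mx 0 i).
have l0 : 0 <= l by exact: fn_ge0.
have s0 : 0 <= \sum_i f (delta_mx 0 i : 'rV[R]_n) by apply: sumr_ge0 => i _; exact: fn_ge0.
have c20 : 0 <= l / (2 * c) by rewrite divr_ge0 // mulr_ge0 // ltW.
apply: bounded_closed_compact.
  exists M; split; first exact: num_real.
  move=> M' MM' y /= Ey; apply: norm_le_coord; first by apply: le_trans (ltW MM'); rewrite addr_ge0.
  move=> i; apply: le_trans (ltW MM').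
  have [hx hp] : f (lsubmx y) < l / 2 /\ forall x, x != 0 -> pairing (rsubmx y) x < f x.
    by apply: energy_lt1; lra.
  case: (split_ordP i) => j ->.
    have -> : y 0 (lshift n j) = lsubmx y 0 j by rewrite mxE.
    apply: le_trans (coord_norm_le _ _) _; rewrite /M ler_wpDr // invfM mulrA ler_pdivlMr // mulrC.
    exact: le_trans (cf _) (ltW hx).
  have -> : y 0 (rshift n j) = pairing (rsubmx y) (delta_mx 0 j) by rewrite pairing_delta mxE.
  have dj : delta_mx 0 j != 0 :> 'rV[R]_n.
    by apply/eqP => /rowP/(_ j); rewrite !mxE !eqxx => /eqP; rewrite oner_eq0.
  apply: (@le_trans _ _ (f (delta_mx 0 j))).
    rewrite ler_norml (ltW (hp _ dj)) andbT lerNl -pairingNr -(fn_sym hf (delta_mx 0 j)).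
    by apply: ltW; apply: hp; rewrite oppr_eq0.
  rewrite /M ler_wpDl // (bigD1 j) //= ler_wpDr //; apply: sumr_ge0 => i' _; exact: fn_ge0.
rewrite (_ : [set y | _] = energy @^-1` [set r | r <= 1 - d]) //.
by apply: preimage_closed; [move=> *; exact: continuous_energy|exact: closed_le].
Qed.

Lemma h_homo : {homo h : a b / a <= b}.
Proof.
by move=> a b ab; apply: (increment_ge0 ab (fun t _ => dh t)) => t _; exact: hd_ge0.
Qed.

Lemma torus_hamiltonian_itv q : 0 <= torus_hamiltonian q <= h 1.
Proof.
case/andP: d0 => d00 d1; have h0 : h 0 = 0 by apply: h_lo; exact: ltW.
have [[y <- Ey]|hi] := low_energy_or q; last first.
  rewrite torus_hamiltonian_hi; last by move=> y /hi; lra.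
  by have := h_homo (@ler01 R); rewrite h0 lexx => ->.
by rewrite torus_hamiltonianE // -[leLHS]h0 !h_homo ?energy_ge0 // ltW.
Qed.

(** A point without a lift of low energy is outside the image of the set where
    energy <= 1 - d; this image is compact, hence closed, and the function is
    constant off it. *)
Lemma torus_hamiltonian_local (i : cs_index (torus_bundle R n)) q : cs_dom i q ->
  (exists2 k, energy (cs_chart i q + shift k) < 1 &
    local_rep setT torus_hamiltonian i q (fun y => h (energy (y + shift k)))) \/
  ((forall y, torus_bundle_proj y = q -> 1 <= energy y) /\
    local_rep setT torus_hamiltonian i q (cst (h 1))).
Proof.
move=> iq; case/andP: d0 => d00 d1; have [[y yq Ey]|hi] := low_energy_or q.
  left; have [k ye] := torus_bundle_proj_eq (etrans yq (esym (torus_bundle_chartK iq))).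
  rewrite ye in Ey; exists k => //.
  have cE : continuous (fun z => energy (z + shift k)).
    move=> z; apply: (@continuous_comp _ _ _ (fun z => z + shift k) energy); last exact: continuous_energy.
    exact: (Cinfty_translation setT (shift k) 0%N z I).
  have oU : open [set z | energy (z + shift k) < 1].
    apply: (@open_comp _ _ (fun z => energy (z + shift k)) [set r | r < 1]); last exact: open_lt.
    by move=> z _; exact: cE.
  exists [set z | energy (z + shift k) < 1]; split=> //.
  - move=> l; apply: (@Ck_comp1 _ _ _ _ setT h (fun z => energy (z + shift k))) => //.
    by apply: Ck_energy => //; exact: Cinfty_translation.
  - move=> q' _ iq' E1; rewrite -{1}(torus_bundle_chartK iq') -(torus_bundle_proj_shift _ k).
    by rewrite torus_hamiltonianE.
right; split=> //; exists (@torus_bundle_proj R n @^-1` ~` core); split.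
- apply: open_comp; first by move=> y _; exact: torus_bundle_proj_continuous.
  apply: closed_openC; apply: compact_closed; last exact: core_compact.
  exact: torus_bundle_hausdorff.
- rewrite /= torus_bundle_chartK // => -[y Ey yq]; have := hi y yq.
  by move: Ey => /=; lra.
- exact: Cinfty_cst.
- move=> q' _ iq'; rewrite /= torus_bundle_chartK // => nq'; apply: torus_hamiltonian_hi => y yq'.
  by rewrite ltNge; apply/negP => Ey; apply: nq'; exists y.
Qed.

Variables (F : torus R n * 'rV[R]_n -> R) (hF : finsler F).
Hypothesis FE : forall q x, F (q, x) = f x.

Local Notation DM := (disc_cotangent_bundle hF).

Definition disc_hamiltonian (q : DM) : R := torus_hamiltonian (set_val q).

Let local_form (i : cs_index (torus_bundle R n)) q (iq : cs_dom i q) :=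
  torus_hamiltonian_local iq.

Lemma smooth_disc_hamiltonian : smooth_on setT disc_hamiltonian.
Proof.
move=> q _ i iq; have [[k _ rep]|[_ rep]] := local_form iq.
  by exists (fun y => h (energy (y + shift k))); exact: sub_local_rep rep.
by exists (cst (h 1)); exact: sub_local_rep rep.
Qed.

Definition ham_field y : 'rV[R]_(n + n) :=
  row_mx (- hd (energy y) *: psum_grad K v (rsubmx y)) (hd (energy y) *: psum_grad K w (lsubmx y)).

Let lsubmx_shift y k : lsubmx (y + shift k) = lsubmx y + intv k.
Proof. by rewrite linearD /= row_mxKl. Qed.

Let rsubmx_shift y k : rsubmx (y + shift k) = rsubmx y + 0.
Proof. by rewrite linearD /= row_mxKr. Qed.

Section orbit_equations.
Variable c : R -> DM.
Hypothesis orbit : hamiltonian_orbit disc_hamiltonian c.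

(** In the local form h o energy of the Hamiltonian, the orbit equation gives
    the canonical equations, and where the Hamiltonian is constant the
    velocity vanishes. *)
Lemma orbit_velocity t (i : cs_index DM) : cs_dom i (c t) -> exists2 u, is_derive t (1 : R) (cs_chart i \o c) u &
  (exists2 k, energy (cs_chart i (c t) + shift k) < 1 & u = ham_field (cs_chart i (c t) + shift k)) \/
  ((forall y, torus_bundle_proj y = set_val (c t) -> 1 <= energy y) /\ u = 0).
Proof.
move=> it; have [_ /(_ t i it) [u du hu]] := orbit; exists u => //.
have canon u' : form_eval (canonical_mx R n) u u' = pairing (rsubmx u) (lsubmx u') - pairing (lsubmx u) (rsubmx u').
  exact: canonical_formE.
have [[k Ek rep]|[hi rep]] := local_form it; [left|right].
  exists k => //; set y := _ + shift k in Ek *.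
  have e u' : pairing (rsubmx u) (lsubmx u') - pairing (lsubmx u) (rsubmx u') =
     hd (energy y) * (pairing (psum_grad K w (lsubmx y)) (lsubmx u') + pairing (psum_grad K v (rsubmx y)) (rsubmx u')).
    rewrite -canon; apply: etrans (hu _ (sub_local_rep rep) u') _.
    have [U [oU Up CU _]] := rep.
    have dg : differentiable (fun y => h (energy (y + shift k))) (cs_chart i (c t)).
      by have [+ _] := CU 1%N; apply.
    rewrite -(deriveE _ dg).
    have dE : is_derive (cs_chart i (c t)) u' (fun y => energy (y + shift k))
        (pairing (psum_grad K w (lsubmx y)) (lsubmx u') + pairing (psum_grad K v (rsubmx y)) (rsubmx u')).
      have -> : (fun y => energy (y + shift k)) = fun y => psum K.+1 w (lsubmx y + intv k) + psum K.+1 v (rsubmx y + 0).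
        by apply/funext => z; rewrite /energy lsubmx_shift rsubmx_shift.
      rewrite (lsubmx_shift _ k) (rsubmx_shift _ k).
      rewrite -[X in pairing _ X + _]addr0 -[X in _ + pairing _ X]addr0.
      apply: is_derive_add.
        exact: is_derive_psum (is_derive_add (is_derive_lsubmx _ _) (is_derive_cst _ _ _)).
      exact: is_derive_psum (is_derive_add (is_derive_rsubmx _ _) (is_derive_cst _ _ _)).
    have dEd : differentiable (fun y => energy (y + shift k)) (cs_chart i (c t)).
      have := @Ck_energy _ 1 setT (fun y => y + shift k) openT (Cinfty_translation setT _ 1%N).
      by move=> [+ _]; apply.
    by have [_ ->] := is_derive_chain dEd (dh _) dE.
  rewrite /ham_field -[LHS]hsubmxK; congr row_mx; apply: pairing_eq => b.
    have := e (row_mx 0 b); rewrite row_mxKl row_mxKr !pairing0r sub0r add0r => e'.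
    by rewrite pairingC -[LHS]opprK e' pairingZr mulNr (pairingC b).
  have := e (row_mx b 0); rewrite row_mxKl row_mxKr !pairing0r subr0 addr0 => e'.
  by rewrite pairingC e' pairingZr (pairingC b).
split=> //; have e u' : pairing (rsubmx u) (lsubmx u') - pairing (lsubmx u) (rsubmx u') = 0.
  rewrite -canon; apply: etrans (hu _ (sub_local_rep rep) u') _.
  by rewrite diff_cst.
rewrite -[LHS]hsubmxK -[RHS]hsubmxK !linear0; congr row_mx; apply: pairing_eq => b; rewrite pairing0r.
  have := e (row_mx 0 b); rewrite row_mxKl row_mxKr !pairing0r sub0r => e'.
  by rewrite pairingC -[LHS]opprK e' oppr0.
by have := e (row_mx b 0); rewrite row_mxKl row_mxKr !pairing0r subr0 pairingC.
Qed.

(** An orbit on which the Hamiltonian is maximal consists of critical points,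
    so that its coordinates, among which the cosines and sines of the base
    angles, have derivative 0. *)
Lemma max_orbit_constant : (forall t, disc_hamiltonian (c t) = h 1) -> forall t, c t = c 0.
Proof.
move=> hmax.
have u0 t (i : cs_index DM) : cs_dom i (c t) -> is_derive t (1 : R) (cs_chart i \o c) 0.
  move=> it; have [u du [[k Ek uE]|[_ uE]]] := orbit_velocity it; last by rewrite -uE.
  rewrite -(_ : u = 0) // uE /ham_field (_ : hd _ = 0) ?oppr0 ?scale0r ?row_mx0 //.
  set e := energy _ in Ek *.
  have he : h e = h 1.
    rewrite -(hmax t) /disc_hamiltonian -(torus_bundle_chartK it) -(torus_bundle_proj_shift _ k).
    by rewrite torus_hamiltonianE.
  have hom := h_homo.
  have D : is_derive e 1 h 0.
    apply: (@derive1_at_max _ h (e - 1) (e + 1)).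
    - lra.
    - by move=> s _; have [] := dh s.
    - by rewrite in_itv /=; apply/andP; split; lra.
    - move=> s _; rewrite he; have [s1|s1] := leP s 1; first exact: hom.
      by rewrite h_hi //; case/andP: d0 => ? ?; lra.
  by have [_ <-] := dh e; have [_ <-] := D.
have const (phi : torus R n * 'rV[R]_n -> R) (G : 'rV[R]_(n + n) -> R) :
    (forall y, differentiable G y) -> (forall y, phi (torus_bundle_proj y) = G y) ->
    forall t, phi (set_val (c t)) = phi (set_val (c 0)).
  move=> dG phiE t; apply: (@is_derive_0_is_cst _ (fun t => phi (set_val (c t)))) => {}t.
  have [i it] := @mf_cover _ _ DM (c t).
  have := is_derive_along (dG _) (u0 t i it); rewrite linear0.
  apply: near_eq_is_derive; apply: filterS (orbit_chart_near orbit it openT I) => s [si _] /=.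
  by rewrite -phiE; congr phi; exact: (torus_bundle_chartK si).
move=> t; apply: val_inj; have tr i := @const (torus_cos i \o fst) (fun y => cos (2 * pi * y 0 (lshift n i))).
have tr' i := @const (torus_sin i \o fst) (fun y => sin (2 * pi * y 0 (lshift n i))).
have fib i := @const (fun q => q.2 0 i) (fun y => y 0 (rshift n i)).
have dcoord (i : 'I_(n + n)) y : differentiable (fun y : 'rV[R]_(n + n) => y 0 i) y.
  by have [+ _] := Ck_coordR 1 i (@openT ('rV[R]_(n + n))); apply.
have dtrig (g : R -> R) i y : (forall k, Ck k setT g) -> differentiable (fun y : 'rV[R]_(n + n) => g (2 * pi * y 0 i)) y.
  move=> Cg; have : Ck 1 setT (fun y : 'rV[R]_(n + n) => g (2 * pi * y 0 i)).
    apply: (@Ck_comp1 _ _ _ _ setT g (fun y : 'rV[R]_(n + n) => 2 * pi * y 0 i)) => //; first exact: openT.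
    by apply: (@Ck_scale _ _ _ _ _ (fun y : 'rV[R]_(n + n) => y 0 i)); [exact: openT|exact: Ck_coordR openT].
  by move=> [+ _]; apply.
have e1 : (set_val (c t)).1 = (set_val (c 0)).1.
  apply: torus_trig_inj => i.
    apply: tr => y; last by rewrite /= torus_cosE mxE.
    by apply: dtrig => k; have [] := Ck_sin_cos k (@openT R).
  apply: tr' => y; last by rewrite /= torus_sinE mxE.
  by apply: dtrig => k; have [] := Ck_sin_cos k (@openT R).
have e2 : (set_val (c t)).2 = (set_val (c 0)).2.
  by apply/rowP => i; apply: fib => y //=; rewrite mxE.
have pair_eq (a b : torus R n * 'rV[R]_n) : a.1 = b.1 -> a.2 = b.2 -> a = b.
  by case: a b => a1 a2 [b1 b2] /= -> ->.
exact: pair_eq.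
Qed.

(** Near a given time, the lifts are obtained from a chart by a fixed deck
    transformation, by uniqueness. *)
Lemma low_orbit_lift : (forall t, exists2 y, torus_bundle_proj y = set_val (c t) & energy y < 1) ->
  exists y : R -> 'rV[R]_(n + n), forall t : R, [/\ torus_bundle_proj (y t) = set_val (c t), energy (y t) < 1 &
    is_derive t (1 : R) y (ham_field (y t))].
Proof.
move=> low; exists (fun t => s2val (cid2 (low t))) => t.
set Y := fun t => s2val (cid2 (low t)).
have Yp s : torus_bundle_proj (Y s) = set_val (c s) by exact: (s2valP (cid2 (low s))).
have Ye s : energy (Y s) < 1 by exact: (s2valP' (cid2 (low s))).
split; [exact: Yp|exact: Ye|].
have [i it] := @mf_cover _ _ DM (c t).
have uniq y : torus_bundle_proj y = set_val (c t) -> energy y < 1 -> y = Y t.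
  by move=> yp ye; apply: low_energy_lift_unique => //; rewrite Yp.
have [k kE] := torus_bundle_proj_eq (etrans (Yp t) (esym (torus_bundle_chartK it))).
have [u du [[k' Ek uE]|[hi _]]] := orbit_velocity it; last first.
  by have := hi _ (Yp t); rewrite leNgt Ye.
rewrite (uniq _ (etrans (torus_bundle_proj_shift _ _) (torus_bundle_chartK it)) Ek) in uE.
rewrite -[X in ham_field X]/(Y t) -uE.
have oU : open [set z | energy (z + shift k) < 1].
  apply: (@open_comp _ _ (fun z => energy (z + shift k)) [set r | r < 1]); last exact: open_lt.
  move=> z _; apply: (@continuous_comp _ _ _ (fun z => z + shift k) energy); last exact: continuous_energy.
  exact: (Cinfty_translation setT (shift k) 0%N z I).
have Ut : [set z | energy (z + shift k) < 1] (cs_chart i (c t)) by rewrite /= -kE.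
have N : \forall s \near t, cs_chart i (c s) + shift k = Y s.
  apply: filterS (orbit_chart_near orbit it oU Ut) => s [si Us].
  apply: low_energy_lift_unique => //.
  by rewrite Yp torus_bundle_proj_shift; exact: torus_bundle_chartK.
apply: (near_eq_is_derive N).
have [Du E] := is_derive_add du (is_derive_cst (shift k) t (1 : R)).
by apply: DeriveDef; [exact: Du|apply: etrans E _; rewrite addr0].
Qed.

End orbit_equations.

Variables (C mu : R).
Hypothesis mu0 : 0 <= mu.
Hypothesis pairing_bound : forall i j, `|pairing (v j) (w i)| <= mu.
Let beta : R := 2 / K.+1%:R.
Hypothesis hdC : forall e, 0 < e -> hd e <= C * (beta * e `^ (beta - 1)).
Hypothesis Cmu : C * mu * (2 * m%:R) `^ beta < 4.

(** Either the orbit meets the region where the Hamiltonian is maximal, or it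
    lifts to a solution of the canonical equations with constant energy e. For
    hd e = 0 the lift is constant. Otherwise no_short_orbit applies with 2 m
    D^(K+1) = e, and its conclusion contradicts the bounds on hd e and on C mu
    (2 m)^beta. *)
Lemma short_orbit_constant (c : R -> DM) (T : R) :
  hamiltonian_orbit disc_hamiltonian c ->
  0 < T <= 1 -> (forall t, c (t + T) = c t) -> forall t, c t = c 0.
Proof.
move=> orbit /andP[T0 T1] cT.
have sH := smooth_disc_hamiltonian.
have [[t0 hi]|low] := pselect (exists t0, forall y, torus_bundle_proj y = set_val (c t0) -> 1 <= energy y).
  apply: (max_orbit_constant orbit) => t.
  rewrite (orbit_energy orbit sH t) -(orbit_energy orbit sH t0) /disc_hamiltonian.
  by rewrite torus_hamiltonian_hi // => y /hi; case/andP: d0 => ? ?; lra.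
have {}low t : exists2 y, torus_bundle_proj y = set_val (c t) & energy y < 1.
  by have [//|hi] := low_energy_or (set_val (c t)); case: low; exists t.
have [y yP] := low_orbit_lift orbit low.
have yproj t : torus_bundle_proj (y t) = set_val (c t) by have [] := yP t.
have dx t : is_derive t (1 : R) (fun t => lsubmx (y t)) (- hd (energy (y t)) *: psum_grad K v (rsubmx (y t))).
  by have [_ _ /is_derive_lsubmx_row] := yP t; rewrite row_mxKl.
have dp t : is_derive t (1 : R) (fun t => rsubmx (y t)) (hd (energy (y t)) *: psum_grad K w (lsubmx (y t))).
  by have [_ _ /is_derive_rsubmx_row] := yP t; rewrite row_mxKr.
have eE t : energy (y t) = energy (y 0).
  apply: (@is_derive_0_is_cst _ (fun t => energy (y t))) => {}t.
  have [De E] := is_derive_add (is_derive_psum K w (dx t)) (is_derive_psum K v (dp t)).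
  apply: DeriveDef; first exact: De.
  apply: etrans E _; rewrite !pairingZr mulNr addrC (pairingC (psum_grad K v _)) subrr //.
set e := energy (y 0) in eE; have {}dx t := dx t; rewrite {1}/e in eE.
have dy t : is_derive t (1 : R) y (row_mx (- hd e *: psum_grad K v (rsubmx (y t))) (hd e *: psum_grad K w (lsubmx (y t)))).
  by have [_ _] := yP t; rewrite /ham_field eE.
have hde := hd_ge0 e; rewrite le_eqVlt in hde; case/orP: hde => [/eqP hd0|hd0].
  move=> t; apply: val_inj; apply: etrans (esym (yproj t)) _; apply: etrans _ (yproj 0).
  congr torus_bundle_proj; apply/rowP => i.
  apply: (@is_derive_0_is_cst _ (fun t => y t 0 i)) => s.
  have := is_derive_coord i (dy s); rewrite -hd0 oppr0 !scale0r row_mx0 mxE //.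
have e0 : 0 < e.
  rewrite lt_neqAle energy_ge0 // andbT eq_sym; apply/eqP => e0; move: hd0; rewrite e0.
  have N : \forall s \near (0 : R), (cst (0 : R)) s = h s.
    apply: (@filterS _ _ _ [set s : R | s < d]) => [s /ltW sd|]; first by rewrite h_lo.
    by apply: open_nbhs_nbhs; split; [exact: open_lt|case/andP: d0].
  have [_ <-] := dh 0; have [_ ->] := near_eq_is_derive N (is_derive_cst (0 : R) (0 : R) (1 : R)).
  by rewrite ltxx.
have m0 : 0 < 2 * m%:R :> R.
  rewrite mulr_gt0 // ltr0n lt0n; apply/negP => /eqP m0; move: e0; rewrite /e /energy /psum.
  by rewrite !big1 ?addr0 ?ltxx // => i; exfalso; case: i => i /=; rewrite m0 ltn0.
have K0 : K.+1%:R != 0 :> R by rewrite pnatr_eq0.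
pose D := (e / (2 * m%:R)) `^ K.+1%:R^-1.
have q0 : 0 < e / (2 * m%:R) by rewrite divr_gt0.
have D0 : 0 < D by rewrite powR_gt0.
have De : 2 * m%:R * D ^+ K.+1 = e.
  by rewrite -powR_mulrn ?ltW // -powRrM mulVf // powRr1 ?ltW // mulrC divfK // gt_eqF.
have D2 : D ^+ 2 * (2 * m%:R) `^ beta = e `^ beta.
  rewrite -powR_mulrn ?(ltW D0) // -powRrM mulrC (_ : K.+1%:R^-1 * 2%:R = beta); last by rewrite mulrC.
  by rewrite -powRM ?(ltW q0) ?(ltW m0) // mulrC divfK // gt_eqF.
have := @no_short_orbit R n m w v K mu D e T (hd e) oK e0 D0 hd0 mu0 T0 pairing_bound De
  (fun t => lsubmx (y t)) (fun t => rsubmx (y t)).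
have yT : y T = y 0.
  have [_ e1 _] := yP T; have [_ e2 _] := yP 0.
  apply: (low_energy_lift_unique e1 e2).
  by rewrite !yproj -(cT 0) add0r.
have dx' t : is_derive t (1 : R) (fun t => lsubmx (y t)) (- hd e *: psum_grad K v (rsubmx (y t))).
  by have := dx t; rewrite (eE t).
have dp' t : is_derive t (1 : R) (fun t => rsubmx (y t)) (hd e *: psum_grad K w (lsubmx (y t))).
  by have := dp t; rewrite (eE t).
move=> /(_ dx' dp'); rewrite yT => /(_ erefl erefl eE) B.
exfalso; have hde := hdC e0.
have eb : e * e `^ (beta - 1) = e `^ beta.
  by rewrite -{1}(powRr1 (ltW e0)) -powRD ?(gt_eqF e0) ?implybT // addrC subrK.
have B1 : K.+1%:R * hd e * mu * e * T <= K.+1%:R * hd e * mu * e.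
  by rewrite -[leRHS]mulr1 ler_wpM2l // !mulr_ge0 // ltW.
have B2 : K.+1%:R * hd e * mu * e <= 2 * (C * mu * e `^ beta).
  have -> : 2 * (C * mu * e `^ beta) = K.+1%:R * (C * (beta * e `^ (beta - 1))) * mu * e.
    by rewrite -eb /beta; field.
  by rewrite !ler_wpM2r ?(ltW e0) // ler_wpM2l.
have B3 : C * mu * e `^ beta < 4 * D ^+ 2.
  rewrite -D2 (_ : C * mu * (D ^+ 2 * _) = C * mu * (2 * m%:R) `^ beta * D ^+ 2); last by ring.
  by rewrite ltr_pM2r ?exprn_gt0.
lra.
Qed.

Let low_in_disc y : energy y < 1 -> disc_bundle F (torus_bundle_proj y).
Proof.
move=> /(energy_lt1)[_ hp].
by apply/(disc_bundle_flat _ hF hf FE).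
Qed.

(** Half of a shortest integer vector has no lift of norm less than half of
    that of the vector. *)
Lemma disc_hamiltonian_attains : exists q, disc_hamiltonian q = h 1.
Proof.
pose q0 : torus_bundle R n := (torus_proj (2^-1 *: intv k0), 0).
have Dq0 : disc_bundle F q0.
  by apply/(disc_bundle_flat _ hF hf FE) => x x0; rewrite pairing0l; exact: fn_pos.
exists (exist _ q0 (mem_set Dq0)); apply: torus_hamiltonian_hi => // y yq.
rewrite ltNge; apply/negP => Ey; case/andP: d0 => d00 d1.
have [|fy _] := energy_lt1 (y := y); first by apply: le_lt_trans Ey _; lra.
have [k kE] := (torus_proj_int (lsubmx y) (2^-1 *: intv k0)).1 (congr1 fst yq).
have yE : intv (k0 + (k + k)) = 2 *: lsubmx y.
  rewrite kE scalerDr scalerA mulfV // scale1r scaler_nat mulr2n.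
  by apply/rowP => i; rewrite !mxE !intrD.
have f0 : 0 < f (intv k0) by apply: fn_pos => //; rewrite intv_eq0.
have [e|N0] := eqVneq (k0 + (k + k)) 0; last first.
  by have := k0min N0; rewrite yE (fnZ _ _ hf) ger0_norm //; lra.
have k1 : k != 0 by apply/eqP => k1; move: e; rewrite k1 !addr0; exact/eqP.
have : f (intv k0) = 2 * f (intv k).
  rewrite -(fn_sym hf) (_ : - intv k0 = 2 *: intv k).
    by rewrite (fnZ _ _ hf) ger0_norm.
  have -> : k0 = - (k + k) by rewrite -[LHS]subr0 -e opprD addNKr.
  by apply/rowP => i; rewrite !mxE intrN intrD opprK; lra.
have := k0min k1; lra.
Qed.

(** The compact set is the one where energy <= 1 - d, and the open set where
    the function vanishes is a neighbourhood of the point (0, 0). *)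
Lemma disc_hamiltonian_admissible : hz_admissible disc_hamiltonian (h 1).
Proof.
case/andP: (d0) => d00 d1; split.
- exact: smooth_disc_hamiltonian.
- exists (set_val @^-1` core); split.
  + apply: compact_subspace; first exact: core_compact.
    by move=> _ [y Ey <-]; apply: low_in_disc; apply: le_lt_trans Ey _; lra.
  + by rewrite interior_no_boundary.
  + move=> q nq; apply: torus_hamiltonian_hi => // y yq.
    by rewrite ltNge; apply/negP => Ey; apply: nq; exists y.
  + by move=> q; exact: torus_hamiltonian_itv.
- pose i0 : cs_index (torus_bundle R n) := 0 : 'rV[R]_n.
  pose A : set (torus_bundle R n) := [set q | cs_dom i0 q /\
    energy (cs_chart i0 q) < d].
  have oA : open A.
    rewrite openE => q [iq Eq].
    have c1 : {for q, continuous (energy \o cs_chart i0)}.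
      by apply: continuous_comp; [exact: mf_chart_continuous|exact: continuous_energy].
    have N1 : nbhs q (cs_dom i0).
      by apply: open_nbhs_nbhs; split=> //; exact: mf_dom_open.
    have N2 : nbhs q ((energy \o cs_chart i0) @^-1` [set r | r < d]).
      by apply: c1; apply: open_nbhs_nbhs; split=> //; exact: open_lt.
    by apply: filterS2 N1 N2.
  exists (set_val @^-1` A); split.
  + by exists A.
  + have E0 : energy 0 = 0.
      by rewrite /energy /psum !linear0 !big1 ?addr0 // => i _; rewrite pairing0r expr0n.
    have b0 : ball (0 : 'rV[R]_n) 2^-1 0 by apply: ballxx; rewrite invr_gt0.
    have L0 : energy 0 < 1 by rewrite E0.
    exists (exist _ (torus_bundle_proj 0) (mem_set (low_in_disc L0))); split.
      by exists 0 => //=; rewrite linear0.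
    have -> : cs_chart i0 (torus_bundle_proj 0) = 0.
      by rewrite /= !linear0 torus_liftE // row_mx0.
    by rewrite E0.
  + move=> q [iq Eq]; rewrite /disc_hamiltonian -(torus_bundle_chartK iq).
    rewrite torus_hamiltonianE; last by apply: lt_trans Eq _; lra.
    by apply: h_lo; exact: ltW.
- exact: short_orbit_constant.
Qed.

Lemma c_HZ_ge_profile : ((h 1)%:E <= c_HZ DM)%E.
Proof.
apply: ereal_sup_ubound; exists (h 1) => //; exists disc_hamiltonian; split; first exact: disc_hamiltonian_admissible.
exact: disc_hamiltonian_attains.
Qed.

End torus_hamiltonian.

(** * The lower bound for the Hofer-Zehnder capacity *)

Section hofer_zehnder_bound.
Context {R : realType} {n : nat}.

Lemma geometric_small (M q : R) : 0 <= M -> 0 <= q < 1 -> exists a : nat, M * q ^+ a.+1 < 1.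
Proof.
move=> M0 /andP[q0 q1]; have q1' : `|q| < 1 by rewrite ger0_norm.
have M1 : 0 < (M + 1)^-1 by rewrite invr_gt0; lra.
have := (cvgrPdist_lt _ _).1 (cvg_expr q1') _ M1; move=> [N _ HN].
exists N; have := HN N.+1 (leqnSn N); rewrite /= sub0r normrN ger0_norm ?exprn_ge0 // => h.
apply: (@le_lt_trans _ _ ((M + 1) * q ^+ N.+1)).
  by rewrite ler_wpM2r ?exprn_ge0 //; lra.
by rewrite mulrC -ltr_pdivlMr ?mul1r //; lra.
Qed.

Lemma powR_root (a : nat) (x : R) : 0 <= x -> (x `^ a.+1%:R^-1) ^+ a.+1 = x.
Proof.
by move=> x0; rewrite -powR_mulrn ?powR_ge0 // -powRrM mulVf ?pnatr_eq0 // powRr1.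
Qed.

Lemma powR_root_ge (a : nat) (x : R) : 0 <= x <= 1 -> x <= x `^ a.+1%:R^-1.
Proof.
move=> /andP[x0 x1]; rewrite -[leLHS](powR_root a x0); set y := x `^ _.
have y0 : 0 <= y by exact: powR_ge0.
have y1 : y <= 1.
  rewrite leNgt; apply/negP => y1; move: x1; rewrite -(powR_root a x0) -/y leNgt.
  by rewrite exprn_egt1.
by rewrite exprS ler_piMr // exprn_ile1.
Qed.

(** The norming families are chosen first, with mu = 2/(l (1-eta)^2); then the
    exponent K+1 = 2(a+1), so large that (2 m)^beta < (1-eta)^-1 for beta =
    1/(a+1). Hence C = 2 l (1-eta)^3 is allowed, and for small d the maximum h
    1 of the Hamiltonian is at least C (1-eta) >= 2 l (1-4 eta). *)
Lemma c_HZ_disc_bundle_ge (F : torus R n * 'rV[R]_n -> R) (hF : finsler F) f (k0 : 'rV[int]_n) :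
  (0 < n)%N -> flat_norm f -> (forall q x, F (q, x) = f x) -> k0 != 0 ->
  (forall k : 'rV[int]_n, k != 0 -> f (intv k0) <= f (intv k)) ->
  ((2 * f (intv k0))%:E <= c_HZ (disc_cotangent_bundle hF))%E.
Proof.
move=> n0 hf FE k00 k0min; set l := f (intv k0).
have l0 : 0 < l by apply: fn_pos => //; rewrite intv_eq0.
apply/lee_addgt0Pr => e e0.
pose eta := Num.min 2^-1 (e / (8 * l)).
have eta0 : 0 < eta by rewrite lt_min invr_gt0 ltr0n divr_gt0 // mulr_gt0.
have eta2 : eta <= 2^-1 by rewrite ge_min lexx.
have etae : 8 * l * eta <= e by rewrite mulrC -ler_pdivlMr ?mulr_gt0 // ge_min lexx orbT.
have eta1 : 0 < eta < 1 by apply/andP; split => //; lra.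
have [m [w [v [pb sf sb]]]] := norming_families hf n0 l0 eta1.
have q1 : 0 <= 1 - eta < 1 by apply/andP; split; lra.
have q0 : 0 < 1 - eta by lra.
have M0 : 0 <= 2 * m%:R :> R by rewrite mulr_ge0.
have [a aq] := geometric_small M0 q1.
pose K := (a.+1 + a)%N.
have oK : odd K by rewrite /K addSn /= addnn odd_double.
pose beta : R := 2 / K.+1%:R.
have betaE : beta = a.+1%:R^-1.
  rewrite /beta /K -addnS addnn -muln2 natrM invfM mulrCA mulfV ?mulr1 //.
have beta0 : 0 < beta by rewrite betaE invr_gt0.
pose C := 2 * l * (1 - eta) ^+ 3.
have C0 : 0 < C by rewrite !mulr_gt0 // exprn_gt0.
pose s := eta / 2.
have s01 : 0 < s by rewrite divr_gt0.
pose d := s ^+ a.+1 / 2.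
have sa0 : 0 < s ^+ a.+1 by rewrite exprn_gt0.
have sas : s ^+ a.+1 <= s.
  by rewrite exprS ler_piMr ?(ltW s01) // exprn_ile1 ?(ltW s01) //; rewrite /s; lra.
have d0 : 0 < d < 4^-1 by apply/andP; split; rewrite /d; [lra|rewrite /s in sas; lra].
have [h [hd [hs dh hdb [hlo hhi] h1]]] := smooth_profile beta0 C0 d0.
have : ((h 1)%:E <= c_HZ (disc_cotangent_bundle hF))%E.
  apply: (@c_HZ_ge_profile R n m f k0 w v K hf k00 oK k0min sb sf h hd d d0 hs dh _ hlo hhi F hF FE C
    (2 / l / (1 - eta) ^+ 2) _ pb).
  - by move=> E; have [] := hdb E.
  - by rewrite divr_ge0 ?exprn_ge0 // ?(ltW q0) // divr_ge0 // ltW.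
  - by move=> E E0; have [_] := hdb E; apply.
  - rewrite -/beta; have -> : C * (2 / l / (1 - eta) ^+ 2) = 4 * (1 - eta).
      by rewrite /C; field; rewrite !gt_eqF.
    have X : ((1 - eta) * (2 * m%:R) `^ beta) ^+ a.+1 < 1.
      by rewrite exprMn betaE powR_root // mulrC.
    rewrite -mulrA -[ltRHS]mulr1 ltr_pM2l // ltNge; apply/negP => X1.
    by move: X; rewrite ltNge => /negP; apply; apply: exprn_ege1.
have p1 : (2 * d) `^ beta = s.
  have -> : 2 * d = s ^+ a.+1 by rewrite /d mulrC divfK.
  by rewrite -powR_mulrn ?(ltW s01) // -powRrM betaE mulfV ?pnatr_eq0 // powRr1 // ltW.
have p2 : 1 - 2 * d <= (1 - 2 * d) `^ beta.
  by rewrite betaE; apply: powR_root_ge; case/andP: d0 => ? ?; apply/andP; split; lra.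
have pd : 1 - eta <= (1 - 2 * d) `^ beta - (2 * d) `^ beta.
  rewrite p1; apply: le_trans (lerB p2 (lexx s)); rewrite /d.
  have -> : eta = s + s by rewrite /s; lra.
  lra.
have low : 2 * l - e <= h 1.
  apply: le_trans h1; apply: (@le_trans _ _ (C * (1 - eta))); last by rewrite ler_pM2l.
  have b2 : (1 - 2 * eta) <= (1 - eta) ^+ 2 by have := sqr_ge0 eta; rewrite sqrrB expr1n mul1r; lra.
  have b4 : 1 - 4 * eta <= (1 - eta) ^+ 2 * (1 - eta) ^+ 2.
    apply: (@le_trans _ _ ((1 - 2 * eta) * (1 - 2 * eta))).
      by have := sqr_ge0 eta; rewrite expr2; lra.
    by apply: ler_pM => //; lra.
  have -> : C * (1 - eta) = 2 * l * ((1 - eta) ^+ 2 * (1 - eta) ^+ 2) by rewrite /C; ring.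
  apply: (@le_trans _ _ (2 * l * (1 - 4 * eta))); first by lra.
  by rewrite ler_pM2l // mulr_gt0.
move=> hz; rewrite -leeBlDr // -EFinB; apply: le_trans hz; by rewrite lee_fin.
Qed.

End hofer_zehnder_bound.


Theorem theorem1p1 (R : realType) (n : nat) (n_ge1 : (1 <= n)%N)
    (F : torus R n * 'rV[R]_n -> R) (F_finsler : finsler F)
    (F_flat : flat F) (F_reversible : reversible F)
    (c : symplectic_manifold R (n + n) -> \bar R)
    (c_capacity : symplectic_capacity c) :
  (c (disc_cotangent_bundle F_finsler) <= (2 * systole F)%:E)%E /\
  ((exists G : torus R n * 'rV[R]_n -> R,
      [/\ finsler G, induced_by_flat_metric G,
          forall z, G z <= F z & systole F = systole G]) \/
   (forall M : symplectic_manifold R (n + n), (c_HZ M <= c M)%E) ->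
   c (disc_cotangent_bundle F_finsler) = (2 * systole F)%:E).
Proof.
have [f hf FE] := flat_finsler_norm F_finsler F_flat F_reversible.
have [k [k0 kmin] upper] := capacity_disc_bundle_le F_finsler n_ge1 hf FE c_capacity.
have sysE := systole_flat hf FE k0 kmin.
split=> [|lower]; first by rewrite sysE.
apply/eqP; rewrite eq_le; apply/andP; split; first by rewrite sysE.
case: lower => [metric|hz]; first exact: (capacity_ge_case_metric F_finsler n_ge1 hf FE).
by apply: le_trans (hz _); rewrite sysE; exact: c_HZ_disc_bundle_ge.
Qed.
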